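(* Let $\varepsilon_h\to 0^+$, $u_h\in L^1(\Omega)$ and $\rho_h\in L^1(\Omega,[0,\infty))$ be sequences such that $$\sup_h\left\|\frac{\rho_h}{\ln\varepsilon_h}\right\|_{L^1(\Omega)}<\infty\qquad\text{and}\qquad \sup_h F_{\varepsilon_h}(u_h,\rho_h)<\infty .$$ Then, up to subsequences, $u_h$ converges in $L^1(\Omega)$ to some $u\in BV(\Omega,\{\alpha,\beta\})$ and $\frac{\rho_h}{|\ln\varepsilon_h|}\mathcal{L}^N$ converges in the weak$^*$ sense to some $\mu\in\mathcal{M}_+(\Omega)$.
   Context: Let $N\ge 2$ and let $\Omega\subset\mathbb{R}^N$ be a bounded regular domain. Fix $\alpha,\beta\in\mathbb{R}$ with $\alpha<\beta$ and a potential $W:\mathbb{R}\to[0,+\infty)$ such that $W(s)=0$ if and only if $s\in\{\alpha,\beta\}$, and $W$ has at least linear growth at $\pm\infty$. For $\varepsilon>0$, $u\in L^1(\Omega)$ and $\rho\in L^1(\Omega,[0,\infty))$ define, with values in $[0,+\infty]$, $$F_\varepsilon(u,\rho):=\frac1\varepsilon\int_\Omega W(u)\,dx+\frac{1}{|\ln\varepsilon|}\int_\Omega\int_\Omega\frac{(u(y)-u(x))^2}{|y-x|^{N+1}}\,dy\,dx+\frac{1}{|\ln\varepsilon|}\int_\Omega\left|\int_\Omega\frac{(u(y)-u(x))^2}{|y-x|^{N+1}}\,dy-\rho(x)\right|dx .$$ $\mathcal{M}_+(\Omega)$ is the space of non-negative Radon measures on $\Omega$; weak$^*$ convergence of $\mu_h$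 to $\mu$ means $\int_\Omega\varphi\,d\mu_h\to\int_\Omega\varphi\,d\mu$ for all $\varphi\in C_c(\Omega)$. $\mathcal{L}^N$ is Lebesgue measure. $BV(\Omega,\{\alpha,\beta\})$ is the set of functions of bounded variation on $\Omega$ taking values in $\{\alpha,\beta\}$ almost everywhere.
   Formalization: The potential W is assumed continuous; without it the claim fails, e.g. W(s)=|s-γ| except W(α)=W(β)=0 and W(γ)=1, for some γ outside {α,β}, with u_h=γ+ε_h and ρ_h=0. *)

(* Defs.v *)
From HB Require Import structures.
From mathcomp Require Import all_boot all_order all_algebra.
From mathcomp Require Import all_classical all_reals all_analysis.
From mathcomp Require Import measurable_realfun.

Set Implicit Arguments.
Unset Strict Implicit.
Unset Printing Implicit Defensive.

Import Order.TTheory GRing.Theory Num.Theory.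
Import numFieldNormedType.Exports.

Local Open Scope classical_set_scope.
Local Open Scope ring_scope.

(* ['rV[R]_n] is measured by its Borel sigma-algebra. *)
Section borel_rV.
Context {R : realType} (n : nat).

Definition borel_rV : set (set 'rV[R]_n) := <<s @open 'rV[R]_n >>.

Let borel_rV0 : borel_rV set0. Proof. exact: sigma_algebra0. Qed.
Let borel_rVC A : borel_rV A -> borel_rV (~` A).
Proof. exact: sigma_algebraC. Qed.
Let borel_rV_bigcup (F : (set 'rV[R]_n)^nat) :
  (forall i, borel_rV (F i)) -> borel_rV (\bigcup_i F i).
Proof. exact: sigma_algebra_bigcup. Qed.

HB.instance Definition _ := @isMeasurable.Build (sigma_display (@open 'rV[R]_n))
  'rV[R]_n borel_rV borel_rV0 borel_rVC borel_rV_bigcup.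

End borel_rV.

Section glue.
Context {R : realType}.

Lemma open_measurable_rV m (A : set 'rV[R]_m) : open A -> measurable A.
Proof. by move=> oA; exact: sub_sigma_algebra. Qed.

Lemma continuous_measurable_rV m (f : 'rV[R]_m -> R) :
  continuous f -> measurable_fun [set: 'rV[R]_m] f.
Proof.
move=> /continuousP cf; apply: (measurability _ (RGenOpens.measurableE R)).
move=> _ [_ [a [b ->] <-]]; rewrite setTI; apply: open_measurable_rV.
exact/cf/interval_open.
Qed.

Context (n : nat).
Local Notation T := (R * 'rV[R]_n)%type.

Definition glue (p : T) : 'rV[R]_n.+1 := row_mx (p.1%:M : 'rV_1) p.2.

Definition unglue (x : 'rV[R]_n.+1) : T :=
  (x ord0 ord0, rsubmx (x : 'rV_(1 + n))).

Lemma glueEl p : glue p ord0 ord0 = p.1.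
Proof.
have -> : ord0 = lshift n ord0 :> 'I_(1 + n) by exact: val_inj.
by apply: (etrans (row_mxEl _ _ _ _)); rewrite mxE eqxx.
Qed.

Lemma glueEr p (j : 'I_n) : glue p ord0 (rshift 1 j) = p.2 ord0 j.
Proof. exact: row_mxEr. Qed.

Lemma glueK : cancel glue unglue.
Proof.
by move=> [a x]; rewrite /unglue glueEl /glue row_mxKr.
Qed.

Lemma unglueK : cancel unglue glue.
Proof.
move=> x; apply/rowP => i; case: (@split_ordP 1 n i) => j ->.
  rewrite (_ : lshift n j = ord0) ?glueEl//.
  by apply: val_inj; rewrite /= ord1.
by rewrite glueEr mxE.
Qed.

Lemma measurable_glue_coord (i : 'I_(1 + n)) :
  measurable_fun [set: T] (fun p => glue p ord0 i).
Proof.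
case: (split_ordP i) => j ->.
  rewrite (_ : (fun _ => _) = fst); first exact: measurable_fst.
  apply/funext => p; rewrite -glueEl; congr (glue _ _ _); apply: val_inj.
  by rewrite /= ord1.
rewrite (_ : (fun _ => _) = (fun x : 'rV[R]_n => x ord0 j) \o snd); last first.
  by apply/funext => p; exact: glueEr.
apply: measurableT_comp; last exact: measurable_snd.
by apply: continuous_measurable_rV => x; exact: coord_continuous.
Qed.

Lemma measurable_glue : measurable_fun [set: T] glue.
Proof.
apply: (@measurability _ _ _ _ _ _ (@open 'rV[R]_n.+1)) => // _ [U oU <-].
rewrite setTI.
pose B (q : 'rV[rat]_n.+1 * nat) : set 'rV[R]_n.+1 :=
  ball (map_mx ratr q.1 : 'rV[R]_n.+1) (q.2.+1%:R^-1 : R).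
pose F q := if `[< B q `<=` U >] then glue @^-1` B q else set0.
rewrite (_ : _ @^-1` _ = \bigcup_(q : 'rV[rat]_n.+1 * nat) F q); last first.
  apply/seteqP; split => [p Up|p [q _]]; last first.
    by rewrite /F; case: asboolP => // + Bp; apply.
  have /nbhs_ballP[e /= e0 eU] := open_nbhs_nbhs (conj oU Up).
  have [k ke] : exists k : nat, k.+1%:R^-1 < e / 2.
    have e20 : 0 < e / 2 by rewrite divr_gt0.
    have [k _ kP] := near_infty_natSinv_lt (PosNum e20).
    by exists k; exact: (kP k (leqnn k)).
  set d : R := k.+1%:R^-1 in ke.
  have d0 : 0 < d by rewrite invr_gt0.
  have qP (i : 'I_n.+1) :
      {q : rat | ratr q \in `](glue p ord0 i - d), (glue p ord0 i + d)[}.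
    by apply/cid/rat_in_itvoo; rewrite ltrBlDr -addrA ltrDl addr_gt0.
  have [f fP] : exists f : 'I_n.+1 -> rat, forall i,
      ratr (f i) \in `](glue p ord0 i - d), (glue p ord0 i + d)[.
    by exists (fun i => sval (qP i)) => i; exact: (svalP (qP i)).
  exists (\row_i f i, k) => //.
  have Bp : B (\row_i f i, k) (glue p).
    split => [|i j]; first by rewrite invr_gt0.
    rewrite !ord1; have -> : map_mx ratr (\row_i f i) ord0 j = ratr (f j) :> R.
      by rewrite !mxE.
    by rewrite /ball/= ltr_distl; have := fP j; rewrite in_itv.
  rewrite /F asboolT// => y By; apply: eU.
  apply: (@ball_splitr _ _ (map_mx ratr (\row_i f i) : 'rV[R]_n.+1)).
    exact: le_ball (ltW ke) _ Bp.
  exact: le_ball (ltW ke) _ By.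
apply: countable_bigcupT_measurable => // q; rewrite /F.
case: asboolP => // _.
rewrite (_ : _ @^-1` _ = \bigcap_(i in [set: 'I_n.+1])
   ((fun p => glue p ord0 i) @^-1` ball (ratr (q.1 ord0 i) : R) q.2.+1%:R^-1)).
  apply: fin_bigcap_measurable => // i _; rewrite -[X in measurable X]setTI.
  apply: measurable_glue_coord => //.
  by apply: open_measurable; apply: ball_open; rewrite invr_gt0.
apply/seteqP; split => [p [_ h] i _|p h].
  by have := h ord0 i; rewrite mxE.
by split; [|move=> i j; rewrite ord1 mxE; exact: h].
Qed.

Lemma measurable_unglue : measurable_fun [set: 'rV[R]_n.+1] unglue.
Proof.
apply/measurable_fun_pairP; split.
  by apply: continuous_measurable_rV => x; exact: coord_continuous.
apply: (@measurability _ _ _ _ _ _ (@open 'rV[R]_n)) => // _ [U oU <-].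
rewrite setTI; apply: open_measurable_rV.
apply: open_comp oU => x _ A /nbhs_ballP[e /= e0 eA].
apply/nbhs_ballP; exists e => //= y [_ xy]; apply: eA; split => // i j.
by rewrite !mxE; exact: xy.
Qed.

End glue.

Section lebesgue_step.
Context {R : realType} (n : nat).
Variable m : {sigma_finite_measure set 'rV[R]_n -> \bar R}.

Definition lebesgue_step : set 'rV[R]_n.+1 -> \bar R :=
  pushforward (lebesgue_measure \x m)%E (@glue R n).

Let lebesgue_step0 : lebesgue_step set0 = 0%E.
Proof. by rewrite /lebesgue_step /pushforward preimage_set0 measure0. Qed.

Let lebesgue_step_ge0 A : (0 <= lebesgue_step A)%E.
Proof. by rewrite /lebesgue_step /pushforward. Qed.

Let lebesgue_step_sigma_additive : semi_sigma_additive lebesgue_step.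
Proof.
have mg A : measurable A -> measurable (@glue R n @^-1` A).
  by move=> mA; rewrite -[X in measurable X]setTI; exact: measurable_glue.
move=> F mF tF mUF; rewrite /lebesgue_step /pushforward preimage_bigcup.
apply: measure_semi_sigma_additive.
- by move=> k; exact: mg.
- apply/trivIsetP => /= i j _ _ ij; rewrite -preimage_setI.
  by move/trivIsetP : tF => /(_ _ _ _ _ ij) ->//; rewrite preimage_set0.
- by rewrite -preimage_bigcup; exact: mg.
Qed.

HB.instance Definition _ := isMeasure.Build _ _ _ lebesgue_step
  lebesgue_step0 lebesgue_step_ge0 lebesgue_step_sigma_additive.

Let lebesgue_step_sigma_finite : sigma_finite setT lebesgue_step.
Proof.
have /sigma_finiteP[F [TF ndF Foo]] := sigma_finiteT (@lebesgue_measure R).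
have /sigma_finiteP[G [TG ndG Goo]] := sigma_finiteT m.
exists (fun k => @unglue R n @^-1` (F k `*` G k)).
  rewrite -preimage_bigcup (_ : \bigcup_k _ = setT) ?preimage_setT//.
  apply/seteqP; split => // -[x y] _.
  have [i _ Fix] : (\bigcup_k F k) x by rewrite -TF.
  have [j _ Gjy] : (\bigcup_k G k) y by rewrite -TG.
  exists (maxn i j) => //; split.
  - by move: x Fix; exact/subsetPset/ndF/leq_maxl.
  - by move: y Gjy; exact/subsetPset/ndG/leq_maxr.
move=> k; have [mF Fk] := Foo k; have [mG Gk] := Goo k; split.
  rewrite -[X in measurable X]setTI; apply: measurable_unglue => //.
  exact: measurableX.
rewrite /lebesgue_step /pushforward -comp_preimage.
rewrite (_ : _ \o _ = id); last by apply/funext => p /=; rewrite glueK.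
by rewrite preimage_id product_measure1E// lte_mul_pinfty// ge0_fin_numE.
Qed.

HB.instance Definition _ := Measure_isSigmaFinite.Build _ _ _ lebesgue_step
  lebesgue_step_sigma_finite.

End lebesgue_step.

(* Lebesgue measure on ['rV[R]_n], as an iterated product carried over by [glue];
   [lebesgue_rV_box] gives its value on boxes, which determines it. *)
Fixpoint lebesgue_rV {R : realType} (n : nat) :
    {sigma_finite_measure set 'rV[R]_n -> \bar R} :=
  match n with
  | 0%N => \d_(0 : 'rV[R]_0)
  | n'.+1 => lebesgue_step (lebesgue_rV n')
  end.

Lemma lebesgue_rV_box {R : realType} (n : nat) (A : 'I_n -> set R) :
  (forall i, measurable (A i)) ->
  lebesgue_rV n [set x | forall i, A i (x ord0 i)] =
  (\prod_(i < n) lebesgue_measure (A i))%E.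
Proof.
elim: n A => [|n IH] A mA.
  by rewrite big_ord0 /= diracE mem_set// => -[].
have mB : measurable
    [set x : 'rV[R]_n | forall i, A (lift ord0 i) (x ord0 i)].
  rewrite (_ : [set _ | _] = \bigcap_(i in [set: 'I_n])
      ((fun x : 'rV[R]_n => x ord0 i) @^-1` A (lift ord0 i))); last first.
    by apply/seteqP; split => [x h i _|x h i]; exact: h.
  apply: fin_bigcap_measurable => // i _; rewrite -[X in measurable X]setTI.
  by apply: continuous_measurable_rV => // x; exact: coord_continuous.
have liftE (j : 'I_n) : lift ord0 j = rshift 1 j :> 'I_(1 + n).
  exact: val_inj.
rewrite big_ord_recl -IH// -product_measure1E//=.
rewrite /lebesgue_step /pushforward; congr (product_measure1 _ _ _).
apply/seteqP; split => [p h|p [h0 h] i]; rewrite /= in h *.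
  split; first by rewrite -glueEl; exact: h.
  by move=> i; rewrite /= -glueEr -liftE; exact: h.
case: (unliftP ord0 i) => [j|] ->; last by rewrite glueEl.
by rewrite {2}liftE glueEr; exact: h.
exact: (mA ord0).
Qed.

Section euclidean.
Context {R : realType} {N : nat}.
Implicit Types x y nu : 'rV[R]_N.

(* The library norm on ['rV[R]_N] is the sup norm; [enorm] is the Euclidean one. *)
Definition edot x y : R := \sum_(i < N) x ord0 i * y ord0 i.
Definition enorm x : R := Num.sqrt (edot x x).

(* Near each boundary point, [Omega] is the strict epigraph, in the direction of
   a unit vector [nu], of a Lipschitz function [g] of the orthogonal projection
   on the hyperplane normal to [nu]. *)
Definition lipschitz_boundary (Omega : set 'rV[R]_N) :=
  forall x0, (closure Omega `\` Omega°) x0 ->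
  exists (nu : 'rV[R]_N) (g : 'rV[R]_N -> R) (k : R),
    [/\ enorm nu = 1, k.-lipschitz g &
      \forall x \near x0, Omega x <-> g (x - edot x nu *: nu) < edot x nu].

Definition regular_bounded_domain (Omega : set 'rV[R]_N) :=
  [/\ open Omega, connected Omega, Omega !=set0, bounded_set Omega &
      lipschitz_boundary Omega].

End euclidean.

Section function_spaces.
Context {R : realType} {N : nat}.
Variable Omega : set 'rV[R]_N.
Local Notation leb := (@lebesgue_rV R N).

Definition in_L1 (f : 'rV[R]_N -> R) := leb.-integrable Omega (EFin \o f).

Definition L1_norm (f : 'rV[R]_N -> R) : \bar R :=
  (\int[leb]_(x in Omega) `|(f x)%:E|)%E.

Definition compactly_supported {V : normedModType R} (phi : 'rV[R]_N -> V) :=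
  let supp := closure [set x | phi x != 0] in
  compact supp /\ supp `<=` Omega.

Definition partial {V : normedModType R} (i : 'I_N) (phi : 'rV[R]_N -> V) :
  'rV[R]_N -> V := 'D_(delta_mx ord0 i) phi.

Definition C1 {V : normedModType R} (phi : 'rV[R]_N -> V) :=
  forall i, (forall x, derivable phi x (delta_mx ord0 i)) /\
            continuous (partial i phi).

Definition divergence (phi : 'rV[R]_N -> 'rV[R]_N) (x : 'rV[R]_N) : R :=
  \sum_(i < N) partial i phi x ord0 i.

Definition variation (f : 'rV[R]_N -> R) : \bar R :=
  ereal_sup [set (\int[leb]_(x in Omega) (f x * divergence phi x)%:E)%E |
    phi in [set phi : 'rV[R]_N -> 'rV[R]_N |
      [/\ C1 phi, compactly_supported phi & forall x, enorm (phi x) <= 1]]].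

Definition in_BV (f : 'rV[R]_N -> R) := in_L1 f /\ (variation f < +oo)%E.

Definition in_BV_pair (a b : R) (f : 'rV[R]_N -> R) :=
  in_BV f /\ {ae leb, forall x, Omega x -> f x = a \/ f x = b}.

(* A non-negative Radon measure on the open set [Omega], extended by zero
   outside [Omega]. *)
Definition radon (mu : {measure set 'rV[R]_N -> \bar R}) :=
  mu (~` Omega) = 0%E /\
  forall K, compact K -> K `<=` Omega -> (mu K < +oo)%E.

(* The measure [f * L^N] on [Omega]. *)
Definition density (f : 'rV[R]_N -> R) (A : set 'rV[R]_N) : \bar R :=
  (\int[leb]_(x in Omega `&` A) (f x)%:E)%E.

Definition weak_star_cvg (mu_ : nat -> set 'rV[R]_N -> \bar R)
    (mu : set 'rV[R]_N -> \bar R) :=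
  forall phi : 'rV[R]_N -> R, continuous phi -> compactly_supported phi ->
    (\int[mu_ h]_(x in Omega) (phi x)%:E)%E @[h --> \oo] -->
    (\int[mu]_(x in Omega) (phi x)%:E)%E.

End function_spaces.

Section energy.
Context {R : realType} {N : nat}.
Variables (W : R -> R) (Omega : set 'rV[R]_N).
Local Notation leb := (@lebesgue_rV R N).
Local Open Scope ereal_scope.

Definition fractional_density (u : 'rV[R]_N -> R) (x : 'rV[R]_N) : \bar R :=
  \int[leb]_(y in Omega) ((u y - u x) ^+ 2 / enorm (y - x) ^+ N.+1)%:E.

(* At [eps = 1], where the mathematical expression is undefined, the factor
   [`|ln eps|^-1] is [0]; this is harmless along sequences tending to [0]. *)
Definition energy (eps : R) (u rho : 'rV[R]_N -> R) : \bar R :=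
  (eps^-1)%:E * (\int[leb]_(x in Omega) (W (u x))%:E) +
  (`|ln eps|^-1)%:E * (\int[leb]_(x in Omega) fractional_density u x) +
  (`|ln eps|^-1)%:E *
    (\int[leb]_(x in Omega) `|fractional_density u x - (rho x)%:E|).

End energy.

(* Main.v *)
From HB Require Import structures.
Require Import Defs.
From mathcomp Require Import all_boot all_order all_algebra.
From mathcomp Require Import all_classical all_reals all_analysis.
From mathcomp Require Import measurable_realfun ring lra.

Set Implicit Arguments.
Unset Strict Implicit.
Unset Printing Implicit Defensive.

Import Order.TTheory GRing.Theory Num.Theory.
Import numFieldNormedType.Exports.

Local Open Scope classical_set_scope.
Local Open Scope ring_scope.

(** The functions. Let [m] be the midpoint of the two wells and [E_h] the part of
[Omega] where [u h > m]. Since the potential vanishes only at the wells and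
grows at least linearly, [u h] is close in L1 to the function equal to [beta]
on [E_h] and to [alpha] elsewhere ([well_dist_le], [well_approximation]), so
that only the sets [E_h] matter.

The kernel [|y - x| ^- (N + 1)] gives about the same weight to all dyadic
scales: between [eps] and its square root there are about [|ln eps|] dyadic
shells, and the double integral is at most [C |ln eps|], so some scale [r] in
that range carries a bounded energy ([good_scale]). At this scale two points
where [u h] takes values on both sides of [m], one of these values outside a
fixed band around [m], cost at least a multiple of [r ^- (N + 1)], while the
set where [u h] is in the band has measure [O(eps)], hence [O(r)]. Averaging over the shell bounds the L1 norm of
[1_E (x + z) - 1_E x] by [C r] for [|z| <= r / 8], and splitting a longer
translation into short steps bounds it by [C (8 |z| + r)]
([energy_shift_estimate]). As [r] tends to 0 with [eps], this is in the limit
a bound linear in [|z|].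

Such a bound has two consequences. First, the indicators are close in L1 to
their mollifications at a fixed small radius; the latter converge pointwise as
soon as the measures with densities [1_(E_h)] converge weakly, so the indicators
form a Cauchy sequence in L1 ([shift_compactness]). Second, the limit set has
finite perimeter: in the integral of the divergence of a test field against the
indicator, derivatives are limits of difference quotients, and a change of
variables moves these from the field to the indicator ([variation_le]).

The measures. The measures with densities [1_(E_h)] and [rho h / |ln (eps h)|]
have bounded mass and live on a cube, where weak limits exist along
subsequences ([prokhorov_cube]). A Peano curve maps [0, 1] onto the cube
and has a Borel right inverse, so that measures on the cube lift to measures
on [0, 1]; there one extracts with the Helly selection theorem on distribution
functions ([helly]), and the curve carries the limit back to the cube. *)

(** * Preliminaries *)

Lemma natSinv_lt {R : realType} (e : R) : 0 < e -> exists k : nat, k.+1%:R^-1 < e.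
Proof.
move=> e0; have [k _ kP] := near_infty_natSinv_lt (PosNum e0).
by exists k; exact: (kP k (leqnn k)).
Qed.

Lemma subseq_ge_id (f : nat -> nat) : {homo f : i j / (i < j)%N} ->
  forall k, (k <= f k)%N.
Proof. by move=> fi; elim=> // k IH; exact: leq_ltn_trans IH (fi _ _ _). Qed.

Lemma subseq_cvgy (f : nat -> nat) : {homo f : i j / (i < j)%N} ->
  f k @[k --> \oo] --> \oo.
Proof.
move=> fi A [N _ NA]; exists N => // k /= Nk; apply: NA => /=.
exact: leq_trans Nk (subseq_ge_id fi k).
Qed.

Lemma bounded_cvg_subseq {R : realType} (u : nat -> R) (M : R) :
  (forall k, `|u k| <= M) ->
  exists2 f : nat -> nat, {homo f : i j / (i < j)%N} & cvgn (fun k => u (f k)).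
Proof.
move=> uM; have [|f fi fc] := @bolzano_weierstrass R u.
  by exists M; split; [exact: num_real|move=> x Mx n _; exact: le_trans (uM n) (ltW Mx)].
exists f => // i j ij; rewrite ltnNge; apply/negP => fji.
by have := fi j i; rewrite leEnat fji => /esym; rewrite leqNgt ij.
Qed.

Lemma cvge0P {R : realType} (a : nat -> \bar R) : (forall k, (0 <= a k)%E) ->
  (forall e : R, 0 < e -> \forall k \near \oo, (a k <= e%:E)%E) ->
  a k @[k --> \oo] --> 0%E.
Proof.
move=> a0 ae; have fa e k : (a k <= e%:E)%E -> a k \is a fin_num.
  by move=> h; rewrite ge0_fin_numE// (le_lt_trans h)// ltry.
apply/fine_cvgP; split; first by apply: filterS (ae 1 ltr01) => k; exact: fa.
apply/cvgrPdist_le => e e0; apply: filterS (ae e e0) => k ak.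
by rewrite sub0r normrN ger0_norm ?fine_ge0// -lee_fin fineK// (fa e).
Qed.

Lemma bounded_integrable {R : realType} d (T : measurableType d)
    (mu : {measure set T -> \bar R}) (A : set T) (f : T -> R) (C : R) :
  measurable A -> (mu A < +oo)%E -> measurable_fun A f ->
  (forall x, A x -> `|f x| <= C) -> mu.-integrable A (EFin \o f).
Proof.
move=> mA Aoo mf fC; apply: measurable_bounded_integrable => //.
by exists C; split; [exact: num_real|move=> y Cy x Ax; exact: le_trans (fC x Ax) (ltW Cy)].
Qed.

Lemma dist_indic {R : realType} T (E F : set T) (x : T) :
  `|\1_E x - \1_F x| = \1_(E `+` F) x :> R.
Proof.
rewrite !indicE /setY in_setU !in_setD.
by case: (x \in E); case: (x \in F) => /=;
  rewrite ?subrr ?subr0 ?sub0r ?normrN ?normr0 ?normr1.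
Qed.

Lemma measurable_symdiff d (T : measurableType d) (E F : set T) :
  measurable E -> measurable F -> measurable (E `+` F).
Proof. by move=> mE mF; apply: measurableU; exact: measurableD. Qed.

Lemma measurable_superlevel {R : realType} d (T : measurableType d) (D : set T)
    (u : T -> R) (m : R) : measurable D -> measurable_fun D u ->
  measurable (D `&` [set x | m < u x]).
Proof.
move=> mD mu; have -> : [set x | m < u x] = u @^-1` `]m, +oo[%classic.
  by apply/seteqP; split => x /=; rewrite in_itv/= andbT.
exact: mu.
Qed.

(** * Borel sets and Lebesgue measure of row vectors *)

(** Names the canonical measure on [pushforward m f], which type inference cannot
find because it depends on the proof [mf]. *)
Definition image_measure {R : realType} d d' (T1 : measurableType d)
    (T2 : measurableType d') (m : {measure set T1 -> \bar R}) (f : T1 -> T2)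
    (mf : measurable_fun setT f) : {measure set T2 -> \bar R} :=
  measure_function_pushforward__canonical__measure_function_Measure m mf.

Section borel_rV_theory.
Context {R : realType}.

(** An open set is a countable union of sup-norm balls with rational centres and
radii, and belonging to such a ball is a condition on each coordinate. *)
Lemma measurable_rV_coord d (T : measurableType d) n (D : set T)
    (f : T -> 'rV[R]_n) :
  measurable D ->
  (forall i, measurable_fun D (fun t => f t ord0 i)) -> measurable_fun D f.
Proof.
move=> mD mf.
apply: (@measurability _ _ _ _ _ _ (@open 'rV[R]_n)) => // _ [U oU <-].
pose B (q : 'rV[rat]_n * nat) : set 'rV[R]_n :=
  ball (map_mx ratr q.1 : 'rV[R]_n) (q.2.+1%:R^-1 : R).
pose F q := if `[< B q `<=` U >] then D `&` f @^-1` B q else set0.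
rewrite (_ : _ `&` _ = \bigcup_(q : 'rV[rat]_n * nat) F q); last first.
  apply/seteqP; split => [p [Dp Up]|p [q _]]; last first.
    by rewrite /F; case: asboolP => // bU [? Bp]; split=> //; exact: bU.
  have /nbhs_ballP[e /= e0 eU] := open_nbhs_nbhs (conj oU Up).
  have [k ke] := natSinv_lt (divr_gt0 e0 (ltr0Sn R 1)).
  set d' : R := k.+1%:R^-1 in ke.
  have d0 : 0 < d' by rewrite invr_gt0.
  have qP (i : 'I_n) :
      {q : rat | ratr q \in `](f p ord0 i - d'), (f p ord0 i + d')[}.
    by apply/cid/rat_in_itvoo; rewrite ltrBlDr -addrA ltrDl addr_gt0.
  have [g gP] : exists g : 'I_n -> rat, forall i,
      ratr (g i) \in `](f p ord0 i - d'), (f p ord0 i + d')[.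
    by exists (fun i => sval (qP i)) => i; exact: (svalP (qP i)).
  exists (\row_i g i, k) => //.
  have Bp : B (\row_i g i, k) (f p).
    split => [|i j]; first by rewrite invr_gt0.
    rewrite !ord1; have -> : map_mx ratr (\row_i g i) ord0 j = ratr (g j) :> R.
      by rewrite !mxE.
    by rewrite /ball/= ltr_distl; have := gP j; rewrite in_itv.
  rewrite /F asboolT// => y By; apply: eU.
  apply: (@ball_splitr _ _ (map_mx ratr (\row_i g i) : 'rV[R]_n)).
    exact: le_ball (ltW ke) _ Bp.
  exact: le_ball (ltW ke) _ By.
apply: countable_bigcupT_measurable => // q; rewrite /F.
case: asboolP => // _.
rewrite (_ : _ `&` _ = D `&` \bigcap_(i in [set: 'I_n])
   (D `&` (fun p => f p ord0 i) @^-1` ball (ratr (q.1 ord0 i) : R) q.2.+1%:R^-1)).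
  apply: measurableI => //.
  apply: fin_bigcap_measurable => // i _.
  apply: mf => //.
  by apply: open_measurable; apply: ball_open; rewrite invr_gt0.
apply/seteqP; split => [p [Dp [_ h]]|p [Dp h]]; split => //.
  by move=> i _; split=> //; have := h ord0 i; rewrite mxE.
by split; [|move=> i j; rewrite ord1 mxE; have [_] := h j Logic.I].
Qed.

Lemma measurable_closed_rV n (D : set 'rV[R]_n) : closed D -> measurable D.
Proof.
move=> cD; rewrite -(setCK D); apply: measurableC.
by apply: open_measurable_rV; exact: closed_openC.
Qed.

Lemma measurable_coord n (i : 'I_n) :
  measurable_fun [set: 'rV[R]_n] (fun x : 'rV[R]_n => x ord0 i).
Proof. by apply: continuous_measurable_rV => x; exact: coord_continuous. Qed.

Lemma measurable_addv d (T : measurableType d) n (f g : T -> 'rV[R]_n) :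
  measurable_fun setT f -> measurable_fun setT g ->
  measurable_fun setT (fun t => f t + g t).
Proof.
move=> mf mg; apply: measurable_rV_coord => // i.
rewrite (_ : (fun _ => _) = (fun t => f t ord0 i + g t ord0 i)); last first.
  by apply/funext => t; rewrite mxE.
by apply: measurable_funD;
  exact: (measurableT_comp (measurable_coord i)).
Qed.

Lemma measurable_subv d (T : measurableType d) n (f g : T -> 'rV[R]_n) :
  measurable_fun setT f -> measurable_fun setT g ->
  measurable_fun setT (fun t => f t - g t).
Proof.
move=> mf mg; apply: measurable_rV_coord => // i.
rewrite (_ : (fun _ => _) = (fun t => f t ord0 i - g t ord0 i)); last first.
  by apply/funext => t; rewrite !mxE.
by apply: measurable_funB;
  exact: (measurableT_comp (measurable_coord i)).
Qed.

Lemma measurable_shift n (z : 'rV[R]_n) :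
  measurable_fun [set: 'rV[R]_n] (fun x : 'rV[R]_n => x + z).
Proof. exact: measurable_addv. Qed.

Lemma measurable_normv n : measurable_fun [set: 'rV[R]_n] (fun x => `|x|).
Proof. by apply: continuous_measurable_rV => x; exact: norm_continuous. Qed.

Lemma measurable_enorm n : measurable_fun [set: 'rV[R]_n] (@enorm R n).
Proof.
apply: (measurableT_comp (continuous_measurable_fun (@sqrt_continuous R))).
apply: measurable_sum => i.
by apply: measurable_funM; exact: measurable_coord.
Qed.

End borel_rV_theory.

Section translation_invariance.
Context {R : realType}.

(** Both sides are measures in [A] that agree on half-open intervals. *)
Lemma lebesgue_measure_shift (a : R) (A : set R) : measurable A ->
  lebesgue_measure ((fun x => x + a) @^-1` A) = lebesgue_measure A.
Proof.
move=> mA; have ms : measurable_fun setT (fun x : R => x + a).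
  exact: measurable_funD.
pose sh (x : R) : measurableTypeR R := x + a.
have -> : lebesgue_measure ((fun x : R => x + a) @^-1` A) =
  pushforward lebesgue_measure sh A by [].
apply/esym/lebesgue_measure_unique => // _ [[b c] _ <-]/=.
rewrite /pushforward/=.
rewrite (_ : _ @^-1` _ = `]b - a, c - a]%classic); last first.
  by apply/seteqP; split => x /=; rewrite !in_itv/= ltrBlDr lerBrDr.
rewrite !lebesgue_measure_itv/= !lte_fin ltrD2r.
by case: ifP => // _; rewrite -!EFinB; congr (_%:E); ring.
Qed.

(** [glue] turns a translation into a translation of both factors, and a product
measure is determined by its values on rectangles. *)
Lemma lebesgue_rV_shift n (z : 'rV[R]_n) (A : set 'rV[R]_n) : measurable A ->
  lebesgue_rV n ((fun x => x + z) @^-1` A) = lebesgue_rV n A.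
Proof.
elim: n z A => [|n IH] z A mA.
  rewrite (_ : (fun x => x + z) = id) ?preimage_id//.
  by apply/funext => x; apply/rowP => -[].
rewrite /= /lebesgue_step /pushforward.
pose zz := unglue z.
have ms : measurable_fun setT
    (fun p : R * 'rV[R]_n => (p.1 + zz.1, p.2 + zz.2)).
  apply/measurable_fun_pairP; split => /=.
    by apply: measurable_funD => //; exact: measurable_fst.
  by apply: measurable_addv => //; exact: measurable_snd.
pose sh (p : measurableTypeR R * 'rV[R]_n) : measurableTypeR R * 'rV[R]_n :=
  (p.1 + zz.1, p.2 + zz.2).
have shP p : Defs.glue p + z = Defs.glue (sh p).
  rewrite -[LHS]unglueK; congr (Defs.glue _); rewrite /unglue /sh/=.
  congr pair; first by rewrite mxE glueEl.
  apply/rowP => j; rewrite !mxE; congr (_ + _).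
  by rewrite -[rshift 1 j]/(unsplit (inr j)) unsplitK.
rewrite (_ : _ @^-1` (_ @^-1` _) = sh @^-1` (@Defs.glue R n @^-1` A)); last first.
  by apply/seteqP; split => p /=; rewrite shP.
have mgA : measurable (@Defs.glue R n @^-1` A).
  by rewrite -[X in measurable X]setTI; exact: measurable_glue.
apply/esym.
refine (@product_measure_unique _ _ _ _ R lebesgue_measure (lebesgue_rV n)
  (image_measure (lebesgue_measure \x lebesgue_rV n)%E (ms : measurable_fun setT sh))
  _ _ mgA).
move=> B C mB mC.
transitivity ((lebesgue_measure \x lebesgue_rV n)%E
  (((fun x : R => x + zz.1) @^-1` B) `*` ((fun x => x + zz.2) @^-1` C))).
  by [].
rewrite product_measure1E//; first by congr (_ * _)%E; [exact: lebesgue_measure_shift|exact: IH].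
  rewrite -[X in measurable X]setTI.
  by apply: (measurable_funD _ _ _ mB).
by rewrite -[X in measurable X]setTI; exact: measurable_shift.
Qed.

Lemma ge0_integral_shift n (z : 'rV[R]_n) (D : set 'rV[R]_n)
    (f : 'rV[R]_n -> \bar R) : measurable D -> measurable_fun D f ->
  (forall y, D y -> (0 <= f y)%E) ->
  (\int[lebesgue_rV n]_(x in (fun x => x + z)%R @^-1` D) f (x + z)%R =
   \int[lebesgue_rV n]_(x in D) f x)%E.
Proof.
move=> mD mf f0.
rewrite -[LHS](@ge0_integral_pushforward _ _ _ _ _ _ (measurable_shift z))//; last first.
  by move=> y; rewrite inE; exact: f0.
apply: (@eq_measure_integral _ _ _ _ _
  (image_measure (lebesgue_rV n) (measurable_shift z))) => A mA AD.
exact: lebesgue_rV_shift.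
Qed.

End translation_invariance.

Lemma lebesgue_rV_cube {R : realType} n (a b : R) : a <= b ->
  lebesgue_rV n [set x : 'rV[R]_n | forall i, a <= x ord0 i < b] =
  ((b - a) ^+ n)%:E.
Proof.
move=> ab.
transitivity (lebesgue_rV n
    [set x : 'rV[R]_n | forall i, (fun=> `[a, b[%classic) i (x ord0 i)]).
  by [].
rewrite (lebesgue_rV_box (A := fun=> `[a, b[%classic))//.
rewrite (eq_bigr (fun=> (b - a)%:E)); last first.
  move=> i _; rewrite lebesgue_measure_itv/= lte_fin.
  by case: ltgtP ab => // -> _; rewrite subrr.
rewrite (_ : (b - a) ^+ n = \prod_(i < n) (b - a)); last first.
  by rewrite prodr_const card_ord.
by rewrite prodEFin.
Qed.

Lemma measurable_box {R : realType} n (a b : R) :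
  measurable [set x : 'rV[R]_n | forall i, a <= x ord0 i < b].
Proof.
rewrite (_ : mkset _ = \bigcap_(i in [set: 'I_n])
    ((fun x : 'rV[R]_n => x ord0 i) @^-1` `[a, b[%classic)); last first.
  by apply/seteqP; split => [w h i _|w h i]; have := h i; rewrite /= in_itv//; exact.
apply: fin_bigcap_measurable => // i _; rewrite -[X in measurable X]setTI.
by apply: measurable_coord.
Qed.

(** * The Helly selection theorem *)

(** The Cantor diagonal argument: [g k] is the composite of the first [k]
extractions, and [n |-> g n n] is a subsequence of each [g k] from [n = k] on. *)
Lemma diagonal_extraction {R : realType} (u : nat -> nat -> R) (M : R) :
  (forall k n, `|u k n| <= M) ->
  exists f : nat -> nat, {homo f : i j / (i < j)%N} /\
    forall k, cvgn (fun n => u k (f n)).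
Proof.
move=> uM.
have ext (kg : nat * (nat -> nat)) : {f : nat -> nat |
    {homo f : i j / (i < j)%N} /\ cvgn (fun n => u kg.1 (kg.2 (f n)))}.
  apply/cid; have [f fi fc] := bounded_cvg_subseq (fun n => uM kg.1 (kg.2 n)).
  by exists f.
pose g := fix g k := if k is k'.+1 then g k' \o sval (ext (k', g k')) else id.
have gS k : g k.+1 = g k \o sval (ext (k, g k)) by [].
have extP k g' : {homo sval (ext (k, g')) : i j / (i < j)%N}.
  by have [] := svalP (ext (k, g')).
have g_mono k : {homo g k : i j / (i < j)%N}.
  by elim: k => // k IH i j ij; rewrite gS /=; exact/IH/extP.
have g_tail k n : (k <= n)%N ->
    exists2 h : nat -> nat, (forall m, m <= h m)%N & g n = g k \o h.
  move=> /subnKC <-; elim: (n - k)%N => [|d [h hm gE]].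
    by exists id; rewrite ?addn0.
  exists (h \o sval (ext ((k + d)%N, g (k + d)%N))).
    by move=> m /=; apply: leq_trans (hm _); exact/subseq_ge_id/extP.
  by rewrite addnS gS {1}gE.
exists (fun n => g n n); split.
  apply: homo_ltn => [? ? ?|n]; first exact: ltn_trans.
  rewrite gS /=; apply: g_mono; apply: leq_trans (ltnSn n) _.
  exact/subseq_ge_id/extP.
move=> k; have [_ /cvg_ex[/= l ul]] := svalP (ext (k, g k)).
apply/cvg_ex; exists l; apply/cvgrPdist_le => e e0.
move/cvgrPdist_le : ul => /(_ _ e0)[m _ mP].
exists (maxn m k.+1) => // n /=; rewrite geq_max => /andP[mn kn].
have [h hm gE] := g_tail _ _ kn.
by rewrite gE gS /=; apply: mP => /=; exact: leq_trans mn (hm n).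
Qed.

Lemma rational_selection {R : realType} (F : nat -> R -> R) (M : R) :
  (forall n t, `|F n t| <= M) ->
  exists f : nat -> nat, {homo f : i j / (i < j)%N} /\
  exists g : rat -> R, forall q, F (f n) (ratr q) @[n --> \oo] --> g q.
Proof.
move=> FM.
pose u k n := if @unpickle rat k is Some q then F n (ratr q) else 0.
have M0 : 0 <= M by apply: le_trans (FM 0%N 0).
have [k n|f [fi fc]] := @diagonal_extraction _ u M.
  by rewrite /u; case: unpickle => [q|]; rewrite ?normr0.
exists f; split=> //; exists (fun q => limn (fun n => F (f n) (ratr q))) => q.
by have := fc (pickle q); rewrite /u pickleK.
Qed.

Lemma cvg_sum_ord {R : realType} (T : Type) (F : set_system T) (FF : Filter F)
    (K : nat) (u : 'I_K -> T -> R) (l : 'I_K -> R) :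
  (forall i, u i t @[t --> F] --> l i) ->
  \sum_(i < K) u i t @[t --> F] --> \sum_(i < K) l i.
Proof.
elim: K u l => [|K IH] u l ul.
  rewrite big_ord0; under eq_fun do rewrite big_ord0; exact: cvg_cst.
rewrite big_ord_recr/=; under eq_fun do rewrite big_ord_recr/=.
by apply: cvgD => //; apply: IH => i; exact: ul.
Qed.

(** Otherwise there would be pairs of points of [[a, b]], at distances tending to
0, at which [psi] differs by more than [e]; a limit point contradicts
continuity. *)
Lemma continuous_unif_itv {R : realType} (psi : R -> R) (e : R) :
  continuous psi -> 0 < e -> forall a b : R, exists2 d : R, 0 < d &
    forall s t : R, a <= s <= b -> a <= t <= b -> `|s - t| <= d ->
    `|psi s - psi t| <= e.
Proof.
move=> cpsi e0 a b; apply/not_exists2P => H.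
have /choice[st stP] n : exists st : R * R, [/\ a <= st.1 <= b, a <= st.2 <= b,
    `|st.1 - st.2| <= n.+1%:R^-1 & e < `|psi st.1 - psi st.2|].
  have [/negP|] := H n.+1%:R^-1; first by rewrite invr_gt0 ltr0n.
  move/existsNP => [s /existsNP[t]].
  move=> /not_implyP[sab /not_implyP[tab /not_implyP[std /negP]]].
  by rewrite -ltNge => ?; exists (s, t).
have st_bnd n : `|(st n).1| <= Num.max `|a| `|b|.
  have [/andP[sa sb] _ _ _] := stP n.
  rewrite le_max; have [s0|s0] := leP 0 (st n).1.
    by rewrite (ger0_norm (le_trans s0 sb)) (ger0_norm s0) sb orbT.
  have a0 : a <= 0 by lra.
  by rewrite (ler0_norm a0) ltr0_norm// lerN2 sa.
have [f fi /cvg_ex[/= l fl]] := bounded_cvg_subseq st_bnd.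
have fn := subseq_ge_id fi.
have ft : (st (f n)).2 @[n --> \oo] --> l.
  apply/cvgrPdist_le => /= r r0; have r20 : 0 < r / 2 by rewrite divr_gt0.
  move/cvgrPdist_le : fl => /(_ _ r20) fl.
  have := near_infty_natSinv_lt (PosNum r20) => /= near2.
  near=> n.
  have h1 : `|l - (st (f n)).1| <= r / 2 by near: n.
  have h2 : n.+1%:R^-1 < r / 2 :> R by near: n.
  have [_ _ h3 _] := stP (f n).
  have h4 : (f n).+1%:R^-1 <= n.+1%:R^-1 :> R.
    by rewrite lef_pV2 ?posrE// ler_nat ltnS.
  rewrite (_ : l - _ = (l - (st (f n)).1) + ((st (f n)).1 - (st (f n)).2)); last first.
    by ring.
  apply: le_trans (ler_normD _ _) _; rewrite (splitr r) lerD//.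
  by rewrite (le_trans h3)// (le_trans h4)// ltW.
have := @cvgB _ _ _ _ _ _ _ _ _ (cvg_comp _ _ fl (cpsi l)) (cvg_comp _ _ ft (cpsi l)).
rewrite subrr => /(_ _)/cvgrPdist_lt-/(_ _ e0)[n _ /(_ n (leqnn n))] /=.
rewrite sub0r normrN => h; have [_ _ _] := stP (f n).
by move=> /lt_trans/(_ h); rewrite ltxx.
Unshelve. all: end_near. Qed.

Lemma dist_chain4 {R : realType} (y c b a x e1 e2 e3 e4 e : R) :
  `|y - c| <= e1 -> `|b - c| <= e2 -> `|b - a| <= e3 -> `|x - a| <= e4 ->
  e1 + e2 + e3 + e4 <= e -> `|y - x| <= e.
Proof.
rewrite !ler_distl => /andP[? ?] /andP[? ?] /andP[? ?] /andP[? ?] ?.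
by apply/andP; split; lra.
Qed.

Section helly.
Context {R : realType}.
Local Notation RR := (measurableTypeR R).

Lemma stieltjes_oc (G : cumulative R R) (a b : R) : a <= b ->
  lebesgue_stieltjes_measure G `]a, b]%classic = (G b - G a)%:E.
Proof.
move=> ab; rewrite /lebesgue_stieltjes_measure/= /measure_extension/=.
rewrite measurable_mu_extE/=; last exact: is_ocitv.
by rewrite wlength_itv_bnd.
Qed.

Lemma dist_Rintegral_cst d (T : measurableType d) (mu : {measure set T -> \bar R})
    (A : set T) (psi : T -> R) (c e : R) : measurable A -> (mu A < +oo)%E ->
  mu.-integrable A (EFin \o psi) ->
  (forall x, A x -> `|psi x - c| <= e) ->
  `|(\int[mu]_(x in A) psi x) - c * fine (mu A)| <= e * fine (mu A).
Proof.
move=> mA muA ipsi h.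
have ic r : mu.-integrable A (EFin \o (fun=> r)).
  by apply: (@bounded_integrable _ _ _ _ _ _ `|r|).
rewrite -(Rintegral_cst _ mA) -RintegralB//.
rewrite -(Rintegral_cst _ mA).
have iB : mu.-integrable A (EFin \o (fun x => psi x - c)).
  by apply: eq_integrable (integrableB mA ipsi (ic c)).
apply: le_trans (le_normr_Rintegral mA iB) _.
by apply: le_Rintegral => //; exact: integrable_norm.
Qed.

(** [psi] stays within [e] of its value at the left end of each cell, so the total
error is at most [e] times the mass. *)
Lemma riemann_sum_Rintegral (mu : {measure set RR -> \bar R}) (psi : R -> R)
    (C e M : R) (t : nat -> R) (K : nat) :
  continuous psi -> (forall x, `|psi x| <= C) ->
  {homo t : i j / (i <= j)%N >-> i <= j} ->
  (mu setT <= M%:E)%E -> mu (~` `]t 0%N, t K]%classic) = 0%E -> 0 <= e ->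
  (forall i s, (i < K)%N -> t i < s <= t i.+1 -> `|psi s - psi (t i)| <= e) ->
  `|(\int[mu]_x psi x) -
    \sum_(i < K) psi (t i) * fine (mu `]t i, t i.+1]%classic)| <= e * M.
Proof.
move=> cpsi psiC tnd muM mu0 e0 h.
have mpsi : measurable_fun [set: RR] psi.
  exact: (continuous_measurable_fun cpsi).
have mu_fin A : measurable A -> (mu A < +oo)%E.
  move=> mA; apply: le_lt_trans (ltry M).
  by apply: le_trans muM; apply: le_measure; rewrite ?inE.
have ipsi A : measurable A -> mu.-integrable A (EFin \o psi).
  move=> mA; apply: (@bounded_integrable _ _ _ _ _ _ C) => //.
    exact: mu_fin.
  exact: measurable_funS mpsi.
have mitv a b : measurable (`]a, b]%classic : set RR).
  exact: (@measurable_itv R).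
have key k : (k <= K)%N -> `|(\int[mu]_(x in `]t 0%N, t k]%classic) psi x) -
    \sum_(i < k) psi (t i) * fine (mu `]t i, t i.+1]%classic)| <=
    e * fine (mu `]t 0%N, t k]%classic).
  elim: k => [_|k IH kK].
    by rewrite set_itvoc0 Rintegral_set0 big_ord0 subr0 normr0 measure0 mulr0.
  have tE : (`]t 0%N, t k.+1] = `]t 0%N, t k] `|` `]t k, t k.+1])%classic.
    by rewrite -itv_bndbnd_setU// bnd_simp tnd.
  have disj : (`]t 0%N, t k] `&` `]t k, t k.+1])%classic = set0.
    by apply/seteqP; split=> x //= []; rewrite !in_itv/= => /andP[_ /le_lt_trans]
      + /andP[] => /[apply]; rewrite ltxx.
  have muE : fine (mu `]t 0%N, t k.+1]%classic) =
      fine (mu `]t 0%N, t k]%classic) + fine (mu `]t k, t k.+1]%classic).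
    by rewrite tE measureU// fineD// ge0_fin_numE//; exact: mu_fin.
  rewrite big_ord_recr/= muE mulrDr {1}tE Rintegral_setU//; last 2 first.
  - by rewrite -tE; exact: ipsi.
  - exact/eqP/disj.
  rewrite opprD addrACA; apply: le_trans (ler_normD _ _) _; apply: lerD.
    exact/IH/ltnW.
  apply: dist_Rintegral_cst => //; [exact: mu_fin|exact: ipsi|].
  by move=> x /=; rewrite in_itv/=; exact: h.
have -> : \int[mu]_x psi x = \int[mu]_(x in `]t 0%N, t K]%classic) psi x.
  rewrite /Rintegral -(setUv `]t 0%N, t K]%classic) integral_setU//; last 3 first.
  - exact: measurableC.
  - by rewrite setUv; apply/measurable_EFinP.
  - by apply/eqP; exact: setICr.
  rewrite [X in (_ + X)%E](_ : _ = 0%E) ?adde0//.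
  apply: null_set_integral => //; first exact: measurableC.
  by apply: measurable_funTS; apply/measurable_EFinP.
apply: le_trans (key _ (leqnn K)) _; rewrite ler_wpM2l//.
rewrite -lee_fin fineK; last by rewrite ge0_fin_numE//; exact: mu_fin.
by apply: le_trans muM; apply: le_measure; rewrite ?inE.
Qed.

(** Summation by parts moves the difference from [d], which is only bounded in sum,
to [p], which varies slowly. *)
Lemma sum_telescope_small (K : nat) (p d : nat -> R) (e M : R) :
  d 0%N = 0 -> d K = 0 -> 0 <= e -> (forall i, (i < K)%N -> 0 <= d i) ->
  (forall i, (i.+1 < K)%N -> `|p i.+1 - p i| <= e) ->
  \sum_(i < K) d i <= M ->
  `|\sum_(i < K) p i * (d i - d i.+1)| <= e * M.
Proof.
move=> d0 dK e0 dge0 pe dM.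
have -> : \sum_(i < K) p i * (d i - d i.+1) =
    \sum_(0 <= i < K) (p i - p i.-1) * d i.
  rewrite -(big_mkord xpredT (fun i => p i * (d i - d i.+1))).
  have H k : \sum_(0 <= i < k) p i * (d i - d i.+1) =
    \sum_(0 <= i < k) (p i - p i.-1) * d i - p k.-1 * d k.
    elim: k => [|k IH]; first by rewrite !big_nil d0; ring.
    by rewrite !big_nat_recr//= IH; ring.
  by rewrite H dK mulr0 subr0.
apply: le_trans (ler_norm_sum _ _ _) _.
rewrite big_mkord; apply: le_trans (ler_wpM2l e0 dM).
rewrite mulr_sumr; apply: ler_sum => -[[|i] iK] _ /=.
  by rewrite d0 !mulr0 normr0.
rewrite normrM (ger0_norm (dge0 _ iK)) ler_wpM2r ?dge0//.
exact: pe.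
Qed.

(** Along a subsequence the distribution functions [F] converge at the rationals to
some [g], whose right-continuous regularisation [G] defines the limit measure.
Integrals are compared through Riemann sums with rational nodes [q i], where
convergence holds even if [G] jumps. Replacing [g] by [G] in such a sum costs
little by summation by parts, because
[0 <= G (q i) - g (q i) <= g (q i.+1) - g (q i)]. *)
Lemma helly (nu_ : nat -> {measure set RR -> \bar R}) (M : R) :
  (forall n, nu_ n setT <= M%:E)%E -> (forall n, nu_ n (~` `[0, 1]%classic) = 0%E) ->
  exists f : nat -> nat, {homo f : i j / (i < j)%N} /\
  exists2 nu : {measure set RR -> \bar R}, (nu setT < +oo)%E &
    forall psi : R -> R, continuous psi -> (exists C, forall x, `|psi x| <= C) ->
    \int[nu_ (f n)]_x psi x @[n --> \oo] --> \int[nu]_x psi x.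
Proof.
move=> nuM nu01.
have nu_fin n A : measurable A -> (nu_ n A < +oo)%E.
  move=> mA; apply: le_lt_trans (ltry M).
  by apply: le_trans (nuM n); apply: le_measure; rewrite ?inE.
have mray a : measurable (`]-oo, a]%classic : set RR).
  exact: (@measurable_itv R).
have mitv a b : measurable (`]a, b]%classic : set RR).
  exact: (@measurable_itv R).
pose F n t := fine (nu_ n `]-oo, t]%classic).
have F0 n t : 0 <= F n t by apply: fine_ge0.
have Fnd n : {homo F n : s t / s <= t}.
  move=> s t st; rewrite /F fine_le ?ge0_fin_numE ?nu_fin//.
  apply: le_measure; rewrite ?inE//.
  by apply: subitvPr; rewrite bnd_simp.
have FB n s t : s <= t -> F n t - F n s = fine (nu_ n `]s, t]%classic).
  move=> st; rewrite /F.
  have -> : (`]-oo, t] = `]-oo, s] `|` `]s, t])%classic.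
    by rewrite -itv_bndbnd_setU// bnd_simp.
  rewrite measureU//; last first.
    by apply/seteqP; split=> x //= []; rewrite !in_itv/= => /le_lt_trans
      + /andP[] => /[apply]; rewrite ltxx.
  by rewrite fineD ?ge0_fin_numE ?nu_fin//; ring.
have FM n t : F n t <= M.
  rewrite -lee_fin fineK; last by rewrite ge0_fin_numE//; exact: nu_fin.
  by apply: le_trans (nuM n); apply: le_measure; rewrite ?inE.
have nu0 n (A : set RR) : measurable A -> A `<=` ~` `[0, 1]%classic -> nu_ n A = 0%E.
  move=> mA A01; apply/eqP; rewrite eq_le measure_ge0 andbT -(nu01 n).
  apply: le_measure; rewrite ?inE//.
  by apply: measurableC; exact: (@measurable_itv R).
have Fneg n (t : R) : t < 0 -> F n t = 0.
  move=> t0; rewrite /F nu0// => x /=; rewrite !in_itv/= => xt /andP[x0 _].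
  by have := lt_le_trans t0 (le_trans x0 xt); rewrite ltxx.
have Fone n s t : 1 <= s -> s <= t -> F n t = F n s.
  move=> s1 st; apply/eqP; rewrite -subr_eq0 FB// nu0// => x /=.
  rewrite !in_itv/= => /andP[sx _] /andP[_ x1].
  by have := lt_le_trans sx (le_trans x1 s1); rewrite ltxx.
have [f [fi [g gF]]] := @rational_selection _ F M (fun n t =>
  eq_ind_r (fun z => z <= M) (FM n t) (ger0_norm (F0 n t))).
exists f; split => //.
have g_ge0 q : 0 <= g q.
  by apply: (ler_cvg_to (cvg_cst 0) (gF q)); exact: nearW.
have g_le q : g q <= M.
  by apply: (ler_cvg_to (gF q) (cvg_cst M)); exact: nearW.
have g_nd (q r : rat) : q <= r -> g q <= g r.
  move=> qr; apply: (ler_cvg_to (gF q) (gF r)); apply: nearW => n.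
  by apply: Fnd; rewrite ler_rat.
have g_neg q : ratr q < 0 :> R -> g q = 0.
  move=> q0; apply/eqP; rewrite eq_le g_ge0 andbT.
  apply: (ler_cvg_to (gF q) (cvg_cst 0)); apply: nearW => n.
  by rewrite Fneg.
have g_one (q r : rat) : 1 <= ratr q :> R -> q <= r -> g r = g q.
  move=> q1 qr; apply/eqP; rewrite eq_le [X in _ && X]g_nd// andbT.
  apply: (ler_cvg_to (gF r) (gF q)); apply: nearW => n.
  by rewrite (@Fone _ (ratr q))// ler_rat.
pose S (t : R) := [set g q | q in [set q | t < ratr q]].
pose G t := inf (S t).
have S0 t : S t !=set0.
  have /rat_in_itvoo[q] : t < t + 1 by rewrite ltrDl.
  by rewrite in_itv/= => /andP[tq _]; exists (g q), q.
have Slb t : has_lbound (S t) by exists 0 => _ [q _ <-].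
have G_le (t : R) q : t < ratr q -> G t <= g q.
  by move=> tq; apply: ge_inf => //; exists q.
have G_ge (t x : R) : (forall q, t < ratr q -> x <= g q) -> x <= G t.
  by move=> h; apply: lb_le_inf => // _ [q tq <-]; exact: h.
have G_nd : {homo G : s t / s <= t}.
  by move=> s t st; apply: G_ge => q tq; apply: G_le; exact: le_lt_trans tq.
have G_ge0 t : 0 <= G t by exact: G_ge.
have G_leM t : G t <= M.
  have [_ [q /= tq _]] := S0 t.
  exact: le_trans (G_le _ _ tq) (g_le q).
have G_gt q : g q <= G (ratr q).
  by apply: G_ge => r; rewrite ltr_rat => /ltW; exact: g_nd.
have G_lt (q r : rat) : q < r -> G (ratr q) <= g r.
  by move=> qr; apply: G_le; rewrite ltr_rat.
have G_neg (t : R) : t < 0 -> G t = 0.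
  move=> t0; have /rat_in_itvoo[q] := t0.
  rewrite in_itv/= => /andP[tq q0]; apply/eqP; rewrite eq_le G_ge0 andbT.
  by rewrite -(g_neg q q0) G_le.
have G_one q : 1 <= ratr q :> R -> G (ratr q) = g q.
  move=> q1; apply/eqP; rewrite eq_le G_gt andbT.
  by rewrite -(g_one q (q + 1))// ?lerDl// G_lt// ltrDl.
have G_rc : right_continuous G.
  move=> t; apply/cvgrPdist_le => e e0.
  have [_ [q /= tq <-] qe] := inf_adherent e0 (conj (S0 t) (Slb t)).
  near=> s.
  have ts : t < s by near: s; exact: nbhs_right_gt.
  have sq : s < ratr q by near: s; exact: nbhs_right_lt.
  have Gts : G t <= G s by exact/G_nd/ltW.
  rewrite distrC ger0_norm ?subr_ge0// lerBlDl.
  by apply: le_trans (ltW qe); exact: G_le.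
pose Gc : cumulative R R := HB.pack G (isCumulative.Build R _ R G G_nd G_rc).
pose nu : {measure set RR -> \bar R} :=
  mrestr (lebesgue_stieltjes_measure Gc) (mitv (-1) 2).
have nuT : nu setT = (G 2 - G (-1))%:E.
  by rewrite /nu/= /mrestr setTI stieltjes_oc//; lra.
have nuC : nu (~` `]-1, 2]%classic) = 0%E.
  by rewrite /nu/= /mrestr setICl measure0.
have nuE (a b : R) : -1 <= a -> a <= b -> b <= 2 ->
    fine (nu `]a, b]%classic) = G b - G a.
  move=> a1 ab b2; rewrite /nu/= /mrestr setIidl.
    by rewrite stieltjes_oc.
  by apply: subset_itv; rewrite bnd_simp.
exists nu; first by rewrite nuT ltry.
move=> psi cpsi [C psiC].
have M0 : 0 <= M by exact: le_trans (g_le 0).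
apply/cvgrPdist_le => e e0.
pose e' := e / (4 * (M + 1)).
have M1 : 0 < 4 * (M + 1) by lra.
have e'0 : 0 < e' by rewrite divr_gt0.
have e'M : e' * M <= e / 4.
  by rewrite /e' mulrAC ler_pdivrMr//; nra.
have [d d0 psid] := continuous_unif_itv cpsi e'0 (-1) 2.
have [k kd] := natSinv_lt d0.
(* The nodes run from -1 to 2 so that both end nodes lie outside [0, 1], where [g]
   and [G] agree. *)
pose q (i : nat) : rat := i%:R / k.+1%:R - 1.
pose K := (3 * k.+1)%N.
pose t i : R := ratr (q i).
have tE i : t i = i%:R / k.+1%:R - 1.
  by rewrite /t /q rmorphB/= rmorph1 fmorph_div/= !ratr_nat.
have t0 : t 0%N = -1 by rewrite tE mul0r sub0r.
have tK : t K = 2 by rewrite tE /K natrM mulfK ?pnatr_eq0//; lra.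
have t_nd : {homo t : i j / (i <= j)%N >-> i <= j}.
  move=> i j ij; rewrite !tE lerB// ler_wpM2r// ?invr_ge0//.
  by rewrite ler_nat.
have q_lt i : q i < q i.+1.
  by rewrite /q ltrD2r ltr_pM2r ?invr_gt0 ?ltr0n// ltr_nat.
have tS i : t i.+1 - t i < d.
  by rewrite !tE opprB addrA subrK -mulrBl -natrB// subSnn mul1r.
have t_in i : (i <= K)%N -> -1 <= t i <= 2.
  by move=> iK; rewrite -{1}t0 -tK !t_nd.
have psi_osc i (s : R) : (i < K)%N -> t i < s <= t i.+1 -> `|psi s - psi (t i)| <= e'.
  move=> iK /andP[ts st].
  have /andP[ti _] := t_in _ (ltnW iK).
  have /andP[_ ti1] := t_in _ iK.
  apply: psid; [|by rewrite ti ltW// (lt_le_trans _ ti1)// (lt_le_trans ts)|].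
    by rewrite (le_trans ti (ltW ts)) (le_trans st ti1).
  have tSi := tS i; move: ts st tSi; clear => ts st tSi.
  by rewrite ger0_norm; lra.
have disjC : ~` `]t 0%N, t K]%classic `<=` (~` `[0, 1]%classic : set RR).
  rewrite t0 tK; apply: subsetC => x /=; rewrite !in_itv/= => /andP[? ?].
  by apply/andP; split; lra.
have R1 n : `|(\int[nu_ (f n)]_x psi x) -
    \sum_(i < K) psi (t i) * (F (f n) (t i.+1) - F (f n) (t i))| <= e' * M.
  rewrite (eq_bigr (fun i : 'I_K =>
      psi (t i) * fine (nu_ (f n) `]t i, t i.+1]%classic))); last first.
    by move=> i _; rewrite FB// t_nd.
  apply: (@riemann_sum_Rintegral _ _ C) => //; last exact: ltW.
  by apply: nu0 => //; exact: measurableC.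
have R2 : `|(\int[nu]_x psi x) -
    \sum_(i < K) psi (t i) * (G (t i.+1) - G (t i))| <= e' * M.
  rewrite (eq_bigr (fun i : 'I_K =>
      psi (t i) * fine (nu `]t i, t i.+1]%classic))); last first.
    move=> i _; rewrite nuE//; last 2 first.
    - exact: t_nd.
    - by have /andP[] := t_in i.+1 (ltn_ord i).
    - by have /andP[] := t_in i (ltnW (ltn_ord i)).
  apply: (@riemann_sum_Rintegral _ _ C) => //; last exact: ltW.
    by rewrite nuT lee_fin lerBlDr (le_trans (G_leM _))// lerDl.
  by rewrite t0 tK.
have R3 : `|\sum_(i < K) psi (t i) * (g (q i.+1) - g (q i)) -
    \sum_(i < K) psi (t i) * (G (t i.+1) - G (t i))| <= e' * M.
  pose d' i := G (t i) - g (q i).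
  rewrite -sumrB (eq_bigr (fun i : 'I_K =>
    psi (t i) * (d' i - d' i.+1))); last by move=> i _; rewrite /d'; ring.
  apply: (@sum_telescope_small K (fun i => psi (t i)) d').
  - by rewrite /d' G_neg ?g_neg ?subr0// -/(t 0%N) t0; lra.
  - by rewrite /d' G_one ?subrr// -/(t K) tK; lra.
  - exact: ltW.
  - by move=> i _; rewrite /d' subr_ge0 G_gt.
  - move=> i iK; apply: psi_osc; first exact: ltnW.
    by rewrite lexx andbT /t ltr_rat.
  - apply: (@le_trans _ _ (\sum_(i < K) (g (q i.+1) - g (q i)))).
      by apply: ler_sum => i _; rewrite /d' lerB// G_lt.
    rewrite -(big_mkord xpredT (fun i => g (q i.+1) - g (q i))).
    rewrite telescope_sumr// lerBlDr (le_trans (g_le _))// lerDl.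
    exact: g_ge0.
have R4 : \sum_(i < K) psi (t i) * (F (f n) (t i.+1) - F (f n) (t i))
    @[n --> \oo] --> \sum_(i < K) psi (t i) * (g (q i.+1) - g (q i)).
  apply: cvg_sum_ord => i; apply: cvgMl_tmp; apply: cvgB; exact: gF.
have e40 : 0 < e / 4 by rewrite divr_gt0.
move/cvgrPdist_le : R4 => /(_ _ e40) R4; near=> n.
have R4n : `|\sum_(i < K) psi (t i) * (g (q i.+1) - g (q i)) -
  \sum_(i < K) psi (t i) * (F (f n) (t i.+1) - F (f n) (t i))| <= e / 4.
  by near: n.
have R1n := R1 n.
by apply: (dist_chain4 R2 R3 R4n R1n); move: e'M; clear; lra.
Unshelve. all: end_near. Qed.

End helly.

(** * Weak compactness of measures on a cube *)

Section sup_norm.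
Context {R : realType}.

Lemma normv_leP n (x : 'rV[R]_n) (r : R) : 0 <= r ->
  `|x| <= r <-> forall i, `|x ord0 i| <= r.
Proof.
move=> r0; rewrite [`|x|]mx_normrE; split => [/bigmax_leP[_ h] i|h].
  exact: (h (ord0, i)).
by apply/bigmax_leP; split => // -[i j] _ /=; rewrite ord1.
Qed.

Lemma normv_ltP n (x : 'rV[R]_n) (r : R) : 0 < r ->
  `|x| < r <-> forall i, `|x ord0 i| < r.
Proof.
move=> r0; rewrite [`|x|]mx_normrE; split => [/bigmax_ltP[_ h] i|h].
  exact: (h (ord0, i)).
by apply/bigmax_ltP; split => // -[i j] _ /=; rewrite ord1.
Qed.

Lemma coord_le_normv n (x : 'rV[R]_n) i : `|x ord0 i| <= `|x|.
Proof. by have /normv_leP := lexx `|x|; apply. Qed.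

Lemma continuous_rV (T : topologicalType) n (f : T -> 'rV[R]_n) :
  (forall i, continuous (fun t => f t ord0 i)) -> continuous f.
Proof.
move=> cf t; apply/cvgrPdist_lt => e e0.
have H : \forall s \near t, forall i, `|f t ord0 i - f s ord0 i| < e.
  apply: filter_forall => i.
  by have /cvgrPdist_lt/(_ _ e0) := cf i t.
apply: filterS H => s sP; apply/normv_ltP => // i.
by rewrite !mxE; exact: sP.
Qed.

Definition cube n (B : R) : set 'rV[R]_n := [set x | `|x| <= B].

Lemma measurable_cube n B : measurable (@cube n B).
Proof.
rewrite (_ : cube _ = setT `&` (fun x : 'rV[R]_n => `|x|) @^-1` `]-oo, B]%classic).
  exact: measurable_normv.
by rewrite setTI; apply/seteqP; split => x /=; rewrite in_itv.
Qed.

End sup_norm.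

Section peano_curve.
Context {R : realType}.

(** The partial sums converge uniformly: the tail after [K] terms is at most
[2^-1 ^+ K]. *)
Lemma binary_series_continuous (T : topologicalType) (v : nat -> T -> R) :
  (forall k, continuous (v k)) -> (forall k t, 0 <= v k t <= 1) ->
  exists P : T -> R, continuous P /\ forall K t,
    \sum_(k < K) 2^-1 ^+ k.+1 * v k t <= P t <=
    \sum_(k < K) 2^-1 ^+ k.+1 * v k t + 2^-1 ^+ K.
Proof.
move=> cv v01.
pose S K t := \sum_(k < K) 2^-1 ^+ k.+1 * v k t.
have p2 k : 0 < 2^-1 ^+ k :> R by rewrite exprn_gt0// invr_gt0.
have S_nd t : {homo S^~ t : m n / (m <= n)%N >-> m <= n}.
  apply: homo_leq => [//|? ? ?|n]; first exact: le_trans.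
  rewrite /S big_ord_recr/= lerDl mulr_ge0 ?(ltW (p2 _))//.
  by have /andP[] := v01 n t.
have S_tail K n t : S (K + n)%N t <= S K t + 2^-1 ^+ K - 2^-1 ^+ (K + n).
  elim: n => [|n IH]; first by rewrite addn0 addrK.
  rewrite addnS {1}/S big_ord_recr/= -/(S _ _).
  apply: le_trans (lerD IH (_ : _ <= 2^-1 ^+ (K + n).+1)) _.
    by rewrite ler_piMr ?(ltW (p2 _))//; have /andP[] := v01 (K + n)%N t.
  by rewrite !exprS; lra.
have S_up K n t : S n t <= S K t + 2^-1 ^+ K.
  have [nK|/ltnW Kn] := leqP n K.
    by rewrite (le_trans (S_nd t _ _ nK))// lerDl ltW.
  rewrite -(subnKC Kn); apply: le_trans (S_tail _ _ _) _.
  by rewrite lerBlDr lerDl ltW.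
have S_cvg t : cvgn (S^~ t).
  apply: nondecreasing_is_cvgn; first exact: S_nd.
  by exists (S 0%N t + 2^-1 ^+ 0) => _ [n _ <-].
pose P t := limn (S^~ t).
have PS K t : S K t <= P t <= S K t + 2^-1 ^+ K.
  apply/andP; split.
    apply: limr_ge; first exact: S_cvg.
    by exists K => // n /= Kn; exact: S_nd.
  by apply: limr_le; [exact: S_cvg|exact: nearW].
exists P; split => // t; apply/cvgrPdist_le => /= e e0.
have [K Ke] : exists K, 2^-1 ^+ K <= e / 4.
  have e40 : 0 < e / 4 by rewrite divr_gt0.
  have h1 : `|2^-1 : R| < 1 by rewrite ger0_norm ?invr_ge0// invf_lt1// ltr1n.
  have /cvgrPdist_le/(_ _ e40)[K _ /(_ K (leqnn K))] := cvg_expr h1.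
  by rewrite sub0r normrN (ger0_norm (ltW (p2 _))) => ?; exists K.
have cS : continuous (S K).
  move=> s; apply: cvg_sum_ord => k.
  by apply: cvgMl_tmp; exact: cv.
have e20 : 0 < e / 2 by rewrite divr_gt0.
have /cvgrPdist_le/(_ _ e20) := cS t.
apply: filterS => s; have := PS K t; have := PS K s; move: Ke; clear.
move=> Ke /andP[? ?] /andP[? ?]; rewrite !ler_distl => /andP[? ?].
by apply/andP; split; lra.
Qed.

(** Greedy expansion; [r k] is the remainder after [k] digits, scaled by [2 ^ k]. *)
Lemma binary_digits (x : R) : 0 <= x <= 1 -> exists b : nat -> bool,
  forall K, \sum_(k < K) 2^-1 ^+ k.+1 * (b k)%:R <= x <=
    \sum_(k < K) 2^-1 ^+ k.+1 * (b k)%:R + 2^-1 ^+ K.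
Proof.
move=> x01.
pose r := fix r k : R := if k is k'.+1 then 2 * r k' - (2^-1 <= r k')%R%:R else x.
have r01 k : 0 <= r k <= 1.
  elim: k => [//|k /andP[r0 r1]] /=.
  by have [h|h] := leP 2^-1 (r k) => /=; apply/andP; split; lra.
exists (fun k => 2^-1 <= r k) => K.
have -> : \sum_(k < K) 2^-1 ^+ k.+1 * (2^-1 <= r k)%R%:R = x - 2^-1 ^+ K * r K.
  elim: K => [|K IH]; first by rewrite big_ord0 expr0 mul1r subrr.
  rewrite big_ord_recr/= IH -/r exprS.
  by field.
have /andP[r0 r1] := r01 K.
have p2 : 0 < 2^-1 ^+ K :> R by rewrite exprn_gt0// invr_gt0.
by apply/andP; split; nra.
Qed.

(** [tau] maps each of [0, 1/3] and [2/3, 1] onto [0, 1], with slope 3 and -3, and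
[digit] is 0 on the first and 1 on the second. Choosing a third at each step
produces a point whose orbit under [tau] has any prescribed finite sequence of
digits ([itinerary]). *)
Let tau (t : R) := 2^-1 * (3 - `|6 * t - 3|).
Let digit (t : R) := 2^-1 * (`|3 * t - 1| - `|3 * t - 2| + 1).

Let continuous_tau : continuous tau.
Proof.
move=> t; apply: cvgMl_tmp; apply: cvgB; first exact: cvg_cst.
apply: cvg_norm; apply: cvgB; last exact: cvg_cst.
by apply: cvgMl_tmp; exact: cvg_id.
Qed.

Let continuous_digit : continuous digit.
Proof.
move=> t; apply: cvgMl_tmp; apply: cvgD; last exact: cvg_cst.
by apply: cvgB; apply: cvg_norm; apply: cvgB; (try exact: cvg_cst);
  apply: cvgMl_tmp; exact: cvg_id.
Qed.

Let digit01 t : 0 <= digit t <= 1.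
Proof.
rewrite /digit; have [?|?] := ger0P (3 * t - 1);
  have [?|?] := ger0P (3 * t - 2); apply/andP; split; lra.
Qed.

Let continuous_iter_tau m : continuous (iter m tau).
Proof.
elim: m => [|m IH] t; first exact: cvg_id.
by apply: (@continuous_comp _ _ _ (iter m tau) tau); [exact: IH|exact: continuous_tau].
Qed.

Let itinerary (c : nat -> bool) n : exists2 t : R, 0 <= t <= 1 &
  forall m, (m < n)%N -> digit (iter m tau t) = (c m)%:R.
Proof.
elim: n c => [|n IH] c; first by exists 0; rewrite ?lexx ?ler01.
have [t /andP[t0 t1] tP] := IH (fun m => c m.+1).
pose s := if c 0%N then 1 - t / 3 else t / 3.
have s01 : 0 <= s <= 1 by rewrite /s; case: (c 0%N); apply/andP; split; lra.
exists s => // -[_|m mn].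
  rewrite /= /digit /s; case: (c 0%N) => /=.
    by rewrite !ger0_norm; lra.
  by rewrite !ler0_norm; lra.
rewrite iterSr (_ : tau s = t); first exact: tP.
rewrite /tau /s; case: (c 0%N) => /=.
  by rewrite ger0_norm; lra.
by rewrite ler0_norm; lra.
Qed.

(** The Schoenberg curve: the binary digits of the coordinate [i] of [p t] are read
along the orbit of [t] under [tau], at the times [n * k + i]. Continuity comes
from that of [digit] and [tau]. Parameters whose first digits are those of a
given [x] accumulate at a parameter of [x]. *)
Lemma peano_curve n : exists2 p : R -> 'rV[R]_n, continuous p &
  forall x : 'rV[R]_n, (forall i, 0 <= x ord0 i <= 1) ->
  exists2 t, 0 <= t <= 1 & p t = x.
Proof.
have /choice[P PP] (i : 'I_n) : exists P : R -> R, continuous P /\ forall K t,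
    \sum_(k < K) 2^-1 ^+ k.+1 * digit (iter (n * k + i) tau t) <= P t <=
    \sum_(k < K) 2^-1 ^+ k.+1 * digit (iter (n * k + i) tau t) + 2^-1 ^+ K.
  apply: (@binary_series_continuous R (fun k t => digit (iter (n * k + i) tau t))).
    move=> k t; apply: (@continuous_comp _ _ _ (iter (n * k + i) tau) digit).
      exact: continuous_iter_tau.
    exact: continuous_digit.
  by move=> k t; exact: digit01.
exists (fun t => \row_i P i t).
  apply: continuous_rV => i; rewrite (_ : (fun _ => _) = P i).
    by have [] := PP i.
  by apply/funext => t; rewrite mxE.
move=> x x01.
have /choice[b bP] i := binary_digits (x01 i).
case: n => [|n] in P PP x x01 b bP *.
  by exists 0; rewrite ?lexx ?ler01//; apply/rowP => -[].
pose c m := b (inord (m %% n.+1)) (m %/ n.+1)%N.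
have cE k (i : 'I_n.+1) : c (n.+1 * k + i)%N = b i k.
  rewrite /c mulnC modnMDl modn_small// divnMDl// divn_small// addn0.
  by rewrite inord_val.
have /choice[t /all_and2[t01 tP]] j : exists t : R, 0 <= t <= 1 /\
    forall m, (m < n.+1 * j)%N -> digit (iter m tau t) = (c m)%:R.
  by have [t] := itinerary c (n.+1 * j); exists t.
have tx i j : `|P i (t j) - x ord0 i| <= 2^-1 ^+ j.
  have [_ /(_ j (t j)) /andP[]] := PP i; have /andP[] := bP i j.
  rewrite (eq_bigr (fun k : 'I_j => 2^-1 ^+ k.+1 * digit (iter (n.+1 * k + i) tau (t j)))).
    by move=> ? ? ? ?; rewrite ler_distl; apply/andP; split; lra.
  move=> k _; rewrite tP ?cE//; apply: (@leq_trans (n.+1 * k.+1)).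
    by rewrite [leqRHS]mulnS -addnS addnC leq_add2r.
  by rewrite leq_mul2l ltn_ord.
have t_bnd j : `|t j| <= 1 by have /andP[t0 t1] := t01 j; rewrite ger0_norm.
have [f fi /cvg_ex[/= l fl]] := bounded_cvg_subseq t_bnd.
exists l.
  apply/andP; split.
    apply: (ler_cvg_to (cvg_cst 0) fl); apply: nearW => j /=.
    by have /andP[] := t01 (f j).
  apply: (ler_cvg_to fl (cvg_cst (1 : R))); apply: nearW => j /=.
  by have /andP[] := t01 (f j).
apply/rowP => i; rewrite mxE; have [cP _] := PP i.
have c1 := cvg_comp _ _ fl (cP l).
apply: (cvg_unique _ c1) => //=.
have h1 : `|2^-1 : R| < 1 by rewrite ger0_norm ?invr_ge0// invf_lt1// ltr1n.
apply/cvgrPdist_le => /= e e0.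
have /cvgrPdist_le/(_ _ e0) := cvg_expr h1.
apply: filterS => j; rewrite sub0r normrN ger0_norm ?exprn_ge0 ?invr_ge0//.
apply: le_trans; rewrite distrC; apply: le_trans (tx i (f j)) _.
by rewrite ler_wiXn2l ?invr_ge0 ?invf_le1 ?ler1n// subseq_ge_id.
Qed.

End peano_curve.

Section prokhorov_cube.
Context {R : realType} {n : nat}.
Local Notation RR := (measurableTypeR R).

(** [s x] is the least parameter of [x]. For [0 <= a], the set where [s <= a]
consists of a compact set, the arc traced up to the time [a], and of the points
outside the curve. *)
Let measurable_min_section (p : R -> 'rV[R]_n) : continuous p ->
  exists s : 'rV[R]_n -> RR, [/\ measurable_fun setT s,
    forall x, 0 <= s x <= 1 &
    forall x, (exists2 t, 0 <= t <= 1 & p t = x) -> p (s x) = x].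
Proof.
move=> cp.
pose A x := [set t : R | 0 <= t <= 1 /\ p t = x].
have AE x : A x = `[0, 1]%classic `&` p @^-1` [set x].
  by apply/seteqP; split => t /=; rewrite in_itv.
have cA x : compact (A x).
  rewrite AE; apply: (@compact_closedI R^o); first exact: segment_compact.
  apply: closed_comp; first by move=> *; exact: cp.
  exact/accessible_closed_set1/hausdorff_accessible/norm_hausdorff.
have /choice[s sP] x : exists s : R, (A x !=set0 -> A x s /\
    forall t, A x t -> s <= t) /\ (~ (A x !=set0) -> s = 0).
  have [Ax|Ax] := pselect (A x !=set0); last by exists 0.
  have cid : {within A x, continuous (@idfun R)}.
    by apply: continuous_subspaceT => ?; exact: cvg_id.
  have [c /set_mem cAx cmin] := @compact_EVT_min _ R idfun _ Ax (cA x) cid.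
  by exists c; split => // _; split => // t /mem_set; exact: cmin.
exists s; split; last 2 first.
- move=> x; have [sA sN] := sP x.
  have [/sA[[]//]|/sN ->] := pselect (A x !=set0).
  by rewrite lexx ler01.
- move=> x [t t01 ptx]; have [sA _] := sP x.
  by have [|[_ //]] := sA; exists t.
have closed_img (a : R) : closed (p @` (`[0, 1]%classic `&` `]-oo, a]%classic)).
  apply: compact_closed; first exact: norm_hausdorff.
  apply: continuous_compact; first exact: continuous_subspaceT.
  apply: (@compact_closedI R^o); first exact: segment_compact.
  exact: interval_closed.
have s_le (a : R) : s @^-1` `]-oo, a]%classic =
    if 0 <= a then p @` (`[0, 1]%classic `&` `]-oo, a]%classic) `|`
      ~` (p @` (`[0, 1]%classic `&` `]-oo, 1]%classic)) else set0.
  apply/seteqP; split => [x|x] /=.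
    rewrite in_itv/= => sxa; have [sA sN] := sP x.
    have [/[dup] Ax /sA[[s01 psx] _]|Ax] := pselect (A x !=set0).
      rewrite ifT; last by have /andP[s0 _] := s01; exact: le_trans sxa.
      by left; exists (s x) => //; rewrite /= !in_itv/=.
    rewrite ifT; last by rewrite -(sN Ax).
    right => -[t [/=]]; rewrite in_itv/= => t01 _ ptx.
    by apply: Ax; exists t.
  case: ifPn => // a0; have [sA sN] := sP x.
  have [/[dup] Ax /sA[[s01 psx] smin]|/[dup] Ax /sN sx0] := pselect (A x !=set0).
    case=> [[t [/=]]|]; rewrite !in_itv/=.
      by move=> t01 ta ptx; apply: le_trans ta; exact: smin.
    by case; exists (s x) => //; split; rewrite /= in_itv//=; have /andP[] := s01.
  by rewrite sx0 in_itv.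
apply: (measurability _ (RGenOInfty.measurableE R)) => _ [_ [a ->] <-].
rewrite setTI (_ : _ @^-1` _ = ~` (s @^-1` `]-oo, a]%classic)); last first.
  by apply/seteqP; split => x /=; rewrite !in_itv/= andbT ltNge => /negP.
apply: measurableC; rewrite s_le.
case: ifP => // _; apply: measurableU; first exact: (measurable_closed_rV (closed_img a)).
by apply: measurableC; exact: (measurable_closed_rV (closed_img 1)).
Qed.

(** The Borel section [s] of a curve [p] that fills the cube carries the measures to
[0, 1], where [helly] applies; since [p (s x) = x] on the cube, pushing the limit
forward along [p] gives the limit of the original measures. *)
Lemma prokhorov_cube (m_ : nat -> {measure set 'rV[R]_n -> \bar R}) (M B : R) :
  0 < B -> (forall k, m_ k setT <= M%:E)%E ->
  (forall k, m_ k (~` cube B) = 0%E) ->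
  exists f : nat -> nat, {homo f : i j / (i < j)%N} /\
  exists2 mu : {measure set 'rV[R]_n -> \bar R}, (mu setT < +oo)%E &
    forall phi : 'rV[R]_n -> R, continuous phi ->
    (exists C, forall x, `|phi x| <= C) ->
    \int[m_ (f k)]_x phi x @[k --> \oo] --> \int[mu]_x phi x.
Proof.
move=> B0 mM mB.
have [p0 cp0 p0P] := @peano_curve R n.
pose p t : 'rV[R]_n := (2 * B) *: p0 t - const_mx B.
have cp : continuous p.
  by move=> t; apply: cvgB; [apply: cvgZl_tmp; exact: cp0|exact: cvg_cst].
have pP x : cube B x -> exists2 t, 0 <= t <= 1 & p t = x.
  move=> /normv_leP-/(_ (ltW B0)) xB.
  have [|t t01 pt] := p0P ((2 * B)^-1 *: (x + const_mx B)).
    move=> i; rewrite !mxE mulrC ler_pdivlMr ?ler_pdivrMr ?mulr_gt0//.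
    by have := xB i; rewrite ler_norml => /andP[? ?]; apply/andP; split; lra.
  exists t => //; rewrite /p pt scalerA divff ?scale1r ?addrK//.
  by rewrite mulf_neq0// gt_eqF.
have [s [ms s01 sP]] := measurable_min_section cp.
pose nu_ k : {measure set RR -> \bar R} := image_measure (m_ k) ms.
have [||f [fi [nu nu_fin nuP]]] := @helly R nu_ M.
- by move=> k; rewrite /nu_ /= /pushforward preimage_setT.
- move=> k; rewrite /nu_ /= /pushforward (_ : _ @^-1` _ = set0) ?measure0//.
  by apply/seteqP; split => // x /=; rewrite in_itv/= s01.
have mp : measurable_fun [set: RR] p.
  apply: measurable_rV_coord => // i.
  have cpi : continuous (fun t : R => p t ord0 i).
    move=> t; apply: (@continuous_comp _ _ _ p (fun x : 'rV[R]_n => x ord0 i)).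
      exact: cp.
    exact: coord_continuous.
  exact: (continuous_measurable_fun cpi).
exists f; split => //; exists (image_measure nu mp).
  by rewrite /= /pushforward preimage_setT.
move=> phi cphi [C phiC].
have mphi : measurable_fun setT phi by exact: continuous_measurable_rV.
have int_bnd d (T : measurableType d) (m : {measure set T -> \bar R})
    (g : T -> R) : (m setT < +oo)%E -> measurable_fun setT g ->
    (forall x, `|g x| <= C) -> m.-integrable setT (EFin \o g).
  by move=> mfin mg gC; exact: (@bounded_integrable _ _ _ _ _ _ C).
have cphip : continuous (phi \o p).
  by move=> t; apply: continuous_comp; [exact: cp|exact: cphi].
have mphip : measurable_fun [set: RR] (phi \o p).
  exact: (continuous_measurable_fun cphip).
have -> : \int[image_measure nu mp]_x phi x = \int[nu]_t (phi \o p) t.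
  rewrite /Rintegral; congr fine.
  rewrite (@integral_pushforward _ _ _ _ _ _ mp nu setT (EFin \o phi))//.
    exact/measurable_EFinP.
  by rewrite preimage_setT; exact: int_bnd.
have -> : (fun k => \int[m_ (f k)]_x phi x) =
    (fun k => \int[nu_ (f k)]_t (phi \o p) t).
  apply/funext => k; rewrite /Rintegral; congr fine.
  rewrite (@integral_pushforward _ _ _ _ _ _ ms (m_ (f k)) setT
    (EFin \o (phi \o p)))//; last 2 first.
  - exact/measurable_EFinP.
  - rewrite preimage_setT; apply: int_bnd => //.
    + exact: le_lt_trans (mM _) (ltry _).
    + exact: measurableT_comp.
    + by move=> x; exact: phiC.
  rewrite preimage_setT; apply: ae_eq_integral => //.
  - exact/measurable_EFinP.
  - by apply/measurable_EFinP; exact: measurableT_comp.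
  - exists (~` cube B); split => //; first by apply: measurableC; exact: measurable_cube.
    by move=> x /= xn Bx; apply: xn => _ /=; rewrite sP//; exact: pP.
by apply: nuP => //; exists C => t /=.
Qed.

End prokhorov_cube.

(** * Translations of sets *)

Section translations.
Context {R : realType} {n : nat}.
Local Notation T := 'rV[R]_n.
Local Notation leb := (@lebesgue_rV R n).
Implicit Types (D E Omega : set T) (x y z w : T) (r d : R).

(** The erosion of [Omega]: from its points, translations by less than [d] stay in
[Omega]. *)
Definition inner Omega d := [set x : T | forall y, `|y - x| < d -> Omega y].

Lemma closed_inner Omega d : closed (inner Omega d).
Proof.
rewrite (_ : inner Omega d = \bigcap_(y in ~` Omega) ~` ball y d).
  apply: closed_bigI => y _; apply: open_closedC; have [d0|d0] := ltP 0 d.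
    exact: ball_open.
  rewrite (_ : ball y d = set0); first exact: open0.
  apply/seteqP; split => // x; rewrite -ball_normE/= => yx.
  by have := lt_le_trans yx d0; rewrite normr_lt0.
apply/seteqP; split => [x xP y Oy|x xP y yx].
  by rewrite -ball_normE/= => yx; exact/Oy/xP.
apply: contrapT => Oy; apply: (xP y Oy).
by rewrite -ball_normE/=.
Qed.

Lemma measurable_inner Omega d : measurable (inner Omega d).
Proof. by apply: measurable_closed_rV; exact: closed_inner. Qed.

Lemma inner_shift Omega d x y : inner Omega d x -> `|y| < d -> Omega (x + y).
Proof. by move=> xP yd; apply: xP; rewrite addrC addKr. Qed.

Lemma inner_sub Omega d : 0 < d -> inner Omega d `<=` Omega.
Proof. by move=> d0 x xP; apply: xP; rewrite subrr normr0. Qed.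

Lemma inner_add Omega d d' x z : inner Omega d x -> `|z| + d' <= d ->
  inner Omega d' (x + z).
Proof.
move=> xP zd y yx; apply: xP.
rewrite (_ : y - x = z + (y - (x + z))); last first.
  by rewrite [RHS]addrC -addrA opprD addrNK.
by apply: le_lt_trans (ler_normD _ _) _; apply: lt_le_trans zd; rewrite ltrD2l.
Qed.

Definition shift_diff D E z : \bar R :=
  (\int[leb]_(x in D) `|\1_E (x + z)%R - \1_E x|%:E)%E.

Lemma measurable_indic_shift E z : measurable E ->
  measurable_fun [set: T] (fun x => \1_E (x + z) : R).
Proof.
move=> mE; apply: (measurableT_comp (measurable_indic mE)).
exact: measurable_shift.
Qed.

Lemma emeasurable_diff_shift E z w : measurable E ->
  measurable_fun [set: T] (fun x => `|\1_E (x + z) - \1_E (x + w) : R|%:E).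
Proof.
move=> mE; apply/measurable_EFinP; apply: measurableT_comp => //.
by apply: measurable_funB; exact: measurable_indic_shift.
Qed.

Lemma emeasurable_diff_indic E z : measurable E ->
  measurable_fun [set: T] (fun x => `|\1_E (x + z) - \1_E x : R|%:E).
Proof.
move=> mE; under eq_fun do rewrite -[X in `|_ - \1_E X|]addr0.
exact: emeasurable_diff_shift.
Qed.

Lemma emeasurable_comp_shift (f : T -> \bar R) z :
  measurable_fun setT f -> measurable_fun setT (fun x => f (x + z)).
Proof. by move=> mf; apply: (measurableT_comp mf); exact: measurable_shift. Qed.

Lemma ge0_le_integralT D (f g : T -> \bar R) : measurable D ->
  measurable_fun setT f -> measurable_fun setT g ->
  (forall x, (0 <= f x)%E) -> (forall x, (0 <= g x)%E) ->
  (forall x, D x -> (f x <= g x)%E) ->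
  (\int[leb]_(x in D) f x <= \int[leb]_(x in D) g x)%E.
Proof.
by move=> mD mf mg f0 g0 fg; apply: ge0_le_integral => //;
  exact: measurable_funTS.
Qed.

Lemma ge0_integralDT D (f g : T -> \bar R) : measurable D ->
  measurable_fun setT f -> measurable_fun setT g ->
  (forall x, (0 <= f x)%E) -> (forall x, (0 <= g x)%E) ->
  (\int[leb]_(x in D) (f x + g x) =
   \int[leb]_(x in D) f x + \int[leb]_(x in D) g x)%E.
Proof.
by move=> mD mf mg f0 g0; apply: ge0_integralD => //; exact: measurable_funTS.
Qed.

Lemma ge0_integral_shift_le D D' (f : T -> \bar R) z :
  measurable D -> measurable D' -> measurable_fun setT f ->
  (forall x, (0 <= f x)%E) -> (forall x, D x -> D' (x + z)) ->
  (\int[leb]_(x in D) f (x + z)%R <= \int[leb]_(x in D') f x)%E.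
Proof.
move=> mD mD' mf f0 DD'; rewrite -(@ge0_integral_shift _ _ z D')//; last first.
  exact: measurable_funTS.
apply: ge0_subset_integral => //.
  by rewrite -[X in measurable X]setTI; exact: measurable_shift.
by apply: measurable_funTS; exact: emeasurable_comp_shift.
Qed.

Lemma ge0_integral_shiftT (f : T -> \bar R) z : measurable_fun setT f ->
  (forall x, (0 <= f x)%E) ->
  (\int[leb]_x f x = \int[leb]_x f (x + z)%R)%E.
Proof. by move=> mf f0; rewrite -(@ge0_integral_shift _ _ z setT). Qed.

(** [z] is split into [m] equal steps of length at most [r / 8], each of which costs
[c * r], and [m * r <= 8 * |z| + r]. The intermediate points move by at most
[|z|], which the margin [d] of the erosion absorbs. *)
Lemma shift_diff_chain Omega E (r c d : R) z : measurable E ->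
  0 < r -> 0 <= c -> `|z| + r < d ->
  (forall (d' : R) w, r < d' -> `|w| <= r / 8 ->
    (shift_diff (inner Omega d') E w <= (c * r)%:E)%E) ->
  (shift_diff (inner Omega d) E z <= (c * (8 * `|z| + r))%:E)%E.
Proof.
move=> mE r0 c0 zrd H.
pose m := (Num.truncn (8 * `|z| / r)).+1.
have z8r : 0 <= 8 * `|z| / r by rewrite divr_ge0 ?mulr_ge0// ltW.
have /andP[m1 m2] := truncn_itv z8r.
pose w := m%:R^-1 *: z.
have m0 : 0 < m%:R :> R by rewrite ltr0n.
have wr : `|w| <= r / 8.
  rewrite normrZ ger0_norm ?invr_ge0 ?ler0n// mulrC ler_pdivrMr//.
  by move: (ltW m2); rewrite ler_pdivrMr// -/m => h; lra.
have mrz : m%:R * r <= 8 * `|z| + r.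
  by move: m1; rewrite ler_pdivlMr// /m -natr1 => h; lra.
have key k : (k <= m)%N ->
    (shift_diff (inner Omega d) E (k%:R *: w) <= (k%:R * (c * r))%:E)%E.
  elim: k => [_|k IH km].
    rewrite scale0r mul0r /shift_diff.
    by under eq_integral do rewrite addr0 subrr normr0; rewrite integral0.
  pose a := k%:R *: w.
  have aE : k.+1%:R *: w = a + w by rewrite -natr1 scalerDl scale1r.
  have az : `|a| <= `|z|.
    rewrite /a /w scalerA normrZ ler_piMl// ger0_norm ?divr_ge0//.
    by rewrite ler_pdivrMr// mul1r ler_nat ltnW.
  rewrite aE; apply: (@le_trans _ _ (\int[leb]_(x in inner Omega d)
      (`|\1_E (x + (a + w))%R - \1_E (x + a)%R|%:E +
       `|\1_E (x + a)%R - \1_E x|%:E)))%E.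
    apply: ge0_le_integralT; first exact: measurable_inner.
    - exact: emeasurable_diff_indic.
    - apply: emeasurable_funD; first exact: emeasurable_diff_shift.
      exact: emeasurable_diff_indic.
    - by move=> x; rewrite lee_fin.
    - by move=> x; rewrite -EFinD lee_fin addr_ge0.
    - by move=> x _; rewrite -EFinD lee_fin ler_distD.
  rewrite ge0_integralDT; last 5 first.
  - exact: measurable_inner.
  - exact: emeasurable_diff_shift.
  - exact: emeasurable_diff_indic.
  - by move=> x; rewrite lee_fin.
  - by move=> x; rewrite lee_fin.
  have -> : (k.+1%:R * (c * r))%:E = ((c * r)%:E + (k%:R * (c * r))%:E)%E.
    by rewrite -EFinD -natr1; congr (_%:E); ring.
  apply: leeD; last exact/IH/ltnW.
  under eq_integral do rewrite addrA.
  apply: (@le_trans _ _ (shift_diff (inner Omega (d - `|z|)) E w)).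
    apply: (@ge0_integral_shift_le _ _ (fun x => `|\1_E (x + w) - \1_E x|%:E));
      (try exact: measurable_inner) => //.
      exact: emeasurable_diff_indic.
    by move=> x xd; apply: inner_add xd _; lra.
  by apply: H => //; lra.
have := key _ (leqnn m); rewrite /w scalerA divff ?scale1r ?gt_eqF// => /le_trans.
by apply; rewrite lee_fin mulrCA ler_wpM2l.
Qed.

Definition shell r : set T := [set z | r / 2 <= `|z| < r].

Lemma measurable_shell r : measurable (shell r).
Proof.
rewrite (_ : shell r = setT `&` (fun x : T => `|x|) @^-1` `[r / 2, r[%classic).
  exact: measurable_normv.
by rewrite setTI; apply/seteqP; split => x /=; rewrite in_itv.
Qed.

Definition shell_diff Omega E r x y : R :=
  \1_Omega y * \1_(shell r) (y - x) * `|\1_E y - \1_E x|.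

Lemma shell_diff_ge0 Omega E r x y : 0 <= shell_diff Omega E r x y.
Proof. by rewrite /shell_diff !mulr_ge0. Qed.

Lemma measurable_shell_diff Omega E r : measurable Omega -> measurable E ->
  measurable_fun [set: T * T] (fun p => shell_diff Omega E r p.1 p.2).
Proof.
move=> mO mE; apply: measurable_funM; first apply: measurable_funM.
- exact: (measurableT_comp (measurable_indic mO) measurable_snd).
- apply: (measurableT_comp (measurable_indic (measurable_shell r))).
  by apply: measurable_subv; [exact: measurable_snd|exact: measurable_fst].
- apply: measurableT_comp => //; apply: measurable_funB.
    exact: (measurableT_comp (measurable_indic mE) measurable_snd).
  exact: (measurableT_comp (measurable_indic mE) measurable_fst).
Qed.

Lemma emeasurable_shell_diff Omega E r x : measurable Omega -> measurable E ->
  measurable_fun setT (fun y => (shell_diff Omega E r x y)%:E).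
Proof.
move=> mO mE; apply/measurable_EFinP.
apply: measurable_funM; first apply: measurable_funM => //.
- apply: (measurableT_comp (measurable_indic (measurable_shell r))).
  exact: measurable_subv.
- by apply: measurableT_comp => //; exact: measurable_funB.
Qed.

(** The measure of the points of [Omega] in the shell around [x] that [E] separates
from [x]. *)
Definition shell_integral Omega E r x : \bar R :=
  (\int[leb]_y (shell_diff Omega E r x y)%:E)%E.

Lemma measurable_shell_integral Omega E r : measurable Omega -> measurable E ->
  measurable_fun setT (shell_integral Omega E r).
Proof.
move=> mO mE.
apply: (@measurable_fun_fubini_tonelli_F _ _ _ _ _ leb
  (fun p => (shell_diff Omega E r p.1 p.2)%:E)).
  by apply/measurable_EFinP; exact: measurable_shell_diff.
by move=> p; rewrite lee_fin shell_diff_ge0.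
Qed.

Lemma shell_integral_ge0 Omega E r x : (0 <= shell_integral Omega E r x)%E.
Proof. by apply: integral_ge0 => y _; rewrite lee_fin shell_diff_ge0. Qed.

(** If [E] separates [x] from [x + z], it separates each third point from one of
them. Integrate this over a cube of side [r / 4] that lies in the shells around
both points. *)
Lemma diff_le_shell_integral Omega E r d x z : (0 < n)%N ->
  measurable Omega -> measurable E ->
  0 < r -> r < d -> `|z| <= r / 8 -> inner Omega d x ->
  (((r / 4) ^+ n * `|\1_E (x + z)%R - \1_E x|)%:E <=
    shell_integral Omega E r x + shell_integral Omega E r (x + z))%E.
Proof.
move=> n0 mO mE r0 rd zr xd.
(* The bounds 5/8 and 7/8 leave on both sides of the shell a margin [r / 8] for
   [z]. *)
pose A : set T := [set w | forall i, 5 / 8 * r <= w ord0 i < 7 / 8 * r].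
have lA : leb A = ((r / 4) ^+ n)%:E.
  by rewrite lebesgue_rV_cube; [congr (_ ^+ n)%:E|]; lra.
have mA : measurable A by exact: measurable_box.
have An w : A w -> 5 / 8 * r <= `|w| < 7 / 8 * r.
  move=> Aw; apply/andP; split.
    have /andP[h _] := Aw (Ordinal n0); apply: le_trans h _.
    by apply: le_trans (ler_norm _) _; exact: coord_le_normv.
  apply/normv_ltP => [|i]; first lra.
  by have /andP[? ?] := Aw i; rewrite ger0_norm//; lra.
have shiftE y : shell_integral Omega E r y =
    (\int[leb]_w (shell_diff Omega E r y (w + x)%R)%:E)%E.
  rewrite /shell_integral (@ge0_integral_shiftT _ x)//.
    exact: emeasurable_shell_diff.
  by move=> w; rewrite lee_fin shell_diff_ge0.
have ms y : measurable_fun setT (fun w => (shell_diff Omega E r y (w + x)%R)%:E).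
  apply: (@emeasurable_comp_shift (fun w => (shell_diff Omega E r y w)%:E)).
  exact: emeasurable_shell_diff.
rewrite !shiftE -ge0_integralDT//; last 2 first.
- by move=> w; rewrite lee_fin shell_diff_ge0.
- by move=> w; rewrite lee_fin shell_diff_ge0.
have -> : ((r / 4) ^+ n * `|\1_E (x + z) - \1_E x|)%:E =
    (\int[leb]_(w in A) (cst `|\1_E (x + z)%R - \1_E x|%:E) w)%E.
  transitivity (`|\1_E (x + z) - \1_E x|%:E * leb A)%E.
    by rewrite lA -EFinM mulrC.
  by rewrite integral_cst.
rewrite integral_mkcond; apply: ge0_le_integral => //.
- by move=> w _; rewrite /patch; case: ifP => // _; rewrite lee_fin.
- by apply/(measurable_restrictT _ mA); exact: measurable_cst.
- by apply: emeasurable_funD.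
move=> w _; rewrite /patch; case: ifPn; last first.
  by move=> _; rewrite -EFinD lee_fin addr_ge0 ?shell_diff_ge0.
rewrite inE => Aw; have /andP[w1 w2] := An w Aw.
have Oxw : Omega (w + x) by rewrite addrC; apply: inner_shift xd _; lra.
have h1 : \1_(shell r) (w + x - x) = 1 :> R.
  by rewrite indicE mem_set// /shell/= addrK; apply/andP; split; lra.
have h2 : \1_(shell r) (w + x - (x + z)) = 1 :> R.
  rewrite indicE mem_set// /shell/= opprD addrA addrK.
  have := ler_normB w z; have := lerB_dist w z.
  by move=> ? ?; apply/andP; split; lra.
rewrite -EFinD lee_fin /shell_diff h1 h2 [\1_Omega _]indicE mem_set// !mul1r.
apply: le_trans (ler_distD (\1_E (w + x)) _ _) _.
by rewrite distrC [leRHS]addrC.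
Qed.

Lemma shift_diff_le_shell Omega E r (c d : R) z : (0 < n)%N ->
  measurable Omega -> measurable E ->
  0 < r -> r < d -> `|z| <= r / 8 -> 0 <= c ->
  (\int[leb]_(x in Omega) shell_integral Omega E r x <= (c * r ^+ n.+1)%:E)%E ->
  (shift_diff (inner Omega d) E z <= (2 * 4 ^+ n * c * r)%:E)%E.
Proof.
move=> n0 mO mE r0 rd zr c0 H.
have mI := measurable_inner Omega d.
have mG := measurable_shell_integral r mO mE.
have p0 : 0 < (r / 4) ^+ n by rewrite exprn_gt0// divr_gt0.
have h : (((r / 4) ^+ n)%:E * shift_diff (inner Omega d) E z <=
    (2 * (c * r ^+ n.+1))%:E)%E.
  rewrite /shift_diff -ge0_integralZl//; last 2 first.
  - by apply: measurable_funTS; exact: emeasurable_diff_indic.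
  - by rewrite lee_fin ltW.
  apply: (@le_trans _ _ (\int[leb]_(x in inner Omega d)
    (shell_integral Omega E r x + shell_integral Omega E r (x + z)%R)))%E.
    apply: ge0_le_integralT => //.
    - apply: emeasurable_funM => //; exact: emeasurable_diff_indic.
    - by apply: emeasurable_funD => //; exact: emeasurable_comp_shift.
    - by move=> x; rewrite mule_ge0// lee_fin ltW.
    - by move=> x; rewrite adde_ge0 ?shell_integral_ge0.
    - by move=> x xd; rewrite -EFinM; exact: (diff_le_shell_integral n0 mO mE r0 rd).
  rewrite ge0_integralDT//; last 3 first.
  - exact: emeasurable_comp_shift.
  - by move=> x; exact: shell_integral_ge0.
  - by move=> x; exact: shell_integral_ge0.
  rewrite mulrDl mul1r EFinD; apply: leeD.
    apply: le_trans H; apply: ge0_subset_integral => //.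
    - exact: measurable_funTS.
    - by move=> x _; exact: shell_integral_ge0.
    - by apply: inner_sub; exact: lt_trans rd.
  apply: le_trans H; apply: ge0_integral_shift_le => //.
    by move=> x; exact: shell_integral_ge0.
  by move=> x xd; apply: inner_shift xd _; lra.
rewrite -(@lee_pmul2l _ ((r / 4) ^+ n)%:E)// ?lte_fin//.
apply: le_trans h _; rewrite -EFinM lee_fin exprMn exprVn exprS.
rewrite [leRHS](_ : _ = (4 ^+ n / 4 ^+ n) * (2 * (c * (r * r ^+ n)))); last by ring.
by rewrite divff ?mul1r// expf_neq0.
Qed.

End translations.

(** * The energy carried by a dyadic shell *)

Section shell_energy.
Context {R : realType} {n : nat}.
Local Notation T := 'rV[R]_n.
Local Notation leb := (@lebesgue_rV R n).
Implicit Types (E Omega : set T) (x y z : T) (r d m : R) (u : T -> R).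

Lemma enorm_ge0 z : 0 <= enorm z. Proof. exact: sqrtr_ge0. Qed.

Lemma enorm_gt0 z : z != 0 -> 0 < enorm z.
Proof.
move=> z0; rewrite sqrtr_gt0 lt_neqAle sumr_ge0 ?andbT; last first.
  by move=> i _; rewrite -expr2 sqr_ge0.
apply: contra z0 => /eqP/esym z0; apply/eqP/rowP => i; rewrite mxE.
have := @psumr_eq0P _ _ _ (fun i => z ord0 i * z ord0 i) _ z0 i isT.
rewrite -expr2 => h; apply/eqP; rewrite -sqrf_eq0; apply/eqP/h => j _.
by rewrite -expr2 sqr_ge0.
Qed.

Lemma enorm_le_normv z : enorm z <= n%:R * `|z|.
Proof.
have nz0 : 0 <= n%:R * `|z| by rewrite mulr_ge0.
rewrite -(ger0_norm nz0) -sqrtr_sqr ler_sqrt ?sqr_ge0//.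
apply: (@le_trans _ _ (\sum_(i < n) `|z| ^+ 2)).
  apply: ler_sum => i _; rewrite -expr2 -(real_normK (num_real _)).
  by rewrite lerXn2r ?nnegrE// coord_le_normv.
rewrite sumr_const card_ord -[leLHS]mulr_natl exprMn ler_wpM2r ?sqr_ge0//.
by rewrite -natrX ler_nat; case: (n) => // k; rewrite leq_pmulr.
Qed.

Definition pair_energy u x y : R := (u y - u x) ^+ 2 / enorm (y - x) ^+ n.+1.

Lemma pair_energy_ge0 u x y : 0 <= pair_energy u x y.
Proof. by rewrite mulr_ge0 ?sqr_ge0// invr_ge0 exprn_ge0// enorm_ge0. Qed.

Definition shell_density Omega u r x y : R :=
  \1_Omega y * \1_(shell r) (y - x) * pair_energy u x y.

Lemma shell_density_ge0 Omega u r x y : 0 <= shell_density Omega u r x y.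
Proof. by rewrite /shell_density mulr_ge0 ?pair_energy_ge0. Qed.

Definition shell_energy Omega u r x : \bar R :=
  (\int[leb]_y (shell_density Omega u r x y)%:E)%E.

Lemma shell_energy_ge0 Omega u r x : (0 <= shell_energy Omega u r x)%E.
Proof. by apply: integral_ge0 => y _; rewrite lee_fin shell_density_ge0. Qed.

Lemma measurable_inv : measurable_fun [set: R] (fun t : R => t^-1).
Proof.
rewrite -(setvU [set 0]); apply/measurable_funU => //; first exact: measurableC.
split; last first.
  apply: (@eq_measurable_fun _ _ _ _ _ (cst (0 : R))) => [t /set_mem /= ->|]; last exact: measurable_cst.
  by rewrite invr0.
apply: open_continuous_measurable_fun.
  apply: closed_openC; exact/accessible_closed_set1/hausdorff_accessible/norm_hausdorff.
by move=> t /set_mem /= t0; apply: inv_continuous; exact/eqP.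
Qed.

Lemma measurable_pair_energy u : measurable_fun setT u ->
  measurable_fun [set: T * T] (fun p => pair_energy u p.1 p.2).
Proof.
move=> mu; apply: measurable_funM.
  apply: measurable_funX; apply: measurable_funB.
    exact: (measurableT_comp mu measurable_snd).
  exact: (measurableT_comp mu measurable_fst).
rewrite (_ : (fun _ => _) = (fun t => t^-1) \o
  (fun p : T * T => enorm (p.2 - p.1) ^+ n.+1))//.
apply: measurableT_comp; first exact: measurable_inv.
apply: measurable_funX; apply: (measurableT_comp (@measurable_enorm R n)).
by apply: measurable_subv; [exact: measurable_snd|exact: measurable_fst].
Qed.

Lemma measurable_shell_density Omega u r :
  measurable Omega -> measurable_fun setT u ->
  measurable_fun [set: T * T] (fun p => shell_density Omega u r p.1 p.2).
Proof.
move=> mO mu; apply: measurable_funM; last exact: measurable_pair_energy.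
apply: measurable_funM.
  exact: (measurableT_comp (measurable_indic mO) measurable_snd).
apply: (measurableT_comp (measurable_indic (measurable_shell r))).
by apply: measurable_subv; [exact: measurable_snd|exact: measurable_fst].
Qed.

Lemma emeasurable_section (f : T * T -> R) x : measurable_fun setT f ->
  measurable_fun setT (fun y => (f (x, y))%:E).
Proof.
move=> mf; apply/measurable_EFinP; apply: (measurableT_comp mf).
exact: measurable_pair1.
Qed.

Lemma measurable_partial_integral (f : T * T -> R) : measurable_fun setT f ->
  (forall p, 0 <= f p) ->
  measurable_fun setT (fun x => \int[leb]_y (f (x, y))%:E)%E.
Proof.
move=> mf f0; apply: (@measurable_fun_fubini_tonelli_F _ _ _ _ _ leb (EFin \o f)).
  exact/measurable_EFinP.
by move=> p; rewrite lee_fin.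
Qed.

Lemma measurable_shell_energy Omega u r :
  measurable Omega -> measurable_fun setT u ->
  measurable_fun setT (shell_energy Omega u r).
Proof.
move=> mO mu.
apply: (measurable_partial_integral (measurable_shell_density r mO mu)) => p.
exact: shell_density_ge0.
Qed.

Lemma lebesgue_shell_le r : 0 < r -> (leb (shell r) <= ((2 * r) ^+ n)%:E)%E.
Proof.
move=> r0.
have -> : 2 * r = r - (- r) by ring.
rewrite -lebesgue_rV_cube; last lra.
apply: le_measure.
- by rewrite inE; exact: measurable_shell.
- by rewrite inE; exact: measurable_box.
- move=> z /andP[_ /normv_ltP-/(_ r0) zr] i.
  by have := zr i; rewrite ltr_norml => /andP[/ltW -> ->].
Qed.

(** Let [E] separate [y] from [x]. If [u x] is farther than [d] from [m], then [u x]
and [u y] differ by at least [d] and the pair contributes at least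
[d ^+ 2 / (n * r) ^+ n.+1] to the energy of the shell. Otherwise [x] lies in the
band, and the shell has measure at most [(2 * r) ^+ n]. *)
Lemma shell_integral_le Omega u r d m x :
  measurable Omega -> measurable_fun setT u -> 0 < r -> 0 < d -> Omega x ->
  (shell_integral Omega (Omega `&` [set y | (m < u y)%R]) r x <=
   (d ^- 2 * (n%:R * r) ^+ n.+1)%:E * shell_energy Omega u r x +
   ((2 * r) ^+ n)%:E * (\1_[set y | (`|u y - m| <= d)%R] x)%:E)%E.
Proof.
move=> mO mu r0 d0 Ox; set E := _ `&` _.
have mE : measurable E.
  by apply: measurable_superlevel => //; exact: measurable_funTS.
have c0 : 0 <= d ^- 2 * (n%:R * r) ^+ n.+1.
  by rewrite mulr_ge0 ?invr_ge0 ?exprn_ge0 ?mulr_ge0// ltW.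
have [bad|good] := leP `|u x - m| d.
  apply: (@le_trans _ _ ((2 * r) ^+ n)%:E); last first.
    rewrite indicE mem_set//= mule1 leeDr// mule_ge0 ?lee_fin//.
    exact: shell_energy_ge0.
  apply: le_trans (lebesgue_shell_le r0).
  rewrite -[leb (shell r)]mul1e -integral_cst; last exact: measurable_shell.
  rewrite integral_mkcond.
  have mp : measurable_fun setT ((cst 1%E : T -> \bar R) \_ (shell r)).
    by apply/(measurable_restrictT _ (measurable_shell r)); exact: measurable_cst.
  have p0 y : (0 <= ((cst 1%E : T -> \bar R) \_ (shell r)) y)%E.
    by rewrite /patch; case: ifP.
  rewrite (@ge0_integral_shiftT _ _ _ (- x) mp p0).
  apply: ge0_le_integralT => //.
  - exact: emeasurable_shell_diff.
  - exact: emeasurable_comp_shift.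
  - by move=> y; rewrite lee_fin shell_diff_ge0.
  - move=> y _; rewrite /shell_diff /patch [\1_(shell _) _]indicE.
    case: ifPn => _; last by rewrite mulr0 mul0r.
    rewrite mulr1 lee_fin !indicE.
    by case: (y \in Omega); case: (y \in E); case: (x \in E) => /=;
      rewrite ?subrr ?subr0 ?sub0r ?normrN ?normr0 ?normr1; lra.
rewrite [\1_[set _ | _] x]indicE memNset; last by move=> /=; rewrite leNgt good.
rewrite mule0 adde0 -ge0_integralZl//; last 2 first.
- apply: (emeasurable_section x (measurable_shell_density r mO mu)).
- by move=> y _; rewrite lee_fin shell_density_ge0.
apply: ge0_le_integralT => //.
- exact: emeasurable_shell_diff.
- apply: emeasurable_funM => //.
  exact: (emeasurable_section x (measurable_shell_density r mO mu)).
- by move=> y; rewrite lee_fin shell_diff_ge0.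
- by move=> y; rewrite mule_ge0 ?lee_fin ?shell_density_ge0.
move=> y _; rewrite -EFinM lee_fin /shell_diff /shell_density.
rewrite mulrCA; rewrite [\1_Omega y]indicE [\1_(shell r) _]indicE.
have [Oy|_] := boolP (y \in Omega); last by rewrite !mul0r.
have [/set_mem/andP[yx1 yx2]|_] := boolP (y - x \in shell r); last by rewrite !mulr0 !mul0r.
have EE w : Omega w -> \1_E w = (m < u w)%R%:R :> R.
  move=> Ow; rewrite indicE; have [h|h] := boolP (m < u w); first by rewrite mem_set.
  by rewrite memNset// => -[_] /=; apply/negP.
rewrite !mul1r; set e := `|_|.
have yx0 : 0 < enorm (y - x).
  by apply: enorm_gt0; rewrite -normr_gt0; lra.
have [->|e1] : e = 0 \/ e = 1 /\ d ^+ 2 <= (u y - u x) ^+ 2.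
- rewrite /e !EE//; last exact: set_mem.
  have gd : m + d < u x \/ u x < m - d.
    by move: good; case: (ger0P (u x - m)) => _ ?; [left|right]; lra.
  have [h1|h1] := ltP m (u y); have [h2|h2] := ltP m (u x).
  + by left; rewrite subrr normr0.
  + right; rewrite subr0 normr1; split => //.
    by rewrite lerXn2r ?nnegrE//; case: gd; lra.
  + right; rewrite sub0r normrN normr1; split => //.
    by rewrite -[leRHS]sqrrN lerXn2r ?nnegrE//; case: gd; lra.
  + by left; rewrite subrr normr0.
- by rewrite mulr_ge0 ?pair_energy_ge0.
move: e1 => [-> dle]; rewrite /pair_energy.
rewrite [leRHS](_ : _ = ((u y - u x) ^+ 2 / d ^+ 2) *
  ((n%:R * r) ^+ n.+1 / enorm (y - x) ^+ n.+1)); last by rewrite invfM; ring.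
rewrite -[leLHS]mul1r; apply: ler_pM => //.
  by rewrite ler_pdivlMr ?mul1r// exprn_gt0.
rewrite ler_pdivlMr ?exprn_gt0// mul1r lerXn2r ?nnegrE ?enorm_ge0//.
  by rewrite mulr_ge0// ltW.
apply: le_trans (enorm_le_normv _) _.
by rewrite ler_wpM2l// ltW.
Qed.

(** The shells are disjoint. The right-hand side records in addition that they all
lie outside the ball of radius [2^-1 ^+ (p + k)], as the induction requires. *)
Lemma sum_shell_le (p k : nat) z :
  \sum_(i < k) \1_(shell (2^-1 ^+ (p + i))) z <= ((2^-1 : R) ^+ (p + k) <= `|z|)%R%:R :> R.
Proof.
elim: k => [|k IH]; first by rewrite big_ord0.
rewrite big_ord_recr/= indicE addnS.
have hk : 2^-1 ^+ (p + k).+1 = 2^-1 ^+ (p + k) / 2 :> R by rewrite exprS mulrC.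
have h0 : 0 < 2^-1 ^+ (p + k) :> R by rewrite exprn_gt0// invr_gt0.
have [/set_mem/andP[h1 h2]|_] := boolP (z \in shell _).
  have h3 : (2^-1 ^+ (p + k) <= `|z|) = false by apply/negbTE; rewrite -ltNge.
  by rewrite hk h1; move: IH; rewrite h3/= => IH; lra.
rewrite addr0; apply: le_trans IH _.
have [h|//] := leP (2^-1 ^+ (p + k)) `|z|.
by rewrite hk (le_trans _ h)//; lra.
Qed.

Lemma lte_sum_cst (a : nat -> \bar R) (c : R) (k : nat) :
  (forall i, (i < k.+1)%N -> (c%:E < a i)%E) ->
  ((c * k.+1%:R)%:E < \sum_(i < k.+1) a i)%E.
Proof.
elim: k => [|k IH] h; first by rewrite big_ord1 mulr1 h.
rewrite big_ord_recr/= -natr1 mulrDr mulr1 EFinD; apply: lteD.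
  by apply: IH => i ik; apply: h; exact: ltnW.
exact: h.
Qed.

(** Pigeonhole: the [p] shells of exponents [p] to [2 * p - 1] are disjoint, so their
energies add up to at most [c * p], and one of them is at most [c]. *)
Lemma good_scale Omega u (c : R) (p : nat) : (0 < p)%N ->
  measurable Omega -> measurable_fun setT u ->
  (\int[leb]_(x in Omega) fractional_density Omega u x <= (c * p%:R)%:E)%E ->
  exists2 j, (p <= j < 2 * p)%N &
    (\int[leb]_(x in Omega) shell_energy Omega u (2^-1 ^+ j) x <= c%:E)%E.
Proof.
move=> p0 mO mu H.
apply: contrapT => /forall2NP hN.
have lt i : (i < p)%N -> (c%:E < \int[leb]_(x in Omega)
    shell_energy Omega u (2^-1 ^+ (p + i)) x)%E.
  move=> ip; rewrite ltNge; apply/negP => le.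
  have [] := hN (p + i)%N => //.
  by rewrite leq_addr mul2n -addnn ltn_add2l ip.
case: p p0 H hN lt => // k _ H _ /lte_sum_cst; apply/negP; rewrite -leNgt.
apply: le_trans H; rewrite -ge0_integral_sum//; last 2 first.
- by move=> i; apply: measurable_funTS; exact: measurable_shell_energy.
- by move=> i x _; exact: shell_energy_ge0.
apply: ge0_le_integral => //.
- by move=> x _; apply: sume_ge0 => i _; exact: shell_energy_ge0.
- apply: measurable_funTS; apply: emeasurable_sum => i.
  exact: measurable_shell_energy.
- apply: measurable_funTS.
  rewrite (_ : fractional_density Omega u = fun x => (\int[leb]_y
      ((fun p : T * T => \1_Omega p.2 * pair_energy u p.1 p.2) (x, y))%:E)%E).
    apply: (@measurable_partial_integral (fun p : T * T => \1_Omega p.2 * pair_energy u p.1 p.2)).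
      apply: measurable_funM; last exact: measurable_pair_energy.
      exact: (measurableT_comp (measurable_indic mO) measurable_snd).
    by move=> q; rewrite mulr_ge0 ?pair_energy_ge0.
  apply/funext => x; rewrite /fractional_density integral_mkcond.
  apply: eq_integral => y _; rewrite /patch/= indicE -/(pair_energy u x y).
  by case: ifP; rewrite ?mul1r ?mul0r.
move=> x Ox; rewrite /shell_energy -ge0_integral_sum//; last 2 first.
- by move=> i; exact: (emeasurable_section x (measurable_shell_density _ mO mu)).
- by move=> i y _; rewrite lee_fin shell_density_ge0.
rewrite /fractional_density [leRHS]integral_mkcond.
have E y : (((fun y => ((u y - u x) ^+ 2 / enorm (y - x) ^+ n.+1)%:E) \_ Omega) y =
    (\1_Omega y * pair_energy u x y)%:E)%E.
  rewrite /patch/= indicE -/(pair_energy u x y).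
  by case: ifP; rewrite ?mul1r ?mul0r.
under [leRHS]eq_integral do rewrite E.
apply: ge0_le_integralT => //.
- apply: emeasurable_sum => i.
  exact: (emeasurable_section x (measurable_shell_density _ mO mu)).
- apply: (@emeasurable_section (fun q => \1_Omega q.2 * pair_energy u q.1 q.2)).
  apply: measurable_funM; last exact: measurable_pair_energy.
  exact: (measurableT_comp (measurable_indic mO) measurable_snd).
- by move=> y; apply: sume_ge0 => i _; rewrite lee_fin shell_density_ge0.
- by move=> y; rewrite lee_fin mulr_ge0 ?pair_energy_ge0.
move=> y _; rewrite sumEFin lee_fin /shell_density -mulr_suml -mulr_sumr.
rewrite ler_wpM2r ?pair_energy_ge0// ler_piMr//.
by apply: le_trans (sum_shell_le _ _ _) _; case: (leP _ `|y - x|); rewrite ?lexx ?ler01.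
Qed.

End shell_energy.

(** * From the energy to a bound on translations *)

Section energy_estimate.
Context {R : realType} {n : nat}.
Local Notation T := 'rV[R]_n.
Local Notation leb := (@lebesgue_rV R n).
Implicit Types (Omega : set T) (u : T -> R).

(** The band where [|u - m| <= d] has measure at most [C * eps / w0], because
[W >= w0] there; [eps <= r] makes this the same order [r ^+ n.+1] as the
contribution of the energy. *)
Lemma shell_integral_bound Omega u (W : R -> R) (m d w0 r c C eps : R) :
  measurable Omega -> measurable_fun setT u -> measurable_fun setT W ->
  (forall s, 0 <= W s) -> 0 < d -> 0 < w0 ->
  (forall s, `|s - m| <= d -> w0 <= W s) ->
  0 < r -> eps <= r -> 0 <= C -> 0 <= c ->
  (\int[leb]_(x in Omega) (W (u x))%:E <= (C * eps)%:E)%E ->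
  (\int[leb]_(x in Omega) shell_energy Omega u r x <= c%:E)%E ->
  (\int[leb]_(x in Omega)
     shell_integral Omega (Omega `&` [set y | (m < u y)%R]) r x <=
   ((d ^- 2 * n%:R ^+ n.+1 * c + 2 ^+ n * C / w0) * r ^+ n.+1)%:E)%E.
Proof.
move=> mO mu mW W0 d0 w00 Ww r0 er C0 c0 HW Hc.
have mE : measurable (Omega `&` [set y | (m < u y)%R]).
  by apply: measurable_superlevel => //; exact: measurable_funTS.
pose bad : set T := [set y | (`|u y - m| <= d)%R].
have mbad : measurable bad.
  rewrite (_ : bad = setT `&` (fun y => `|u y - m|) @^-1` `]-oo, d]%classic).
    have : measurable_fun setT (fun y => `|u y - m|).
      by apply: measurableT_comp => //; exact: measurable_funB.
    by apply.
  by rewrite setTI; apply/seteqP; split => y /=; rewrite in_itv.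
have ibad : measurable_fun setT (fun x : T => (\1_bad x : R)%:E).
  by apply/measurable_EFinP; exact: measurable_indic.
set K1 := d ^- 2 * (n%:R * r) ^+ n.+1; set K2 := (2 * r) ^+ n.
have K10 : 0 <= K1.
  by rewrite mulr_ge0 ?invr_ge0 ?exprn_ge0 ?mulr_ge0// ltW.
have K20 : 0 <= K2 by rewrite exprn_ge0// mulr_ge0// ltW.
have mSE := measurable_shell_energy r mO mu.
have SE0 := shell_energy_ge0 Omega u r.
apply: (@le_trans _ _ (\int[leb]_(x in Omega)
    (K1%:E * shell_energy Omega u r x + K2%:E * (\1_bad x)%:E)))%E.
  apply: ge0_le_integralT => //.
  - exact: measurable_shell_integral.
  - by apply: emeasurable_funD; exact: emeasurable_funM.
  - by move=> x; exact: shell_integral_ge0.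
  - by move=> x; rewrite adde_ge0// mule_ge0// ?lee_fin.
  - by move=> x Ox; exact: shell_integral_le.
rewrite ge0_integralDT//; last 4 first.
- exact: emeasurable_funM.
- exact: emeasurable_funM.
- by move=> x; rewrite mule_ge0.
- by move=> x; rewrite mule_ge0// lee_fin.
rewrite !ge0_integralZl//; last 2 first.
- exact: measurable_funTS.
- exact: measurable_funTS.
have Hbad : (\int[leb]_(x in Omega) (\1_bad x)%:E <= (C * eps / w0)%:E)%E.
  rewrite EFinM lee_pdivlMr// muleC -ge0_integralZl//; last 2 first.
  - exact: measurable_funTS.
  - by rewrite lee_fin ltW.
  apply: le_trans HW; apply: ge0_le_integralT => //.
  - exact: emeasurable_funM.
  - by apply/measurable_EFinP; exact: measurableT_comp.
  - by move=> x; rewrite mule_ge0// lee_fin ltW.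
  - by move=> x; rewrite lee_fin.
  move=> x _; rewrite -EFinM lee_fin indicE.
  have [/set_mem/Ww|_] := boolP (x \in bad); first by rewrite mulr1.
  by rewrite mulr0.
apply: (@le_trans _ _ (K1%:E * c%:E + K2%:E * (C * eps / w0)%:E)%E).
  by apply: leeD; apply: lee_wpmul2l.
rewrite -!EFinM -EFinD lee_fin mulrDl; apply: lerD.
  by rewrite /K1 exprMn le_eqVlt; apply/orP; left; apply/eqP; ring.
rewrite /K2 exprMn exprS [leRHS](_ : _ = 2 ^+ n * r ^+ n * (C * r / w0)); last first.
  by ring.
rewrite ler_wpM2l ?mulr_ge0 ?exprn_ge0// ?(ltW r0)//.
by rewrite ler_wpM2r ?invr_ge0 ?(ltW w00)// ler_wpM2l.
Qed.

(** [p] is the integer part of the logarithm of [1 / eps] in base 4, so that the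
scales [2 ^- j] with [p <= j < 2 * p] range between [eps] and [2 * sqrt eps]. *)
Lemma dyadic_exponent (eps : R) : 0 < eps -> eps <= 4^-1 ->
  exists p : nat, [/\ (0 < p)%N, eps <= 4^-1 ^+ p, 4^-1 ^+ p <= 4 * eps &
    `|ln eps| <= 2 * ln 4 * p%:R].
Proof.
move=> e0 e4.
have l4 : 0 < ln 4 :> R by rewrite ln_gt0// ltr1n.
have le : ln eps <= - ln 4.
  by rewrite -lnV ?posrE// ler_ln ?posrE// invr_gt0.
pose L := - ln eps / ln 4.
have L1 : 1 <= L by rewrite /L ler_pdivlMr//; lra.
have L0 : 0 <= L by exact: le_trans L1.
have /andP[p1 p2] := truncn_itv L0.
have lnp k : ln (4^-1 ^+ k) = - (ln 4 * k%:R) :> R.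
  by rewrite lnXn ?invr_gt0// lnV ?posrE// mulr_natr mulNrn.
have p0 : (0 < Num.truncn L)%N by rewrite truncn_gt0.
exists (Num.truncn L); split => //.
- rewrite -ler_ln ?posrE ?exprn_gt0 ?invr_gt0// lnp.
  by move: p1; rewrite /L ler_pdivlMr//; lra.
- rewrite (_ : 4^-1 ^+ _ = 4 * 4^-1 ^+ (Num.truncn L).+1); last first.
    by rewrite exprS mulrA divff ?mul1r.
  rewrite ler_wpM2l// -ler_ln ?posrE ?exprn_gt0 ?invr_gt0// lnp.
  by move: (ltW p2); rewrite {1}/L ler_pdivrMr//; lra.
- rewrite ltr0_norm; last lra.
  have q1 : 1 <= (Num.truncn L)%:R :> R by rewrite ler1n.
  by move: (ltW p2); rewrite {1}/L ler_pdivrMr// -natr1; nra.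
Qed.

(** Among the [p] scales given by [dyadic_exponent], one has a shell energy bounded
independently of [eps], since [|ln eps|] is at most a multiple of [p]; there the
estimates on the shell and the chaining of short translations apply. *)
Lemma energy_shift_estimate Omega (W : R -> R) (m d w0 C : R) : (0 < n)%N ->
  measurable Omega -> measurable_fun setT W -> (forall s, 0 <= W s) ->
  0 < d -> 0 < w0 -> (forall s, `|s - m| <= d -> w0 <= W s) -> 0 <= C ->
  exists2 c1 : R, 0 <= c1 & forall (eps : R) u, 0 < eps -> eps <= 4^-1 ->
    measurable_fun Omega u ->
    (\int[leb]_(x in Omega) (W (u x))%:E <= (C * eps)%:E)%E ->
    (\int[leb]_(x in Omega) fractional_density Omega u x <= (C * `|ln eps|)%:E)%E ->
    exists r : R, [/\ 0 < r, r ^+ 2 <= 4 * eps & forall (delta : R) z,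
      `|z| + r < delta ->
      (shift_diff (inner Omega delta) (Omega `&` [set y | (m < u y)%R]) z <=
        (c1 * (8 * `|z| + r))%:E)%E].
Proof.
move=> n0 mO mW W0 d0 w00 Ww C0.
have l4 : 0 < ln 4 :> R by rewrite ln_gt0// ltr1n.
pose c := C * (2 * ln 4); have c0 : 0 <= c by rewrite mulr_ge0// mulr_ge0// ltW.
pose c2 := d ^- 2 * n%:R ^+ n.+1 * c + 2 ^+ n * C / w0.
have c20 : 0 <= c2.
  by rewrite addr_ge0// !mulr_ge0// ?invr_ge0 ?exprn_ge0// ltW.
exists (2 * 4 ^+ n * c2); first by rewrite !mulr_ge0// exprn_ge0.
move=> eps u e0 e4 mu HW Hf.
(* [v] extends [u] by zero, to be measurable on the whole space. *)
pose v := u \_ Omega.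
have vu x : Omega x -> v x = u x by move=> Ox; rewrite /v patchE mem_set.
have mv : measurable_fun setT v by apply/(measurable_restrictT _ mO).
have {}HW : (\int[leb]_(x in Omega) (W (v x))%:E <= (C * eps)%:E)%E.
  by apply: le_trans HW; under eq_integral => x /set_mem Ox do rewrite vu//.
have [p [p0 ep pe lp]] := dyadic_exponent e0 e4.
have {}Hf : (\int[leb]_(x in Omega) fractional_density Omega v x <=
    (c * p%:R)%:E)%E.
  rewrite (eq_integral (fractional_density Omega u)); last first.
    move=> x /set_mem Ox; apply: eq_integral => y /set_mem Oy.
    by rewrite !vu.
  by apply: le_trans Hf _; rewrite lee_fin /c -mulrA ler_wpM2l.
have -> : Omega `&` [set y | m < u y] = Omega `&` [set y | m < v y].
  by apply/seteqP; split => x [Ox] /=; rewrite vu.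
have mE : measurable (Omega `&` [set y | (m < v y)%R]).
  by apply: measurable_superlevel => //; exact: measurable_funTS.
have [j /andP[pj j2p] Hj] := good_scale p0 mO mv Hf.
have r0 : 0 < 2^-1 ^+ j :> R by rewrite exprn_gt0// invr_gt0.
have h41 : 4^-1 = 2^-1 ^+ 2 :> R by rewrite expr2 -invfM; congr (_^-1); ring.
have er : eps <= 2^-1 ^+ j.
  apply: le_trans ep _; rewrite h41 -exprM ler_wiXn2l ?invr_ge0 ?invf_le1 ?ler1n//.
  exact: ltnW.
exists (2^-1 ^+ j); split => //.
  apply: le_trans pe; rewrite h41 -!exprM mulnC ler_wiXn2l ?invr_ge0 ?invf_le1 ?ler1n//.
  by rewrite leq_mul2l.
move=> delta z zr; apply: shift_diff_chain => //; first by rewrite !mulr_ge0// exprn_ge0.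
move=> delta' w rd wr; apply: shift_diff_le_shell => //.
exact: (shell_integral_bound mO mv mW W0 d0 w00 Ww r0 er C0 c0 HW Hj).
Qed.

End energy_estimate.

(** * Compactness of sets in measure *)

Section symdiff_complete.
Context d (T : measurableType d) {R : realType} (mu : {measure set T -> \bar R}).

(** Along a subsequence [g] whose consecutive terms are at distance at most [2 ^- k],
the limit inferior [E] can differ from [F (g k)] only at points where two later
consecutive terms differ, and the measures of these sets sum to [2 / 2 ^ k]. *)
Lemma symdiff_cauchy_cvg (F : nat -> set T) : (forall k, measurable (F k)) ->
  (forall e : R, 0 < e -> exists K, forall i j, (K <= i)%N -> (K <= j)%N ->
     (mu (F i `+` F j) <= e%:E)%E) ->
  exists2 f : nat -> nat, {homo f : i j / (i < j)%N} &
  exists E, [/\ measurable E, forall D, (forall k, F k `<=` D) -> E `<=` D &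
    mu (F (f k) `+` E) @[k --> \oo] --> 0%E].
Proof.
move=> mF cF.
have p2 k : 0 < (2 ^ k)%:R^-1 :> R by rewrite invr_gt0 ltr0n expn_gt0.
have /choice[N NP] k := cF _ (p2 k).
pose g := fix g k := if k is k'.+1 then maxn (N k) (g k').+1 else N 0%N.
have gN k : (N k <= g k)%N by case: k => //= k; exact: leq_maxl.
have gS k : (g k < g k.+1)%N by rewrite /= leq_max ltnSn orbT.
have g_mono : {homo g : i j / (i < j)%N}.
  by apply: homo_ltn => [? ? ?|//]; exact: ltn_trans.
have mFY i j : measurable (F i `+` F j).
  exact: measurable_symdiff.
pose E := \bigcup_K \bigcap_(k in [set k | (K <= k)%N]) F (g k).
have mE : measurable E.
  apply: bigcupT_measurable => K; apply: bigcap_measurable => //.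
  by exists K => /=.
exists g => //; exists E; split => //.
  by move=> D FD x [K _ /(_ K (leqnn K))]; exact: FD.
have sub k : F (g k) `+` E `<=` \bigcup_j (F (g (k + j)%N) `+` F (g (k + j).+1)).
  move=> x xP; apply: contrapT => xN.
  have const j : F (g (k + j)%N) x <-> F (g k) x.
    elim: j => [|j IH]; first by rewrite addn0.
    rewrite addnS -IH; split => h; apply: contrapT => h'; apply: xN; exists j => //.
      by right.
    by left.
  have EF : E x <-> F (g k) x.
    split => [[K _ KP]|Fx].
      by apply/(const K)/KP => /=; exact: leq_addl.
    exists k => // j /= kj; rewrite -(subnKC kj).
    exact/const.
  by case: xP => -[] /[dup] h1 /EF; [move=> + /EF|move=> + /[dup] /EF].
have bnd k : (mu (F (g k) `+` E) <= (2 / 2 ^+ k)%:E)%E.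
  apply: (@le_trans _ _ (\sum_(j <oo) mu (F (g (k + j)%N) `+` F (g (k + j).+1)))%E).
    by apply: measure_sigma_subadditive => //; exact: measurable_symdiff.
  have <- := cvg_lim (@ereal_hausdorff R) (@cvg_geometric_eseries_half R 2 k).
  apply: lee_nneseries => // j _.
  apply: le_trans (NP (k + j)%N _ _ _ _) _.
  - exact: gN.
  - by apply: leq_trans (gN _) _; exact/ltnW/gS.
  rewrite lee_fin addnS expnS natrM invfM mulrA divff// mul1r.
  by rewrite addnC.
apply: (@squeeze_cvge _ _ _ _ (cst 0%E) _ (fun k => (2 / 2 ^+ k)%:E)).
- by apply: nearW => k; rewrite measure_ge0 bnd.
- exact: cvg_cst.
- apply: cvg_EFin; first exact: nearW.
  rewrite /comp/= -[X in _ --> X](mulr0 2); apply: cvgMl_tmp.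
  have h1 : `|2^-1 : R| < 1 by rewrite ger0_norm ?invr_ge0// invf_lt1// ltr1n.
  by under eq_fun do rewrite -exprVn; exact: cvg_expr.
Qed.

Lemma ge0_integral_mrestr (D : set T) (mD : measurable D) (f : T -> \bar R) :
  measurable_fun setT f -> (forall x, (0 <= f x)%E) ->
  (\int[mrestr mu mD]_x f x = \int[mu]_(x in D) f x)%E.
Proof.
move=> mf f0; rewrite (@ge0_negligible_integral _ _ _ _ setT (~` D))//; last 2 first.
- exact: measurableC.
- by rewrite /= /mrestr setICl measure0.
rewrite setTD setCK; apply: eq_measure_integral => A mA AD.
by rewrite /= /mrestr setIidl.
Qed.

End symdiff_complete.

Lemma dist_triangle4 {R : realType} (y b a o x : R) :
  `|y - x| <= `|y - b| + `|b - o| + (`|a - o| + `|x - a|).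
Proof.
rewrite (_ : y - x = (y - b) + (b - o) + ((o - a) + (a - x))); last by ring.
rewrite (distrC a) (distrC x).
apply: le_trans (ler_normD _ _) _; apply: lerD; exact: ler_normD.
Qed.

Section tent.
Context {R : realType} {n : nat}.
Local Notation T := 'rV[R]_n.
Local Notation leb := (@lebesgue_rV R n).
Implicit Types (D E Omega : set T) (x y z w : T) (l : R).

Definition tent l w : R := Num.max 0 (l - `|w|).

Lemma tent_ge0 l w : 0 <= tent l w. Proof. by rewrite le_max lexx. Qed.

Lemma tent_le l w : 0 <= l -> tent l w <= l.
Proof. by move=> l0; rewrite /tent ge_max l0 lerBlDr lerDl normr_ge0. Qed.

Lemma tent_eq0 l w : l <= `|w| -> tent l w = 0.
Proof. by move=> lw; apply/max_idPl; rewrite subr_le0. Qed.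

Lemma continuous_dist x : continuous (fun y => `|y - x|).
Proof.
move=> y; apply: (@continuous_comp _ _ _ (fun y : T => y - x) (fun z : T => `|z|)).
  by apply: (@continuousB _ _ T); [exact: cvg_id|exact: cst_continuous].
exact: norm_continuous.
Qed.

Lemma continuous_tent l x : continuous (fun y => tent l (y - x)).
Proof.
have cg : continuous (fun y : T => l - `|y - x|).
  by move=> y; apply: (@continuousB _ R^o T (cst l) (fun y => `|y - x|));
    [exact: cst_continuous|exact: continuous_dist].
move=> y; apply: (@continuous_max _ _ (cst 0) (fun y => l - `|y - x|)).
  exact: cst_continuous.
exact: cg.
Qed.

Lemma measurable_tent l : measurable_fun [set: T] (tent l).
Proof.
have := continuous_measurable_rV (@continuous_tent l 0).
by under eq_fun do rewrite subr0.
Qed.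

Lemma integral_cst_leb D (r : R) : measurable D ->
  (\int[leb]_(w in D) (cst r%:E) w = r%:E * leb D)%E.
Proof. by move=> mD; rewrite integral_cst. Qed.

Definition tent_mass l : \bar R := (\int[leb]_w (tent l w)%:E)%E.

Lemma tent_mass_lty l : 0 < l -> (tent_mass l < +oo)%E.
Proof.
move=> l0; pose A : set T := [set w | forall i, - l <= w ord0 i < l].
have mA : measurable A by exact: measurable_box.
apply: (@le_lt_trans _ _ (\int[leb]_(w in A) (cst l%:E) w)%E); last first.
  by rewrite integral_cst_leb// lebesgue_rV_cube ?ltry//; lra.
rewrite [leRHS]integral_mkcond; apply: ge0_le_integralT => //.
- by apply/measurable_EFinP; exact: measurable_tent.
- by apply/(measurable_restrictT _ mA); exact: measurable_cst.
- by move=> w; rewrite lee_fin tent_ge0.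
- by move=> w; rewrite /patch; case: ifP => // _; rewrite lee_fin ltW.
move=> w _; rewrite /patch; case: ifPn => [_|]; first by rewrite lee_fin tent_le// ltW.
rewrite notin_setE => Aw; rewrite tent_eq0// leNgt; apply/negP => wl; apply: Aw => i.
move/normv_ltP : wl => /(_ l0 i); rewrite ltr_norml => /andP[/ltW -> ->//].
Qed.

Lemma tent_mass_gt0 l : 0 < l -> (0 < tent_mass l)%E.
Proof.
move=> l0; pose A : set T := [set w | forall i, - (l / 2) <= w ord0 i < l / 2].
have mA : measurable A by exact: measurable_box.
have l20 : 0 <= l / 2 by rewrite divr_ge0 ?ltW.
apply: (@lt_le_trans _ _ (\int[leb]_(w in A) (cst (l / 2)%:E) w)%E).
  rewrite integral_cst_leb// lebesgue_rV_cube; last lra.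
  by rewrite -EFinM lte_fin mulr_gt0 ?divr_gt0// exprn_gt0//; lra.
rewrite [leLHS]integral_mkcond; apply: ge0_le_integralT => //.
- by apply/(measurable_restrictT _ mA); exact: measurable_cst.
- by apply/measurable_EFinP; exact: measurable_tent.
- by move=> w; rewrite /patch; case: ifP => // _; rewrite lee_fin.
- by move=> w; rewrite lee_fin tent_ge0.
move=> w _; rewrite /patch; case: ifPn => [|_]; last by rewrite lee_fin tent_ge0.
rewrite inE => Aw; rewrite lee_fin le_max; apply/orP; right.
have : `|w| <= l / 2.
  apply/normv_leP => // i; have /andP[? ?] := Aw i.
  by rewrite ler_norml; apply/andP; split; lra.
lra.
Qed.

Definition mollify l E x : \bar R := (\int[leb]_y (tent l (y - x) * \1_E y)%:E)%E.

Lemma measurable_tent_pair l E : measurable E ->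
  measurable_fun [set: T * T] (fun p => tent l (p.2 - p.1) * \1_E p.2).
Proof.
move=> mE; apply: measurable_funM.
  apply: (measurableT_comp (measurable_tent l)).
  by apply: measurable_subv; [exact: measurable_snd|exact: measurable_fst].
exact: (measurableT_comp (measurable_indic mE) measurable_snd).
Qed.

Lemma measurable_mollify l E : measurable E -> measurable_fun setT (mollify l E).
Proof.
move=> mE; apply: (measurable_partial_integral (measurable_tent_pair l mE)) => p.
by rewrite mulr_ge0 ?tent_ge0.
Qed.

Lemma mollify_shift l E x : measurable E ->
  mollify l E x = (\int[leb]_w (tent l w * \1_E (x + w)%R)%:E)%E.
Proof.
move=> mE; rewrite /mollify (@ge0_integral_shiftT _ _ _ x).
- by under eq_integral do rewrite addrK addrC.
- exact: (emeasurable_section x (measurable_tent_pair l mE)).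
- by move=> y; rewrite lee_fin mulr_ge0 ?tent_ge0.
Qed.

Lemma measurable_tent_shift l E x : measurable E ->
  measurable_fun setT (fun w => (tent l w * \1_E (x + w)%R)%:E : \bar R).
Proof.
move=> mE; apply/measurable_EFinP; apply: measurable_funM.
  exact: measurable_tent.
by under eq_fun do rewrite addrC; exact: measurable_indic_shift.
Qed.

Lemma mollify_le l E x : measurable E -> (0 <= mollify l E x <= tent_mass l)%E.
Proof.
move=> mE; rewrite mollify_shift//; apply/andP; split.
  by apply: integral_ge0 => w _; rewrite lee_fin mulr_ge0 ?tent_ge0.
apply: ge0_le_integralT => //.
- exact: measurable_tent_shift.
- by apply/measurable_EFinP; exact: measurable_tent.
- by move=> w; rewrite lee_fin mulr_ge0 ?tent_ge0.
- by move=> w; rewrite lee_fin tent_ge0.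
by move=> w _; rewrite lee_fin ler_piMr ?tent_ge0.
Qed.

Lemma mollify_dist l E x : 0 < l -> measurable E ->
  (`|fine (tent_mass l) * \1_E x - fine (mollify l E x)|%:E <=
    \int[leb]_w (tent l w * `|\1_E (x + w)%R - \1_E x|)%:E)%E.
Proof.
move=> l0 mE.
have mt := @measurable_tent l.
have it : leb.-integrable setT (EFin \o tent l).
  apply/integrableP; split; first exact/measurable_EFinP.
  under eq_integral do rewrite /= ger0_norm ?tent_ge0//.
  exact: tent_mass_lty.
have m1 : measurable_fun setT (fun w => \1_E (x + w) : R).
  by under eq_fun do rewrite addrC; exact: measurable_indic_shift.
have ib (g : T -> R) : measurable_fun setT g -> (forall w, `|g w| <= 1) ->
    leb.-integrable setT (EFin \o (fun w => tent l w * g w)).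
  move=> mg g1; apply: (le_integrable _ _ _ it) => //.
    by apply/measurable_EFinP; exact: measurable_funM.
  move=> w _ /=; rewrite lee_fin normrM ler_piMr//.
have i1 w : `|\1_E w : R| <= 1.
  by rewrite indicE; case: (_ \in _); rewrite ?normr1 ?normr0.
have iA : leb.-integrable setT (EFin \o (fun w => tent l w * \1_E x)).
  by apply: (ib (fun=> \1_E x)).
have iB := ib _ m1 (fun w => i1 (x + w)).
rewrite mollify_shift//.
have -> : fine (tent_mass l) * \1_E x = \int[leb]_w (tent l w * \1_E x).
  by rewrite RintegralZr.
rewrite -[fine _]/(\int[leb]_w (tent l w * \1_E (x + w)))%R -RintegralB//.
have iAB : leb.-integrable setT
    (EFin \o (fun w => tent l w * \1_E x - tent l w * \1_E (x + w))).
  by apply: eq_integrable (integrableB measurableT iA iB).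
apply: (@le_trans _ _ (\int[leb]_w `|tent l w * \1_E x - tent l w * \1_E (x + w)%R|)%R%:E).
  by rewrite lee_fin le_normr_Rintegral.
rewrite /Rintegral fineK; last first.
  by apply: integrable_fin_num => //; exact: integrable_norm.
rewrite le_eqVlt; apply/orP; left; apply/eqP; apply: eq_integral => w _.
by rewrite -mulrBr normrM ger0_norm ?tent_ge0// distrC.
Qed.

(** By the Tonelli theorem the error of mollification is at most an average of
translation increments, weighted by the tent. *)
Lemma mollify_dist_integral l D E (b : R) : 0 < l -> 0 <= b ->
  measurable D -> measurable E ->
  (forall w, `|w| < l -> (shift_diff D E w <= b%:E)%E) ->
  (\int[leb]_(x in D) `|fine (tent_mass l) * \1_E x - fine (mollify l E x)|%:E <=
   (fine (tent_mass l) * b)%:E)%E.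
Proof.
move=> l0 b0 mD mE H.
pose h (p : T * T) := \1_D p.1 * (tent l p.2 * `|\1_E (p.1 + p.2) - \1_E p.1|).
have h0 p : 0 <= h p by rewrite /h mulr_ge0 ?mulr_ge0 ?tent_ge0.
have mh : measurable_fun setT h.
  apply: measurable_funM.
    exact: (measurableT_comp (measurable_indic mD) measurable_fst).
  apply: measurable_funM; first exact: (measurableT_comp (measurable_tent l) measurable_snd).
  apply: measurableT_comp => //; apply: measurable_funB.
    apply: (measurableT_comp (measurable_indic mE)).
    by apply: measurable_addv; [exact: measurable_fst|exact: measurable_snd].
  exact: (measurableT_comp (measurable_indic mE) measurable_fst).
have mhE : measurable_fun setT (EFin \o h) by exact/measurable_EFinP.
have hE0 p : (0 <= (EFin \o h) p)%E by rewrite lee_fin.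
have md : measurable_fun setT (fun x : T =>
    `|fine (tent_mass l) * \1_E x - fine (mollify l E x)|).
  apply: measurableT_comp => //; apply: measurable_funB.
    apply: measurable_funM => //; exact: measurable_indic.
  apply: (measurableT_comp (fine_measurable measurableT)).
  exact: measurable_mollify.
apply: (@le_trans _ _ (\int[leb]_x \int[leb]_w (EFin \o h) (x, w))%E).
  rewrite [leLHS]integral_mkcond; apply: ge0_le_integralT => //.
  - by apply/(measurable_restrictT _ mD); apply: measurable_funTS; exact/measurable_EFinP.
  - exact: (measurable_fun_fubini_tonelli_F (EFin \o h)).
  - by move=> x; rewrite /patch; case: ifP => // _; rewrite lee_fin.
  - by move=> x; apply: integral_ge0.
  move=> x _; rewrite /patch; case: ifPn => [/set_mem xD|_]; last by apply: integral_ge0.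
  apply: le_trans (mollify_dist x l0 mE) _.
  rewrite le_eqVlt; apply/orP; left; apply/eqP; apply: eq_integral => w _.
  have -> : (EFin \o h) (x, w) = (\1_D x * (tent l w * `|\1_E (x + w) - \1_E x|))%:E by [].
  by rewrite [\1_D x]indicE mem_set// mul1r.
rewrite (fubini_tonelli (EFin \o h))//.
apply: (@le_trans _ _ (\int[leb]_w ((tent l w)%:E * b%:E))%E); last first.
  rewrite ge0_integralZr//.
  - rewrite -/(tent_mass l) EFinM fineK// ge0_fin_numE ?tent_mass_lty//.
    by apply: integral_ge0 => w _; rewrite lee_fin tent_ge0.
  - by apply/measurable_EFinP; exact: measurable_tent.
  - by move=> w _; rewrite lee_fin tent_ge0.
apply: ge0_le_integralT => //.
- exact: (measurable_fun_fubini_tonelli_G (EFin \o h)).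
- apply: emeasurable_funM => //.
  by apply/measurable_EFinP; exact: measurable_tent.
- by move=> w; apply: integral_ge0.
- by move=> w; rewrite mule_ge0// lee_fin tent_ge0.
move=> w _; have [lw|wl] := leP l `|w|.
  rewrite integral0_eq ?mule_ge0 ?lee_fin ?tent_ge0//.
  by move=> x _; rewrite /h/= tent_eq0// mul0r mulr0.
apply: (@le_trans _ _ ((tent l w)%:E * shift_diff D E w)%E); last first.
  by rewrite lee_wpmul2l ?lee_fin ?tent_ge0// H.
rewrite /shift_diff -ge0_integralZl//; last 2 first.
- by apply: measurable_funTS; exact: emeasurable_diff_indic.
- by rewrite lee_fin tent_ge0.
rewrite [leRHS]integral_mkcond le_eqVlt; apply/orP; left; apply/eqP.
apply: eq_integral => x _; rewrite /h/= /patch indicE.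
by case: ifP => _; rewrite ?mul1r ?mul0r.
Qed.


Lemma integral_diff_indic D E F : measurable D -> measurable E -> measurable F ->
  (\int[leb]_(x in D) `|\1_E x - \1_F x|%:E = leb (D `&` (E `+` F)))%E.
Proof.
move=> mD mE mF; have mEF := measurable_symdiff mE mF.
rewrite setIC -(@integral_indic _ _ _ leb D mD (E `+` F) mEF).
by apply: eq_integral => x _; rewrite dist_indic.
Qed.

Lemma lebesgue_sub_cube Omega (B : R) : measurable Omega -> 0 < B ->
  Omega `<=` cube B -> (leb Omega <= ((4 * B) ^+ n)%:E)%E.
Proof.
move=> mO B0 OB; have -> : 4 * B = 2 * B - - (2 * B) by ring.
rewrite -lebesgue_rV_cube; last by lra.
apply: le_measure; rewrite ?inE//; first exact: measurable_box.
move=> x /OB/normv_leP-/(_ (ltW B0)) xB i; have := xB i.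
by rewrite ler_norml => /andP[? ?]; lra.
Qed.

(** The sets [Omega `\` inner Omega d] decrease to the empty set because [Omega] is
open. *)
Lemma inner_exhausts Omega : open Omega -> (leb Omega < +oo)%E ->
  forall e : R, 0 < e -> exists2 d : R, 0 < d &
    (leb (Omega `\` inner Omega d) <= e%:E)%E.
Proof.
move=> oO fO e e0; have mO := open_measurable_rV oO.
pose G k := Omega `\` inner Omega k.+1%:R^-1.
have mG k : measurable (G k) by apply: measurableD => //; exact: measurable_inner.
have capG : \bigcap_k G k = set0.
  apply/seteqP; split => // x xG; have [Ox _] := xG 0%N I.
  have /nbhs_ballP[d /= d0 dO] := open_nbhs_nbhs (conj oO Ox).
  have [k kd] := natSinv_lt d0.
  have [_] := xG k I; apply=> y yx; apply: dO; rewrite -ball_normE/=.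
  by rewrite distrC (lt_trans yx).
have : leb (G k) @[k --> \oo] --> leb (\bigcap_k G k).
  apply: nonincreasing_cvg_mu => //.
  - by apply: le_lt_trans fO; apply: le_measure; rewrite ?inE// => x [].
  - by rewrite capG.
  - move=> i j ij; apply/subsetPset => x [Ox xj]; split => // xi; apply: xj => y yx.
    apply: xi; apply: lt_le_trans yx _.
    by rewrite lef_pV2 ?posrE// ler_nat.
rewrite capG measure0 => /fine_cvgP[fG /cvgrPdist_le/(_ _ e0) cG].
near \oo => k.
exists k.+1%:R^-1; first by rewrite invr_gt0.
have f1 : leb (G k) \is a fin_num by near: k.
rewrite -(fineK f1) lee_fin; apply: le_trans (ler_norm _) _.
have : `|0 - fine (leb (G k))| <= e by near: k.
by rewrite sub0r normrN.
Unshelve. all: end_near. Qed.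


Section compactness.
Variables (Omega : set T) (B c1 : R) (E_ : nat -> set T) (r_ : nat -> R).
Hypotheses (oO : open Omega) (B0 : 0 < B) (OB : Omega `<=` cube B).
Hypotheses (mE : forall k, measurable (E_ k)) (EO : forall k, E_ k `<=` Omega).
Hypothesis c10 : 0 <= c1.
Hypothesis r_cvg : r_ k @[k --> \oo] --> 0.
Hypothesis shiftE : forall k (delta : R) z, `|z| + r_ k < delta ->
  (shift_diff (inner Omega delta) (E_ k) z <= (c1 * (8 * `|z| + r_ k))%:E)%E.

Let mO : measurable Omega. Proof. exact: open_measurable_rV. Qed.

Let massO : (leb Omega <= ((4 * B) ^+ n)%:E)%E.
Proof. exact: lebesgue_sub_cube mO B0 OB. Qed.

Let finO : (leb Omega < +oo)%E. Proof. exact: le_lt_trans massO (ltry _). Qed.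

(** A weak limit of the Lebesgue measures restricted to the [E_ k], tested against
the tent centred at [x], gives the convergence of the mollifications at [x]. *)
Let weak_extraction : exists2 f : nat -> nat, {homo f : i j / (i < j)%N} &
  forall l x, 0 < l -> cvgn (fun k => fine (mollify l (E_ (f k)) x)).
Proof.
pose m_ k : {measure set T -> \bar R} := mrestr leb (mE k).
have [|k|f [fi [mu _ fP]]] := @prokhorov_cube R n m_ ((4 * B) ^+ n) B B0.
- move=> k; rewrite /m_ /= /mrestr setTI; apply: le_trans massO.
  by apply: le_measure; rewrite ?inE//; exact: EO.
- rewrite /m_ /= /mrestr (_ : _ `&` _ = set0) ?measure0//.
  by apply/seteqP; split => // x [xB /EO/OB].
exists f => // l x l0.
have := fP _ (@continuous_tent l x).
have H : exists C, forall y, `|tent l (y - x)| <= C.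
  by exists l => y; rewrite ger0_norm ?tent_ge0// tent_le// ltW.
move=> /(_ H) fc; apply/cvg_ex; eexists.
rewrite (_ : (fun k => fine _) =
  (fun k => \int[m_ (f k)]_y tent l (y - x))); first exact: fc.
apply/funext => k; rewrite /Rintegral /m_ ge0_integral_mrestr; last 2 first.
- apply/measurable_EFinP; apply: (measurableT_comp (measurable_tent l)).
  exact: measurable_subv.
- by move=> y; rewrite lee_fin tent_ge0.
rewrite integral_mkcond; congr fine; apply: eq_integral => y _.
by rewrite /patch indicE; case: ifP => _; rewrite ?mulr1 ?mulr0.
Qed.

(** On an erosion of [Omega] the mollifications at a fixed radius [l] converge in L1
by dominated convergence, and for small [l] the bound on translations makes them
close to the indicators, uniformly in [k] large. The rest of [Omega] has small
measure. *)
Let l1_cauchy : exists2 f : nat -> nat, {homo f : i j / (i < j)%N} &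
  forall e : R, 0 < e -> exists K, forall i j, (K <= i)%N -> (K <= j)%N ->
     (leb (E_ (f i) `+` E_ (f j)) <= e%:E)%E.
Proof.
have [f fi fc] := weak_extraction.
exists f => // e e0.
have e40 : 0 < e / 4 by rewrite divr_gt0.
have [delta d0 Hd] := inner_exhausts oO finO e40.
set I := inner Omega delta in Hd.
have mI : measurable I by exact: measurable_inner.
have IO : I `<=` Omega by exact: inner_sub.
(* [l <= delta / 2] leaves room for [r_ k] in the bound on translations; the second
   term keeps the two errors of mollification, [9 * c1 * l] each, below [e / 3] in
   total, and the two distances to the limit take [e / 16] each. *)
pose l := Num.min (delta / 2) (e / (64 * (c1 + 1))).
have c11 : 0 < 64 * (c1 + 1) by have := c10; lra.
have l0 : 0 < l by rewrite lt_min !divr_gt0.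
have ld : l <= delta / 2 by rewrite ge_min lexx.
have le : 64 * (c1 + 1) * l <= e.
  by rewrite mulrC -ler_pdivlMr// ge_min lexx orbT.
pose a k x := fine (mollify l (E_ (f k)) x).
pose ao x := limn (a ^~ x).
have acvg x : a k x @[k --> \oo] --> ao x by exact: fc.
pose c := fine (tent_mass l).
have cE : tent_mass l = c%:E.
  rewrite /c fineK// ge0_fin_numE ?tent_mass_lty//.
  by apply: integral_ge0 => w _; rewrite lee_fin tent_ge0.
have c0 : 0 < c by rewrite -lte_fin -cE tent_mass_gt0.
have a0c k x : 0 <= a k x <= c.
  have /andP[h1 h2] := mollify_le l x (mE (f k)).
  rewrite /a fine_ge0//= -lee_fin fineK -?cE// ge0_fin_numE//.
  by apply: le_lt_trans h2 _; rewrite cE ltry.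
have ma k : measurable_fun setT (a k).
  apply: (measurableT_comp (fine_measurable measurableT)).
  exact: measurable_mollify.
have mao : measurable_fun setT (EFin \o ao).
  apply: (emeasurable_fun_cvg (fun k => EFin \o a k)).
    by move=> k; exact/measurable_EFinP.
  by move=> x _; apply: cvg_EFin; [exact: nearW|exact: acvg].
have mao' : measurable_fun setT ao by exact/measurable_EFinP.
have finI : (leb I < +oo)%E.
  by apply: le_lt_trans finO; apply: le_measure; rewrite ?inE.
have mid : (\int[leb]_(x in I) `|a k x - ao x|%:E)%E @[k --> \oo] --> 0%E.
  have [| | | | |_ + _] := @dominated_convergence _ _ R leb I mI
    (fun k => EFin \o a k) (EFin \o ao) (fun=> c%:E) .
  - by move=> k; apply: measurable_funTS; exact/measurable_EFinP.
  - exact: measurable_funTS.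
  - by apply: aeW => x _; apply: cvg_EFin; [exact: nearW|exact: acvg].
  - by apply: (@bounded_integrable _ _ _ _ _ _ c) => // x _; rewrite ger0_norm// ltW.
  - apply: aeW => x k _; have /andP[? ?] := a0c k x.
    by rewrite /= lee_fin ger0_norm.
  by [].
have ec : 0 < c * (e / 16) by rewrite mulr_gt0// divr_gt0.
have [K1 K1P] : exists K, forall k, (K <= k)%N ->
    (\int[leb]_(x in I) `|a k x - ao x|%:E <= (c * (e / 16))%:E)%E.
  move/fine_cvgP : mid => [fm /cvgrPdist_le/(_ _ ec) cm].
  have [K _ KP] : \forall k \near \oo, (\int[leb]_(x in I) `|a k x - ao x|%:E
      <= (c * (e / 16))%:E)%E.
    near=> k.
    have f1 : (\int[leb]_(x in I) `|a k x - ao x|%:E)%E \is a fin_num by near: k.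
    rewrite -(fineK f1) lee_fin; apply: le_trans (ler_norm _) _.
    have : `|0 - fine (\int[leb]_(x in I) `|a k x - ao x|%:E)%E| <= c * (e / 16).
      by near: k.
    by rewrite sub0r normrN.
  by exists K.
have [K2 K2P] : exists K, forall k, (K <= k)%N -> r_ (f k) <= l.
  move/cvgrPdist_le : r_cvg => /(_ _ l0)[K _ KP]; exists K => k Kk.
  have := KP (f k) (leq_trans Kk (subseq_ge_id fi k)); rewrite sub0r normrN.
  exact: le_trans (ler_norm _).
have approx k : (K2 <= k)%N ->
    (\int[leb]_(x in I) `|c * \1_(E_ (f k)) x - a k x|%:E <=
     (c * (9 * c1 * l))%:E)%E.
  move=> /K2P rl; apply: mollify_dist_integral => //.
    by rewrite !mulr_ge0// ltW.
  move=> w wl; apply: le_trans (shiftE _) _.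
    by have := d0; lra.
  have -> : 9 * c1 * l = c1 * (9 * l) by ring.
  by rewrite lee_fin ler_wpM2l//; lra.
exists (maxn K1 K2) => i j; rewrite !geq_max => /andP[i1 i2] /andP[j1 j2].
have mEE : measurable (E_ (f i) `+` E_ (f j)) by exact: measurable_symdiff.
have inI : (leb (I `&` (E_ (f i) `+` E_ (f j))) <= (e / 2)%:E)%E.
  rewrite -integral_diff_indic// -(@lee_pmul2l _ c%:E)// ?lte_fin//.
  rewrite -ge0_integralZl//; last 2 first.
  - apply: measurable_funTS; apply/measurable_EFinP; apply: measurableT_comp => //.
    by apply: measurable_funB; exact: measurable_indic.
  - by rewrite lee_fin ltW.
  have mA k : measurable_fun setT (fun x => `|c * \1_(E_ (f k)) x - a k x|%:E).
    apply/measurable_EFinP; apply: measurableT_comp => //.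
    by apply: measurable_funB => //; apply: measurable_funM => //.
  have mB k : measurable_fun setT (fun x => `|a k x - ao x|%:E).
    by apply/measurable_EFinP; apply: measurableT_comp => //; exact: measurable_funB.
  apply: (@le_trans _ _ (\int[leb]_(x in I)
    ((`|c * \1_(E_ (f i)) x - a i x|%:E + `|a i x - ao x|%:E) +
     (`|a j x - ao x|%:E + `|c * \1_(E_ (f j)) x - a j x|%:E)))%E).
    apply: ge0_le_integralT => //.
    - apply: emeasurable_funM => //; apply/measurable_EFinP.
      apply: measurableT_comp => //.
      by apply: measurable_funB; exact: measurable_indic.
    - by apply: emeasurable_funD; apply: emeasurable_funD.
    - by move=> x; rewrite mule_ge0// lee_fin ltW.
    - by move=> x; rewrite -!EFinD lee_fin !addr_ge0.
    move=> x _; rewrite -!EFinD -EFinM lee_fin.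
    rewrite -[X in X * _](ger0_norm (ltW c0)) -normrM mulrBr.
    exact: dist_triangle4.
  have s0 (p q : R) : (0 <= `|p|%:E + `|q|%:E)%E by rewrite -EFinD lee_fin addr_ge0.
  rewrite ge0_integralDT//; [|exact: emeasurable_funD..].
  rewrite (ge0_integralDT _ (mA i) (mB i))// (ge0_integralDT _ (mB j) (mA j))//.
  apply: le_trans (leeD (leeD (approx _ i2) (K1P _ i1)) (leeD (K1P _ j1) (approx _ j2))) _.
  rewrite -!EFinD -EFinM lee_fin -!mulrDr ler_wpM2l ?(ltW c0)//.
  have : c1 * l <= (c1 + 1) * l by rewrite ler_wpM2r ?(ltW l0)//; lra.
  by move: le; lra.
have outI : (leb ((Omega `\` I) `&` (E_ (f i) `+` E_ (f j))) <= (e / 4)%:E)%E.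
  apply: le_trans Hd; apply: le_measure; rewrite ?inE.
  - by apply: measurableI => //; exact: measurableD.
  - exact: measurableD.
  - exact: subIsetl.
apply: (@le_trans _ _ (leb (I `&` (E_ (f i) `+` E_ (f j))) +
  leb ((Omega `\` I) `&` (E_ (f i) `+` E_ (f j))))%E).
  apply: (@le_trans _ _ (leb ((I `&` (E_ (f i) `+` E_ (f j))) `|`
      ((Omega `\` I) `&` (E_ (f i) `+` E_ (f j)))))).
    apply: le_measure; rewrite ?inE//.
      apply: measurableU; apply: measurableI => //; exact: measurableD.
    move=> x xE; have Ox : Omega x by case: xE => -[/EO].
    by have [xI|xI] := pselect (I x); [left|right].
  by apply: measureU2; apply: measurableI => //; exact: measurableD.
apply: le_trans (leeD inI outI) _.
by rewrite -EFinD lee_fin; lra.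
Unshelve. all: end_near. Qed.

Lemma shift_compactness : exists2 f : nat -> nat, {homo f : i j / (i < j)%N} &
  exists E : set T, [/\ measurable E, E `<=` Omega &
    leb (E_ (f k) `+` E) @[k --> \oo] --> 0%E].
Proof.
have [f fi fc] := l1_cauchy.
have [g gi [E [mEE EO' cE]]] := symdiff_cauchy_cvg (fun k => mE (f k)) fc.
exists (f \o g); first by move=> i j ij /=; exact/fi/gi.
by exists E; split => //; apply: EO' => k; exact: EO.
Qed.

End compactness.
End tent.

(** * Bounded variation by difference quotients *)

Section directional_calculus.
Context {R : realType} {n : nat}.
Local Notation T := 'rV[R]_n.
Implicit Types (phi : T -> T) (x y : T) (K Omega : set T).
Local Notation e_ i := (delta_mx ord0 i : T).

Lemma normv_delta (i : 'I_n) : `|e_ i| <= 1.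
Proof.
apply/normv_leP => // j; rewrite mxE eqxx/=.
by case: (_ == _); rewrite ?normr1 ?normr0.
Qed.

Lemma coord_le_enorm x (i : 'I_n) : `|x ord0 i| <= enorm x.
Proof.
rewrite -sqrtr_sqr ler_wsqrtr// /edot (bigD1 i)//= expr2 lerDl.
by apply: sumr_ge0 => j _; rewrite -expr2 sqr_ge0.
Qed.

Lemma compact_sub_inner K Omega : compact K -> open Omega -> K `<=` Omega ->
  exists2 d : R, 0 < d & K `<=` inner Omega d.
Proof.
move=> cK oO KO.
have /compact_near_coveringP H := cK.
have [|k _ kP] := H _ \oo (fun k x => inner Omega k.+1%:R^-1 x) _.
  move=> x Kx.
  have /nbhs_ballP[e /= e0 eO] := open_nbhs_nbhs (conj oO (KO x Kx)).
  have e20 : 0 < e / 2 by rewrite divr_gt0.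
  near=> y k => z /= zy.
  apply: eO; rewrite -ball_normE/=.
  have xy : `|x - y| < e / 2.
    by near: y; have := nbhsx_ballx x _ e20; rewrite -ball_normE.
  have ke : k.+1%:R^-1 < e / 2 by near: k; exact: (near_infty_natSinv_lt (PosNum e20)).
  rewrite (_ : x - z = (x - y) - (z - y)); last by rewrite opprB addrA subrK.
  apply: le_lt_trans (ler_normB _ _) _; rewrite [e]splitr ltrD//.
  exact: lt_trans zy ke.
exists k.+1%:R^-1; first by rewrite invr_gt0.
exact: (kP k (leqnn k)).
Unshelve. all: end_near. Qed.

Lemma is_derive_line phi (v x : T) (i : 'I_n) (s : R) :
  derivable phi (x + s *: v) v ->
  is_derive s 1 (fun s : R => phi (x + s *: v) ord0 i : R^o)
    ('D_v phi (x + s *: v) ord0 i).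
Proof.
move=> dphi.
pose F (s : R) : R^o := phi (x + s *: v) ord0 i.
have H : (h^-1 *: ((F \o shift s) (h *: 1) - F s)) @[h --> 0^'] -->
    ('D_v phi (x + s *: v) ord0 i : R^o).
  have -> : (fun h : R => h^-1 *: ((F \o shift s) (h *: 1) - F s)) =
      (fun M : T => M ord0 i) \o
      (fun h : R => h^-1 *: ((phi \o shift (x + s *: v)) (h *: v) - phi (x + s *: v))).
    apply/funext => h; rewrite /F /= !mxE [h *: 1]mulr1 scalerDl; congr (_ * _).
    by rewrite addrCA.
  apply: (@cvg_comp R T R _ _ 0^' (nbhs ('D_v phi (x + s *: v) : T))).
    exact: dphi.
  exact: coord_continuous.
apply: DeriveDef; first by apply/cvg_ex; eexists; exact: H.
exact: cvg_lim H.
Qed.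

Lemma line_diff_le phi (v x : T) (i : 'I_n) (t C : R) :
  (forall y, derivable phi y v) -> (forall y, `|'D_v phi y| <= C) ->
  `|phi (x + t *: v) ord0 i - phi x ord0 i| <= C * `|t|.
Proof.
move=> dphi phiC.
pose F (s : R) := phi (x + s *: v) ord0 i.
have dF (s : R) : is_derive s 1 (F : R -> R^o) ('D_v phi (x + s *: v) ord0 i).
  exact: is_derive_line.
have cF (s : R) : {for s, continuous F}.
  by apply: differentiable_continuous; apply/derivable1_diffP; have [] := dF s.
have key (a b : R) : a <= b -> `|F b - F a| <= C * (b - a).
  move=> ab; have [|c _ ->] := MVT_segment ab (fun s _ => dF s).
    by apply: continuous_subspaceT => s; exact: cF.
  rewrite normrM (ger0_norm (_ : 0 <= b - a)) ?subr_ge0//.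
  by rewrite ler_wpM2r ?subr_ge0// (le_trans (coord_le_normv _ _)).
have F0 : F 0 = phi x ord0 i by rewrite /F scale0r addr0.
rewrite -F0 -/(F t); have [t0|/ltW t0] := leP 0 t.
  by have := key _ _ t0; rewrite subr0 (ger0_norm t0).
by have := key _ _ t0; rewrite sub0r distrC (ler0_norm t0).
Qed.

Lemma compact_zero_bounded (V : normedModType R) (g : T -> V) K : continuous g ->
  compact K -> (forall x, ~ K x -> g x = 0) ->
  exists2 C : R, 0 <= C & forall x, `|g x| <= C.
Proof.
move=> cg cK g0.
have [M [_ MP]] := compact_bounded (continuous_compact (continuous_subspaceT cg) cK).
exists `|M + 1| => // x; have [Kx|/g0 ->] := pselect (K x); last by rewrite normr0.
apply: (MP `|M + 1|); first by rewrite (lt_le_trans _ (ler_norm _))// ltrDl.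
by exists x.
Qed.

(** Outside its support the field vanishes near each point, hence so do its partial
derivatives. *)
Lemma partial_bounded Omega phi : C1 phi -> compactly_supported Omega phi ->
  exists2 C : R, 0 <= C & forall i x, `|partial i phi x| <= C.
Proof.
move=> phiC1 [cK _].
have H i : exists C : R, 0 <= C /\ forall x, `|partial i phi x| <= C.
  have [_ ci] := phiC1 i.
  have [|C C0 CP] := compact_zero_bounded ci cK; last by exists C.
  move=> x xK; rewrite /partial (near_eq_derive (g := fun=> 0)) ?derive_cst//.
  have oK : open (~` closure [set x | phi x != 0]).
    exact/closed_openC/closed_closure.
  apply: filterS (open_nbhs_nbhs (conj oK xK)) => y yK.
  by apply: contrapT => /eqP phiy; apply/yK/subset_closure.
have {H}/choice[C_ CP] := H.
exists (\sum_i C_ i); first by apply: sumr_ge0 => i _; have [] := CP i.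
move=> i x; have [_ /(_ x)/le_trans] := CP i; apply.
by rewrite (bigD1 i)//= lerDl sumr_ge0// => j _; have [] := CP j.
Qed.

(** [C1] speaks of partial derivatives only. Going from [x] to [y] by changing one
coordinate at a time, the mean value theorem along each axis shows that [phi] is
Lipschitz. *)
Lemma C1_continuous_coord Omega phi i : C1 phi -> compactly_supported Omega phi ->
  continuous (fun x => phi x ord0 i).
Proof.
move=> phiC1 sphi; have [C C0 CP] := partial_bounded phiC1 sphi.
have lip x y : `|phi y ord0 i - phi x ord0 i| <= n%:R * C * `|y - x|.
  pose p (j : nat) : T := \row_(k < n) if (k < j)%N then y ord0 k else x ord0 k.
  have p0 : p 0%N = x by apply/rowP => k; rewrite mxE.
  have pn : p n = y by apply/rowP => k; rewrite mxE ltn_ord.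
  have step (j : 'I_n) : p j.+1 = p j + (y ord0 j - x ord0 j) *: e_ j.
    apply/rowP => k; rewrite !mxE eqxx/= ltnS leq_eqVlt.
    have [->|kj] := eqVneq k j; first by rewrite eqxx ltnn/= mulr1 addrC subrK.
    have -> : (k == j :> nat) = false by exact: negPf kj.
    by rewrite mulr0 addr0.
  have key (j : nat) : (j <= n)%N ->
      `|phi (p j) ord0 i - phi x ord0 i| <= j%:R * (C * `|y - x|).
    elim: j => [_|j IH jn]; first by rewrite p0 subrr normr0 mul0r.
    apply: le_trans (ler_distD (phi (p j) ord0 i) _ _) _.
    rewrite -natr1 mulrDl mul1r addrC lerD ?IH ?(ltnW jn)//.
    rewrite (step (Ordinal jn))/=.
    apply: le_trans (line_diff_le _ _ _ _ (CP _)) _.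
      by move=> z; have [] := phiC1 (Ordinal jn).
    rewrite ler_wpM2l// (le_trans _ (coord_le_normv _ (Ordinal jn)))//.
    by rewrite !mxE.
  by have := key _ (leqnn n); rewrite pn mulrA.
move=> x; apply/(@cvgrPdist_lt R R^o T (nbhs (x : T))) => e e0.
have nC : 0 < n%:R * C + 1 by rewrite ltr_wpDl// mulr_ge0.
have e1 : 0 < e / (n%:R * C + 1) by rewrite divr_gt0.
apply: filterS (nbhsx_ballx x _ e1) => y; rewrite -ball_normE/= => xy.
rewrite distrC; apply: le_lt_trans (lip x y) _; rewrite distrC.
apply: (@le_lt_trans _ _ ((n%:R * C + 1) * `|x - y|)).
  by rewrite ler_wpM2r// lerDl.
by rewrite mulrC -ltr_pdivlMr.
Qed.

End directional_calculus.
Section variation_bound.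
Context {R : realType} {n : nat}.
Local Notation T := 'rV[R]_n.
Local Notation leb := (@lebesgue_rV R n).
Implicit Types (phi : T -> T) (f g : T -> R) (x y z : T) (Omega : set T).
Local Notation e_ i := (delta_mx ord0 i : T).

Lemma integral_shiftT (h : T -> \bar R) z : measurable_fun setT h ->
  (\int[leb]_x h x = \int[leb]_x h (x + z)%R)%E.
Proof.
move=> mh; rewrite integralE [RHS]integralE; congr (_ - _)%E.
  rewrite (@ge0_integral_shiftT _ _ _ z)//; last exact: measurable_funepos.
  by apply: eq_integral => x _; rewrite !funeposE.
rewrite (@ge0_integral_shiftT _ _ _ z)//; last exact: measurable_funeneg.
by apply: eq_integral => x _; rewrite !funenegE.
Qed.

Lemma bounded_support_integrable Omega g (C : R) : measurable Omega ->
  (leb Omega < +oo)%E -> measurable_fun setT g -> (forall x, `|g x| <= C) ->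
  (forall x, ~ Omega x -> g x = 0) ->
  leb.-integrable setT (EFin \o g) /\
  (\int[leb]_(x in Omega) (g x)%:E = \int[leb]_x (g x)%:E)%E.
Proof.
move=> mO fO mg gC g0.
have gE : (EFin \o g) \_ Omega = EFin \o g.
  apply/funext => x; rewrite /patch; case: ifPn => //.
  by rewrite notin_setE => /g0 /= ->.
split; last by rewrite integral_mkcond gE.
rewrite -gE; apply/(integrable_mkcond _ mO).
by apply: (@bounded_integrable _ _ _ _ _ _ C) => //; exact: measurable_funTS.
Qed.

Lemma difference_quotient_cvg phi (v x : T) i (t_ : nat -> R) :
  derivable phi x v -> (forall k, t_ k != 0) -> t_ k @[k --> \oo] --> 0 ->
  (t_ k)^-1 * (phi (x + t_ k *: v) ord0 i - phi x ord0 i) @[k --> \oo]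
    --> 'D_v phi x ord0 i.
Proof.
move=> dphi t0 tcvg.
have H : t_ k @[k --> \oo] --> 0^'.
  move=> A; rewrite /dnbhs /within /= => /tcvg tA.
  have {}tA : \forall k \near \oo, t_ k != 0 -> A (t_ k) by exact: tA.
  have : \forall k \near \oo, A (t_ k); last by [].
  near=> k.
  have : t_ k != 0 -> A (t_ k) by near: k.
  by apply; exact: t0.
have -> : (fun k => (t_ k)^-1 * (phi (x + t_ k *: v) ord0 i - phi x ord0 i)) =
    (fun M : T => M ord0 i) \o
    ((fun h : R => h^-1 *: ((phi \o shift x) (h *: v) - phi x)) \o t_).
  by apply/funext => k; rewrite /= !mxE [t_ k *: v + x]addrC.
apply: (@cvg_comp _ T R _ _ \oo (nbhs ('D_v phi x : T))); last exact: coord_continuous.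
apply: cvg_comp; [exact: H|exact: dphi].
Unshelve. all: end_near. Qed.

(** Discrete integration by parts. The difference quotients of the component [psi]
of [phi] converge to the partial derivative and stay bounded. By translation
invariance the integral of [f] against such a quotient is that of [psi] against
a difference quotient of [f], and [psi] is at most 1 in absolute value and
supported in an erosion of [Omega]. *)
Lemma directional_bound Omega f phi (M c : R) (i : 'I_n) : open Omega ->
  (leb Omega < +oo)%E -> measurable_fun setT f -> (forall x, `|f x| <= M) ->
  0 <= c ->
  (forall (d : R) z, `|z| < d ->
    (\int[leb]_(x in inner Omega d) `|f (x + z)%R - f x|%:E <= (c * `|z|)%:E)%E) ->
  C1 phi -> compactly_supported Omega phi -> (forall x, enorm (phi x) <= 1) ->
  leb.-integrable Omega (fun x => (f x * partial i phi x ord0 i)%:E) /\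
  (\int[leb]_(x in Omega) (f x * partial i phi x ord0 i)%:E <= c%:E)%E.
Proof.
move=> oO fO mf fM c0 fc phiC1 sphi phi1.
have mO := open_measurable_rV oO.
have [C C0 CP] := partial_bounded phiC1 sphi.
have [cK KO] := sphi.
set K := closure _ in cK KO.
have [d d0 Kd] := compact_sub_inner cK oO KO.
pose psi x := phi x ord0 i.
have cpsi : continuous psi by exact: C1_continuous_coord phiC1 sphi.
have mpsi : measurable_fun setT psi by exact: continuous_measurable_rV.
have psi1 x : `|psi x| <= 1 by rewrite (le_trans (coord_le_enorm _ _)).
have psi0 x : ~ inner Omega d x -> psi x = 0.
  move=> xd; apply: contrapT => px; apply/xd/Kd/subset_closure.
  by apply/eqP => px0; apply: px; rewrite /psi px0 mxE.
have M0 : 0 <= M by apply: le_trans (fM 0); exact: normr_ge0.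
pose t_ k : R := d / 2 * k.+1%:R^-1.
have t_gt0 k : 0 < t_ k by rewrite mulr_gt0 ?divr_gt0// invr_gt0.
have t_ltd k : t_ k < d.
  apply: (@le_lt_trans _ _ (d / 2)); last by lra.
  by rewrite ler_piMr ?divr_ge0// ?invf_le1// ?ler1n// ltW.
have t_cvg : t_ k @[k --> \oo] --> 0.
  rewrite -[X in _ --> X](mulr0 (d / 2)); apply: cvgMl_tmp.
  exact: cvg_harmonic.
pose w k := t_ k *: e_ i.
have wt k : `|w k| <= t_ k.
  by rewrite normrZ gtr0_norm// ler_piMr ?(ltW (t_gt0 k))// normv_delta.
have wd k : `|w k| < d by exact: le_lt_trans (wt k) (t_ltd k).
pose q k x := (t_ k)^-1 * (psi (x + w k) - psi x).
have mpsiw z : measurable_fun setT (fun x => psi (x + z)).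
  by apply: (measurableT_comp mpsi); exact: measurable_shift.
have mfw z : measurable_fun setT (fun x => f (x + z)).
  by apply: (measurableT_comp mf); exact: measurable_shift.
have mq k : measurable_fun setT (q k).
  by apply: measurable_funM => //; apply: measurable_funB.
have qC k x : `|q k x| <= C.
  rewrite normrM gtr0_norm ?invr_gt0// mulrC ler_pdivrMr//.
  rewrite -[leRHS]/(C * t_ k) -(gtr0_norm (t_gt0 k)); apply: line_diff_le => y; last exact: CP.
  by have [] := phiC1 i.
have mpartial : measurable_fun setT (fun x => partial i phi x ord0 i).
  have [_ ci] := phiC1 i.
  apply: continuous_measurable_rV => x.
  apply: (@continuous_comp _ _ _ (partial i phi) (fun M : T => M ord0 i)).
    exact: ci.
  exact: coord_continuous.
have [| | | | |iN _ cN] := @dominated_convergence _ _ R leb Omega mO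
    (fun k x => (f x * q k x)%:E) (fun x => (f x * partial i phi x ord0 i)%:E)
    (fun=> (M * C)%:E).
- move=> k; apply: measurable_funTS; apply/measurable_EFinP.
  exact: measurable_funM.
- by apply: measurable_funTS; apply/measurable_EFinP; exact: measurable_funM.
- apply: aeW => x _; apply: cvg_EFin; first exact: nearW.
  apply: cvgMl_tmp; apply: difference_quotient_cvg => //.
    by have [] := phiC1 i.
  by move=> k; rewrite gt_eqF.
- apply: (@bounded_integrable _ _ _ _ _ _ (M * C)) => // x _.
  by rewrite ger0_norm ?mulr_ge0.
- by apply: aeW => x k _; rewrite lee_fin normrM ler_pM.
split => //; apply: (cvge_to_le cN); apply: nearW => k.
pose G x := f x * psi (x + w k).
pose H x := f x * psi x.
pose G' x := f (x - w k) * psi x.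
have psiO x : ~ Omega x -> psi x = 0.
  by move=> xO; apply: psi0 => /(inner_sub d0).
have MC1 a b : `|a| <= M -> `|b| <= 1 -> `|a * b| <= M.
  by move=> aM b1; rewrite normrM -[M]mulr1 ler_pM.
have [iG GE] : leb.-integrable setT (EFin \o G) /\
    (\int[leb]_(x in Omega) (G x)%:E = \int[leb]_x (G x)%:E)%E.
  apply: (@bounded_support_integrable _ _ M) => //.
  - exact: measurable_funM.
  - by move=> x; exact: MC1.
  move=> x xO; rewrite /G psi0 ?mulr0// => xwd; apply: xO.
  have -> : x = x + w k - w k by rewrite addrK.
  by apply: (inner_shift xwd); rewrite normrN.
have [iH HE] : leb.-integrable setT (EFin \o H) /\
    (\int[leb]_(x in Omega) (H x)%:E = \int[leb]_x (H x)%:E)%E.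
  apply: (@bounded_support_integrable _ _ M) => //.
  - exact: measurable_funM.
  - by move=> x; exact: MC1.
  by move=> x xO; rewrite /H psiO ?mulr0.
have [iG' _] : leb.-integrable setT (EFin \o G') /\
    (\int[leb]_(x in Omega) (G' x)%:E = \int[leb]_x (G' x)%:E)%E.
  apply: (@bounded_support_integrable _ _ M) => //.
  - exact: measurable_funM.
  - by move=> x; exact: MC1.
  by move=> x xO; rewrite /G' psiO ?mulr0.
have GG' : (\int[leb]_x (G x)%:E = \int[leb]_x (G' x)%:E)%E.
  rewrite (@integral_shiftT (EFin \o G) (- w k)); last first.
    by apply/measurable_EFinP; exact: measurable_funM.
  by apply: eq_integral => x _; rewrite /= /G subrK.
have qE x : (f x * q k x)%:E = ((t_ k)^-1%:E * ((G x)%:E - (H x)%:E))%E.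
  by rewrite -EFinB -EFinM /G /H /q; congr (_%:E); ring.
rewrite /=; under eq_integral do rewrite qE.
have iGO : leb.-integrable Omega (EFin \o G) by exact: integrableS iG.
have iHO : leb.-integrable Omega (EFin \o H) by exact: integrableS iH.
rewrite integralZl//; last exact: (integrableB mO iGO iHO).
rewrite (@integralB _ _ _ _ _ mO (EFin \o G) (EFin \o H))//.
rewrite GE HE GG' -(@integralB _ _ _ _ _ measurableT (EFin \o G') (EFin \o H))//.
apply: (@le_trans _ _ ((t_ k)^-1%:E * (c * t_ k)%:E)%E); last first.
  by rewrite -EFinM lee_fin mulrCA mulVf ?mulr1// gt_eqF.
rewrite lee_wpmul2l ?lee_fin ?invr_ge0 ?(ltW (t_gt0 k))//.
apply: le_trans (lee_abs _) _; apply: le_trans (le_abse_integral _ _ _) _ => //.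
  by apply/measurable_EFinP; apply: measurable_funB; exact: measurable_funM.
apply: (@le_trans _ _ (\int[leb]_(x in inner Omega d) `|f (x - w k)%R - f x|%:E)%E).
  rewrite [leRHS]integral_mkcond; apply: ge0_le_integralT => //.
  - apply/measurable_EFinP; apply: measurableT_comp => //.
    by apply: measurable_funB; exact: measurable_funM.
  - apply/(measurable_restrictT _ (measurable_inner _ _)); apply: measurable_funTS.
    apply/measurable_EFinP; apply: measurableT_comp => //.
    exact: measurable_funB.
  - by move=> x; rewrite /patch; case: ifP => // _; rewrite lee_fin.
  move=> x _; rewrite /patch; case: ifPn => [_|].
    by rewrite /= lee_fin /G' /H -mulrBl normrM ler_piMr.
  by rewrite notin_setE => /psi0 px; rewrite /= /G' /H px !mulr0 subrr normr0.
apply: le_trans (fc _ _ _) _; first by rewrite normrN.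
by rewrite lee_fin ler_wpM2l// normrN.
Qed.

Lemma variation_le Omega f (M c : R) : open Omega ->
  (leb Omega < +oo)%E -> measurable_fun setT f -> (forall x, `|f x| <= M) ->
  0 <= c ->
  (forall (d : R) z, `|z| < d ->
    (\int[leb]_(x in inner Omega d) `|f (x + z)%R - f x|%:E <= (c * `|z|)%:E)%E) ->
  (Defs.variation Omega f <= (n%:R * c)%:E)%E.
Proof.
move=> oO fO mf fM c0 fc; apply: ub_ereal_sup => _ [phi [phiC1 sphi phi1] <-].
have H i := @directional_bound _ _ _ _ _ i oO fO mf fM c0 fc phiC1 sphi phi1.
have -> : (\int[leb]_(x in Omega) (f x * divergence phi x)%:E =
    \int[leb]_(x in Omega) \sum_(i < n) (f x * partial i phi x ord0 i)%:E)%E.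
  by apply: eq_integral => x _; rewrite /divergence mulr_sumr sumEFin.
rewrite integral_sum//; last 2 first.
- exact: open_measurable_rV.
- by move=> i; have [] := H i.
apply: (@le_trans _ _ (\sum_(i < n) c%:E)%E).
  by apply: lee_sum => i _; have [] := H i.
by rewrite sumEFin lee_fin sumr_const card_ord mulr_natl.
Qed.

(** Replacing [E] by [E_ k] costs at most [leb (E_ k `+` E)] at [x] and as much at
[x + z]. *)
Lemma shift_diff_limit Omega (c1 : R) (E_ : nat -> set T) (E : set T) (r_ : nat -> R) :
  (forall k, measurable (E_ k)) -> measurable E ->
  r_ k @[k --> \oo] --> 0 -> leb (E_ k `+` E) @[k --> \oo] --> 0%E ->
  (forall k (delta : R) z, `|z| + r_ k < delta ->
    (shift_diff (inner Omega delta) (E_ k) z <= (c1 * (8 * `|z| + r_ k))%:E)%E) ->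
  forall (delta : R) z, `|z| < delta ->
    (shift_diff (inner Omega delta) E z <= (c1 * (8 * `|z|))%:E)%E.
Proof.
move=> mE_ mE rcvg Ecvg H delta z zd.
have mD := measurable_inner Omega delta.
have mS k : measurable (E_ k `+` E) by exact: measurable_symdiff.
pose S k x : \bar R := (\1_(E_ k `+` E) x)%:E.
have mSk k : measurable_fun setT (S k).
  by apply/measurable_EFinP; exact: measurable_indic.
have Sint k : (\int[leb]_x S k x = leb (E_ k `+` E))%E.
  by rewrite integral_indic// setIT.
have le1 k : (shift_diff (inner Omega delta) E z <=
    shift_diff (inner Omega delta) (E_ k) z + (leb (E_ k `+` E) + leb (E_ k `+` E)))%E.
  apply: (@le_trans _ _ (\int[leb]_(x in inner Omega delta)
      (`|\1_(E_ k) (x + z)%R - \1_(E_ k) x|%:E + (S k (x + z)%R + S k x)))%E).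
    apply: ge0_le_integralT => //.
    - exact: emeasurable_diff_indic.
    - apply: emeasurable_funD; first exact: emeasurable_diff_indic.
      by apply: emeasurable_funD => //; exact: emeasurable_comp_shift.
    - by move=> x; rewrite /S -!EFinD lee_fin !addr_ge0.
    move=> x _; rewrite /S -!EFinD lee_fin.
    have D y : `|\1_E y - \1_(E_ k) y| <= \1_(E_ k `+` E) y :> R.
      by rewrite distrC dist_indic.
    have -> : \1_E (x + z) - \1_E x = (\1_(E_ k) (x + z) - \1_(E_ k) x) +
        ((\1_E (x + z) - \1_(E_ k) (x + z)) - (\1_E x - \1_(E_ k) x)) :> R by ring.
    apply: le_trans (ler_normD _ _) _; rewrite lerD2l.
    by apply: le_trans (ler_normB _ _) _; rewrite lerD.
  have S0 k' x : (0 <= S k' x)%E by rewrite lee_fin.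
  rewrite ge0_integralDT//; last 3 first.
  - exact: emeasurable_diff_indic.
  - by apply: emeasurable_funD => //; exact: emeasurable_comp_shift.
  - by move=> x; rewrite adde_ge0.
  rewrite ge0_integralDT//; last exact: emeasurable_comp_shift.
  rewrite leeD2l// leeD// -Sint; last exact: ge0_subset_integral.
  exact: ge0_integral_shift_le.
have le2 : \forall k \near \oo, (shift_diff (inner Omega delta) E z <=
    (c1 * (8 * `|z| + r_ k))%:E + (leb (E_ k `+` E) + leb (E_ k `+` E)))%E.
  have dz : 0 < delta - `|z| by lra.
  move/cvgrPdist_lt : rcvg => /(_ _ dz); apply: filterS => k rk.
  apply: le_trans (le1 k) _; rewrite leeD2r// H//.
  by move: rk; rewrite sub0r normrN => /(le_lt_trans (ler_norm _)); lra.
apply: (cvge_to_ge _ le2).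
rewrite -[X in _ --> X]adde0; apply: cvgeD => //.
  apply: cvg_EFin; first exact: nearW.
  apply: cvgMl_tmp; rewrite -[X in _ --> X]addr0; apply: cvgD => //.
  exact: cvg_cst.
by rewrite -[X in _ --> X]adde0; apply: cvgeD.
Qed.

End variation_bound.

(** * The double well *)

Section double_well.
Context {R : realType}.
Variables (W : R -> R) (alpha beta : R).
Hypotheses (ab : alpha < beta) (cW : continuous W) (W_ge0 : forall s, 0 <= W s).
Hypothesis W_zero : forall s, W s = 0 -> s = alpha \/ s = beta.

Let mid : R := (alpha + beta) / 2.

Definition well (s : R) : R := if mid < s then beta else alpha.

Lemma segment_lower_bound (a b : R) : (forall s, a <= s <= b -> s != alpha /\ s != beta) ->
  exists2 w : R, 0 < w & forall s, a <= s <= b -> w <= W s.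
Proof.
move=> H; have [ab'|ba] := leP a b; last first.
  by exists 1 => // s /andP[as1 sb]; have := lt_le_trans ba (le_trans as1 sb); rewrite ltxx.
have [|c cI cP] := EVT_min ab' (f := W); first exact: continuous_subspaceT.
rewrite in_itv/= in cI; have [ca cb] := H c cI.
exists (W c); last by move=> s sI; apply: cP; rewrite in_itv.
rewrite lt_neqAle W_ge0 andbT eq_sym; apply/eqP => /W_zero.
by case; apply/eqP.
Qed.

Lemma band_lower_bound : exists2 w : R, 0 < w &
  forall s, `|s - mid| <= (beta - alpha) / 4 -> w <= W s.
Proof.
have [|w w0 wP] := @segment_lower_bound (mid - (beta - alpha) / 4)
    (mid + (beta - alpha) / 4).
  move=> s /andP[s1 s2]; move: ab s1 s2; rewrite /mid => ab' s1 s2.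
  by split; apply/eqP => sE; lra.
by exists w => // s; rewrite ler_distl => /wP.
Qed.

Hypothesis W_growth :
  exists c M : R, 0 < c /\ forall s, M <= `|s| -> c * `|s| <= W s.

(** Within [e] of a well the first term suffices. The other points are either far
out, where [W] dominates [|s|], or in three compact intervals without wells,
where [W] is bounded below. *)
Lemma well_dist_le (e : R) : 0 < e -> exists2 C : R, 0 <= C &
  forall s, `|s - well s| <= e + C * W s.
Proof.
move=> e0; have [c [M [c0 cM]]] := W_growth.
pose A := `|alpha| + `|beta|; pose M' := `|M| + A + 1.
have A0 : 0 <= A by rewrite addr_ge0.
have dA s : `|s - well s| <= `|s| + A.
  apply: le_trans (ler_normB _ _) _; rewrite lerD2l /well /A.
  by case: ifP => _; rewrite ?lerDl ?lerDr.
have [|w1 w10 w1P] := @segment_lower_bound (- M') (alpha - e).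
  by move=> s /andP[_ se]; split; apply/eqP => sE; move: ab e0 se; lra.
have [|w2 w20 w2P] := @segment_lower_bound (alpha + e) (beta - e).
  by move=> s /andP[s1 se]; split; apply/eqP => sE; move: ab e0 se s1; lra.
have [|w3 w30 w3P] := @segment_lower_bound (beta + e) M'.
  by move=> s /andP[se _]; split; apply/eqP => sE; move: ab e0 se; lra.
have M'0 : 0 < M' by rewrite ltr_wpDl// addr_ge0.
have q0 w : 0 < w -> 0 <= (M' + A) / w.
  by move=> ?; rewrite divr_ge0// ?addr_ge0// ltW.
pose C := 2 / c + (M' + A) / w1 + (M' + A) / w2 + (M' + A) / w3.
have c20 : 0 <= 2 / c by rewrite divr_ge0// ltW.
have h1 := q0 _ w10; have h2 := q0 _ w20; have h3 := q0 _ w30.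
have C1' : 2 / c <= C by rewrite /C; lra.
have C2 : (M' + A) / w1 <= C by rewrite /C; lra.
have C3 : (M' + A) / w2 <= C by rewrite /C; lra.
have C4 : (M' + A) / w3 <= C by rewrite /C; lra.
have C0 : 0 <= C by exact: le_trans C1'.
exists C => // s.
have [sM|/ltW Ms] := leP `|s| M'; last first.
  have Ms' : M <= `|s|.
    by apply: le_trans (ler_norm _) _; apply: le_trans Ms; rewrite /M'; lra.
  apply: le_trans (dA s) _; apply: (@le_trans _ _ (2 * `|s|)).
    have : A <= `|s| by apply: le_trans Ms; have := normr_ge0 M; rewrite /M'; lra.
    by lra.
  apply: (@le_trans _ _ (2 / c * W s)); last first.
    by apply: (@le_trans _ _ (C * W s)); [rewrite ler_wpM2r|rewrite lerDr ltW].
  by have := cM s Ms'; rewrite mulrAC ler_pdivlMr// => h; lra.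
have [es|/ltW es] := leP `|s - well s| e.
  by apply: le_trans es _; rewrite lerDl mulr_ge0.
have core w : 0 < w -> (M' + A) / w <= C -> w <= W s -> `|s - well s| <= e + C * W s.
  move=> w0 wC wW; apply: le_trans (dA s) _; apply: (@le_trans _ _ (C * W s)); last first.
    by rewrite lerDr ltW.
  apply: (@le_trans _ _ ((M' + A) / w * w)).
    by rewrite divfK ?gt_eqF// lerD2r.
  by rewrite ler_pM// ?q0// ltW.
move: sM; rewrite ler_norml => /andP[sM1 sM2].
have {}core : (s <= alpha - e \/ (alpha + e <= s /\ s <= beta - e)) \/ beta + e <= s ->
    `|s - well s| <= e + C * W s.
  case=> [[sI|[sI1 sI2]]|sI].
  - by apply: (core w1) => //; apply: w1P; rewrite sM1.
  - by apply: (core w2) => //; apply: w2P; rewrite sI1.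
  - by apply: (core w3) => //; apply: w3P; rewrite sI.
apply: core; move: es; rewrite /well /mid; case: ltP => sm; rewrite ler_normr.
  by case/orP => h; [right|left; right]; [|split]; move: ab e0 sm h; lra.
by case/orP => h; [left; right; split|left; left]; move: ab e0 sm h; lra.
Qed.

End double_well.

(** * Densities as measures *)

Section density_measure.
Context {R : realType} {n : nat}.
Local Notation T := 'rV[R]_n.
Local Notation leb := (@lebesgue_rV R n).
Variables (Omega : set T) (f : T -> R).
Hypotheses (mO : measurable Omega) (mf : measurable_fun Omega f).
Hypothesis f0 : forall x, Omega x -> 0 <= f x.

(** The [let] turns the hypotheses into parameters of this alias of [density], as its
measure structure depends on them. *)
Definition density_measure := let _ := (mO, mf, f0) in density Omega f.

Let density0 : density_measure set0 = 0%E.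
Proof. by rewrite /density_measure/= /density setI0 integral_set0. Qed.

Let density_ge0 A : (0 <= density_measure A)%E.
Proof. by apply: integral_ge0 => x [/f0 ? _]; rewrite lee_fin. Qed.

Let density_sigma_additive : semi_sigma_additive density_measure.
Proof.
move=> F mF tF mUF.
have mOF i : measurable (Omega `&` F i) by exact: measurableI.
have -> : density_measure (\bigcup_i F i) = (\sum_(i <oo) density_measure (F i))%E.
  rewrite /density_measure/= /density setI_bigcupr ge0_integral_bigcup//.
  - apply/measurable_EFinP; apply: measurable_funS mf => //.
    by apply: bigcup_sub => i _; exact: subIsetl.
  - by move=> x [i _ [/f0 ? _]]; rewrite lee_fin.
  - exact: trivIset_setIl.
exact: is_cvg_nneseries.
Qed.

HB.instance Definition _ := isMeasure.Build _ _ _ density_measure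
  density0 density_ge0 density_sigma_additive.

Lemma density_is_measure : exists m : {measure set T -> \bar R},
  (m : set T -> \bar R) = density Omega f.
Proof. by exists density_measure. Qed.

End density_measure.

Section supported_integral.
Context {R : realType} {n : nat}.
Local Notation T := 'rV[R]_n.

Lemma integral_support (m : {measure set T -> \bar R}) (Omega : set T)
    (phi : T -> R) (C : R) : measurable Omega -> (m setT < +oo)%E ->
  continuous phi -> (forall x, `|phi x| <= C) -> (forall x, ~ Omega x -> phi x = 0) ->
  (\int[m]_(x in Omega) (phi x)%:E)%E = (\int[m]_x phi x)%:E.
Proof.
move=> mO fm cphi phiC phi0.
rewrite /Rintegral fineK; last first.
  apply: integrable_fin_num => //; apply: (@bounded_integrable _ _ _ _ _ _ C) => //.
  exact: continuous_measurable_rV.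
rewrite [LHS]integral_mkcond; apply: eq_integral => x _; rewrite /patch.
by case: ifPn => //; rewrite notin_setE => /phi0 ->.
Qed.

End supported_integral.
(** * Compactness of functions and measures *)

Section compactness_theorem.
Context {R : realType} {n : nat}.
Local Notation T := 'rV[R]_n.
Local Notation leb := (@lebesgue_rV R n).
Variables (Omega : set T) (B : R).
Hypotheses (oO : open Omega) (B0 : 0 < B) (OB : Omega `<=` cube B).

Let mO : measurable Omega. Proof. exact: open_measurable_rV. Qed.

Let fO : (leb Omega < +oo)%E.
Proof. exact: le_lt_trans (lebesgue_sub_cube mO B0 OB) (ltry _). Qed.

(** The limit obtained on the cube may charge the boundary of [Omega]; it is
restricted to [Omega], which test functions supported in [Omega] do not see. *)
Lemma density_compactness (g : nat -> T -> R) (M : R) :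
  (forall k, measurable_fun Omega (g k)) -> (forall k x, Omega x -> 0 <= g k x) ->
  (forall k, (\int[leb]_(x in Omega) (g k x)%:E <= M%:E)%E) ->
  exists2 f : nat -> nat, {homo f : i j / (i < j)%N} &
  exists mu : {measure set T -> \bar R}, radon Omega mu /\
    weak_star_cvg Omega (fun k => density Omega (g (f k))) mu.
Proof.
move=> mg g0 gM.
have [m mE] := choice (fun k => density_is_measure mO (mg k) (g0 k)).
have mT k : (m k setT <= M%:E)%E by rewrite mE /density setIT.
have [|f [fi [mu0 fmu fP]]] := @prokhorov_cube R n m M B B0 mT.
  move=> k; rewrite mE /density (_ : _ `&` _ = set0) ?integral_set0//.
  by apply/seteqP; split => // x [/OB].
exists f => //.
pose mu : {measure set T -> \bar R} := mrestr mu0 mO.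
exists mu; split.
  split; first by rewrite /mu/= /mrestr setICl measure0.
  move=> K cK _; have mK : measurable K.
    by apply: measurable_closed_rV; apply: compact_closed => //; exact: norm_hausdorff.
  apply: le_lt_trans fmu; apply: (@le_measure _ _ _ mu0); rewrite ?inE//.
  exact: measurableI.
move=> phi cphi sphi.
have [cK KO] := sphi.
have phiK x : ~ closure [set x | phi x != 0] x -> phi x = 0.
  by move=> xK; apply: contrapT => /eqP phix; apply/xK/subset_closure.
have [C _ phiC] := compact_zero_bounded cphi cK phiK.
have phi0 x : ~ Omega x -> phi x = 0 by move=> xO; apply: phiK => /KO.
have -> : (\int[mu]_(x in Omega) (phi x)%:E = (\int[mu0]_x phi x)%:E)%E.
  rewrite -(integral_support mO fmu cphi phiC phi0).
  by apply: eq_measure_integral => A mA AO; rewrite /mu/= /mrestr setIidl.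
have -> : (fun k => \int[density Omega (g (f k))]_(x in Omega) (phi x)%:E)%E =
    (fun k => (\int[m (f k)]_x phi x)%:E).
  apply/funext => k; rewrite -mE (integral_support mO _ cphi phiC phi0)//.
  by apply: le_lt_trans (mT _) _; exact: ltry.
apply: cvg_EFin; first exact: nearW.
by apply: fP => //; exists C.
Qed.

Lemma indicator_in_BV_pair (a b c : R) (E : set T) : a < b -> 0 <= c ->
  measurable E ->
  (forall (delta : R) z, `|z| < delta ->
     (shift_diff (inner Omega delta) E z <= (c * `|z|)%:E)%E) ->
  in_BV_pair Omega a b (fun x => a + (b - a) * \1_E x).
Proof.
move=> ab c0 mE H; pose v x := a + (b - a) * \1_E x : R.
have vab x : v x = a \/ v x = b.
  rewrite /v indicE; case: (_ \in _); [right|left]; rewrite /= ?mulr1 ?mulr0 ?addr0//.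
  by rewrite addrC subrK.
have mv : measurable_fun setT v.
  by apply: measurable_funD => //; apply: measurable_funM.
have vM x : `|v x| <= `|a| + `|b|.
  by case: (vab x) => ->; rewrite ?lerDl ?lerDr.
have ba : 0 <= b - a by rewrite subr_ge0 ltW.
split; last by apply: aeW => x _; exact: vab.
split.
  by apply: (@bounded_integrable _ _ _ leb Omega v (`|a| + `|b|)) => //; exact: measurable_funTS.
apply: le_lt_trans (ltry (n%:R * ((b - a) * c))).
apply: (variation_le oO fO mv vM); first exact: mulr_ge0.
move=> d z zd; rewrite -mulrA EFinM.
apply: (@le_trans _ _ ((b - a)%:E * shift_diff (inner Omega d) E z)%E); last first.
  by rewrite lee_wpmul2l ?lee_fin// H.
rewrite /shift_diff -ge0_integralZl//; last 2 first.
- exact: measurable_inner.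
- by apply: measurable_funTS; exact: emeasurable_diff_indic.
rewrite le_eqVlt; apply/orP; left; apply/eqP; apply: eq_integral => x _.
rewrite -EFinM /v opprD addrACA subrr add0r -mulrBr normrM ger0_norm//.
Qed.

(** [well alpha beta (u k)] is the value of the two-valued function attached to the
superlevel set of [u k], and its L1 distance to [u k] is at most
[e * leb Omega + D * C * eps k] for each [e], with [D] depending on [e]. *)
Lemma well_approximation (W : R -> R) (alpha beta C : R) (E : set T)
    (eps : nat -> R) (u : nat -> T -> R) : alpha < beta ->
  continuous W -> (forall s, 0 <= W s) ->
  (forall e : R, 0 < e -> exists2 D : R, 0 <= D &
     forall s, `|s - well alpha beta s| <= e + D * W s) ->
  0 <= C -> measurable E -> E `<=` Omega ->
  (forall k, measurable_fun Omega (u k)) ->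
  (forall k, (\int[leb]_(x in Omega) (W (u k x))%:E <= (C * eps k)%:E)%E) ->
  eps k @[k --> \oo] --> 0 ->
  leb ((Omega `&` [set x | (alpha + beta) / 2 < u k x]) `+` E) @[k --> \oo] --> 0%E ->
  L1_norm Omega (u k \- (fun x => alpha + (beta - alpha) * \1_E x)) @[k --> \oo] --> 0%E.
Proof.
move=> ab cW W0 HW C0 mE EO mu uW ecvg Ecvg.
pose Ek k := Omega `&` [set x | (alpha + beta) / 2 < u k x].
have mEk k : measurable (Ek k) by exact: measurable_superlevel.
have mS k : measurable (Ek k `+` E) by exact: measurable_symdiff.
have mWu k : measurable_fun Omega (fun x => W (u k x)).
  exact: (measurableT_comp (continuous_measurable_fun cW) (mu k)).
have ba : 0 < beta - alpha by rewrite subr_gt0.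
have key k (e D : R) : 0 < e -> 0 <= D ->
    (forall s, `|s - well alpha beta s| <= e + D * W s) ->
    (L1_norm Omega (u k \- (fun x => alpha + (beta - alpha) * \1_E x))%R <=
     e%:E * leb Omega + D%:E * (C * eps k)%:E +
     (beta - alpha)%:E * leb (Ek k `+` E))%E.
  move=> e0 D0 HD; rewrite /L1_norm.
  have mind : measurable_fun Omega (fun x => ((beta - alpha) * \1_(Ek k `+` E) x)%:E).
    by apply: measurable_funTS; apply/measurable_EFinP; apply: measurable_funM.
  have mDW : measurable_fun Omega (fun x => (D * W (u k x))%:E).
    by apply/measurable_EFinP; apply: measurable_funM.
  apply: (@le_trans _ _ (\int[leb]_(x in Omega) ((cst e%:E x + (D * W (u k x))%:E) +
      ((beta - alpha) * \1_(Ek k `+` E) x)%:E))%E).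
    apply: ge0_le_integral => //.
    - apply/measurable_EFinP; apply: measurableT_comp => //; apply: measurable_funB => //.
      by apply: measurable_funTS; apply: measurable_funD => //; apply: measurable_funM.
    - by apply: emeasurable_funD => //; apply: emeasurable_funD.
    move=> x Ox; rewrite -!EFinD lee_fin /=.
    apply: le_trans (ler_distD (well alpha beta (u k x)) _ _) _.
    apply: lerD; first exact: HD.
    have -> : well alpha beta (u k x) = alpha + (beta - alpha) * \1_(Ek k) x.
      rewrite /well indicE; case: ifPn => um; last first.
        by rewrite memNset ?mulr0 ?addr0// => -[_]; exact/negP.
      by rewrite mem_set ?mulr1 1?addrC ?subrK.
    by rewrite opprD addrACA subrr add0r -mulrBr normrM gtr0_norm// dist_indic.
  have s0 x : (0 <= (D * W (u k x))%:E)%E by rewrite lee_fin mulr_ge0.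
  have i0 x : (0 <= ((beta - alpha) * \1_(Ek k `+` E) x)%:E)%E.
    by rewrite lee_fin mulr_ge0// ltW.
  have ce0 (x : T) : (0 <= (cst e%:E : T -> \bar R) x)%E by rewrite lee_fin ltW.
  rewrite ge0_integralD//; last 2 first.
  - by move=> x _; rewrite adde_ge0.
  - exact: emeasurable_funD.
  rewrite ge0_integralD// integral_cst_leb//.
  rewrite leeD//.
    rewrite leeD2l//; under eq_integral do rewrite EFinM.
    rewrite ge0_integralZl//; last 2 first.
    - exact/measurable_EFinP.
    - by move=> x _; rewrite lee_fin.
    by rewrite lee_wpmul2l.
  under eq_integral do rewrite EFinM.
  rewrite ge0_integralZl//; last 2 first.
  - by apply: measurable_funTS; apply/measurable_EFinP; exact: measurable_indic.
  - by rewrite lee_fin ltW.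
  rewrite lee_wpmul2l ?lee_fin ?(ltW ba)// integral_indic//.
  by apply: le_measure; rewrite ?inE//; exact: measurableI.
apply: cvge0P => [k|e e0]; first by apply: integral_ge0.
pose V := fine (leb Omega).
have VE : leb Omega = V%:E by rewrite fineK// ge0_fin_numE.
have V0 : 0 <= V by rewrite fine_ge0.
pose h := e / (3 * (V + 1)).
have h0 : 0 < h by rewrite divr_gt0// mulr_gt0// ltr_wpDl.
have [D D0 HD] := HW _ h0.
have e1 : 0 < e / (3 * (D * C + 1)).
  by rewrite divr_gt0// mulr_gt0// ltr_wpDl// mulr_ge0.
have e2 : 0 < e / (3 * (beta - alpha)) by rewrite divr_gt0// mulr_gt0.
have third (a : R) : 0 <= a -> e / (3 * (a + 1)) * a <= e / 3.
  move=> a0; have a1 : 0 < a + 1 by rewrite ltr_wpDl.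
  have -> : e / (3 * (a + 1)) * a = e / 3 * (a / (a + 1)) by field; rewrite gt_eqF.
  by rewrite ler_piMr ?divr_ge0 ?(ltW e0)// ler_pdivrMr// mul1r lerDl.
have hV : h * V <= e / 3 by exact: third.
have H1 : \forall k \near \oo, D * (C * eps k) <= e / 3.
  move/cvgrPdist_lt : ecvg => /(_ _ e1); apply: filterS => k.
  rewrite sub0r normrN => /(le_lt_trans (ler_norm _)) /ltW ek.
  apply: le_trans (third (D * C) (mulr_ge0 D0 C0)).
  by rewrite mulrA mulrC ler_wpM2r// mulr_ge0.
have H2 : \forall k \near \oo,
    ((beta - alpha)%:E * leb (Ek k `+` E) <= (e / 3)%:E)%E.
  move/fine_cvgP : Ecvg => [fE /cvgrPdist_lt/(_ _ e2) cE].
  near=> k.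
  have f1 : leb (Ek k `+` E) \is a fin_num by near: k.
  rewrite -(fineK f1) -EFinM lee_fin.
  have : `|0 - fine (leb (Ek k `+` E))| < e / (3 * (beta - alpha)) by near: k.
  rewrite sub0r normrN => /(le_lt_trans (ler_norm _)).
  by rewrite invfM mulrA ltr_pdivlMr// mulrC => /ltW.
near=> k.
apply: le_trans (key k h D h0 D0 HD) _.
have -> : e = e / 3 + e / 3 + e / 3 by field.
rewrite !EFinD VE -!EFinM leeD//; last by near: k.
by rewrite -EFinD lee_fin lerD//; near: k.
Unshelve. all: end_near. Qed.


(** The radii [r_ k] tend to 0 because their squares are at most [4 * eps k], so the
bound on translations becomes linear for the limit set. *)
Lemma phase_compactness (W : R -> R) (alpha beta C : R) (eps : nat -> R)
    (u : nat -> T -> R) : (0 < n)%N -> alpha < beta ->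
  continuous W -> (forall s, 0 <= W s) ->
  (forall s, W s = 0 -> s = alpha \/ s = beta) -> 0 <= C ->
  (forall k, 0 < eps k) -> (forall k, eps k <= 4^-1) ->
  eps k @[k --> \oo] --> 0 ->
  (forall k, measurable_fun Omega (u k)) ->
  (forall k, (\int[leb]_(x in Omega) (W (u k x))%:E <= (C * eps k)%:E)%E) ->
  (forall k, (\int[leb]_(x in Omega) fractional_density Omega (u k) x <=
     (C * `|ln (eps k)|)%:E)%E) ->
  exists2 f : nat -> nat, {homo f : i j / (i < j)%N} &
  exists E : set T, [/\ measurable E, E `<=` Omega,
    leb ((Omega `&` [set x | (alpha + beta) / 2 < u (f k) x]) `+` E)
      @[k --> \oo] --> 0%E &
    exists2 c, 0 <= c & forall (delta : R) z, `|z| < delta ->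
     (shift_diff (inner Omega delta) E z <= (c * `|z|)%:E)%E].
Proof.
move=> n0 ab cW W0 Wz C0 eps0 eps4 ecvg mu uW uF.
have [w w0 wP] := band_lower_bound ab cW W0 Wz.
have d0 : 0 < (beta - alpha) / 4 by rewrite divr_gt0// subr_gt0.
have [c1 c10 H] := energy_shift_estimate n0 mO (continuous_measurable_fun cW) W0 d0 w0 wP C0.
have /choice[r_ rP] k := H _ _ (eps0 k) (eps4 k) (mu k) (uW k) (uF k).
pose E_ k := Omega `&` [set x | (alpha + beta) / 2 < u k x].
have mE k : measurable (E_ k) by exact: measurable_superlevel.
have r_gt0 k : 0 < r_ k by have [] := rP k.
have r_cvg : r_ k @[k --> \oo] --> 0.
  apply/cvgrPdist_lt => e e0.
  have e24 : 0 < e ^+ 2 / 4 by rewrite divr_gt0// exprn_gt0.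
  move/cvgrPdist_lt : ecvg => /(_ _ e24); apply: filterS => k.
  rewrite !sub0r !normrN (gtr0_norm (eps0 k)) (gtr0_norm (r_gt0 k)) => ek.
  have [_ rk _] := rP k.
  rewrite -(ltr_pXn2r (ltn0Sn 1)) ?nnegrE ?ltW//.
  by apply: le_lt_trans rk _; move: ek; lra.
have shiftE k delta z : `|z| + r_ k < delta ->
    (shift_diff (inner Omega delta) (E_ k) z <= (c1 * (8 * `|z| + r_ k))%:E)%E.
  by have [_ _] := rP k; apply.
have EO k : E_ k `<=` Omega by move=> x [].
have [f fi [E [mEE EEO Ecvg]]] := shift_compactness oO B0 OB mE EO c10 r_cvg shiftE.
exists f => //; exists E; split => //.
exists (c1 * 8); first by rewrite mulr_ge0.
move=> delta z zd; rewrite -mulrA.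
apply: (shift_diff_limit (fun k => mE (f k)) mEE _ Ecvg) zd.
- exact: cvg_comp (subseq_cvgy fi) r_cvg.
- by move=> k; exact: shiftE.
Qed.

End compactness_theorem.

Lemma ereal_sup_lty_bound {R : realType} (a : nat -> \bar R) :
  (ereal_sup (range a) < +oo)%E -> exists2 C : R, 0 <= C & forall k, (a k <= C%:E)%E.
Proof.
move=> aoo; have ak k : (a k <= ereal_sup (range a))%E.
  by apply: ereal_sup_ubound; exists k.
case: (ereal_sup _) aoo ak => [r _ ak|//|_ ak].
  exists `|r| => // k; apply: le_trans (ak k) _; rewrite lee_fin; exact: ler_norm.
by exists 0 => // k; apply: le_trans (ak k) _; exact: leNye.
Qed.

Lemma energy_bounds {R : realType} {n : nat} (Omega : set 'rV[R]_n) (W : R -> R)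
    (eps C : R) (u rho : 'rV[R]_n -> R) :
  (forall s, 0 <= W s) -> 0 < eps -> ln eps != 0 ->
  (energy W Omega eps u rho <= C%:E)%E ->
  (\int[lebesgue_rV n]_(x in Omega) (W (u x))%:E <= (C * eps)%:E)%E /\
  (\int[lebesgue_rV n]_(x in Omega) fractional_density Omega u x <=
    (C * `|ln eps|)%:E)%E.
Proof.
move=> W0 e0 lne; rewrite /energy.
set I1 := (\int[_]_(_ in _) (W _)%:E)%E; set I2 := (\int[_]_(_ in _) fractional_density _ _ _)%E.
set I3 := (\int[_]_(_ in _) `|_|)%E => H.
have I10 : (0 <= I1)%E by apply: integral_ge0 => x _; rewrite lee_fin.
have I20 : (0 <= I2)%E.
  apply: integral_ge0 => x _; apply: integral_ge0 => y _.
  by rewrite lee_fin divr_ge0 ?sqr_ge0 ?exprn_ge0 ?sqrtr_ge0.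
have I30 : (0 <= I3)%E by apply: integral_ge0.
have l0 : 0 < `|ln eps| by rewrite normr_gt0.
have i1 : (0 <= (eps^-1)%:E * I1)%E by rewrite mule_ge0// lee_fin invr_ge0 ltW.
have i2 : (0 <= (`|ln eps|^-1)%:E * I2)%E by rewrite mule_ge0// lee_fin invr_ge0.
have i3 : (0 <= (`|ln eps|^-1)%:E * I3)%E by rewrite mule_ge0// lee_fin invr_ge0.
have div (r : R) I : 0 < r -> ((r^-1)%:E * I <= C%:E)%E -> (I <= (C * r)%:E)%E.
  move=> r0 h; have : (r%:E * (r^-1%:E * I) <= r%:E * C%:E)%E.
    by rewrite lee_wpmul2l// lee_fin ltW.
  by rewrite muleA -EFinM divff ?gt_eqF// mul1e -EFinM mulrC.
split; apply: div => //; apply: le_trans H.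
  by rewrite -addeA leeDl// adde_ge0.
by apply: (@le_trans _ _ ((eps^-1)%:E * I1 + (`|ln eps|^-1)%:E * I2)%E);
  [exact: leeDr|exact: leeDl].
Qed.

Theorem theorem2p1 (R : realType) (N : nat) (hN : (2 <= N)%N)
  (Omega : set 'rV[R]_N) (hOmega : regular_bounded_domain Omega)
  (alpha beta : R) (hab : alpha < beta)
  (W : R -> R) (W_cont : continuous W) (W_ge0 : forall s, 0 <= W s)
  (W_zero : forall s, W s = 0 <-> s = alpha \/ s = beta)
  (W_growth : exists c M : R, 0 < c /\ forall s, M <= `|s| -> c * `|s| <= W s)
  (eps : nat -> R) (eps_gt0 : forall h, 0 < eps h)
  (eps_cvg0 : eps h @[h --> \oo] --> 0)
  (u rho : nat -> 'rV[R]_N -> R)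
  (u_L1 : forall h, in_L1 Omega (u h))
  (rho_L1 : forall h, in_L1 Omega (rho h))
  (rho_ge0 : forall h x, Omega x -> 0 <= rho h x)
  (rho_bound : (ereal_sup (range (fun h =>
     L1_norm Omega (fun x => rho h x / ln (eps h))%R)) < +oo)%E)
  (energy_bound : (ereal_sup (range (fun h =>
     energy W Omega (eps h) (u h) (rho h))) < +oo)%E) :
  exists sigma : nat -> nat, {homo sigma : i j / (i < j)%N} /\
    (exists v : 'rV[R]_N -> R, in_BV_pair Omega alpha beta v /\
       L1_norm Omega (u (sigma k) \- v) @[k --> \oo] --> 0%E) /\
    (exists mu : {measure set 'rV[R]_N -> \bar R}, radon Omega mu /\
       weak_star_cvg Omega
         (fun k => density Omega
            (fun x => rho (sigma k) x / `|ln (eps (sigma k))|)) mu).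
Proof.
have [oO _ _ [B0 [_ BP]] _] := hOmega.
pose B := `|B0| + 1.
have B_gt0 : 0 < B by rewrite ltr_wpDl.
have OB : Omega `<=` cube B.
  by apply: BP; rewrite (le_lt_trans (ler_norm _))// ltrDl.
have [C C0 CP] := ereal_sup_lty_bound energy_bound.
have [M M0 MP] := ereal_sup_lty_bound rho_bound.
(* From the index [K] on, [eps <= 4^-1], so that the logarithm does not vanish. *)
have [K KP] : exists K, forall k, eps (k + K)%N <= 4^-1.
  have q4 : 0 < 4^-1 :> R by rewrite invr_gt0.
  move/cvgrPdist_le : eps_cvg0 => /(_ _ q4)[K _ KP]; exists K => k.
  have := KP (k + K)%N (leq_addl _ _).
  by rewrite sub0r normrN; apply: le_trans; exact: ler_norm.
have mu k : measurable_fun Omega (u k).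
  by apply/measurable_EFinP; case/integrableP : (u_L1 k).
have mrho k : measurable_fun Omega (rho k).
  by apply/measurable_EFinP; case/integrableP : (rho_L1 k).
have lnN k : ln (eps (k + K)%N) < 0.
  apply: ln_lt0; rewrite eps_gt0/= (le_lt_trans (KP k))//.
  by rewrite invf_lt1// ltr1n.
have eK_cvg : eps (k + K)%N @[k --> \oo] --> 0.
  exact: cvg_comp (cvg_addnr K) eps_cvg0.
have EB k := @energy_bounds _ _ Omega W (eps (k + K)%N) C (u (k + K)%N) (rho (k + K)%N)
  W_ge0 (eps_gt0 _) (ltr0_neq0 (lnN k)) (CP (k + K)%N).
have W_zero' s : W s = 0 -> s = alpha \/ s = beta by move/W_zero.
have [f fi [E [mE EO Ecvg [c c0 Hc]]]] := phase_compactness oO B_gt0 OB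
  (ltnW hN) hab W_cont W_ge0 W_zero' C0 (fun k => eps_gt0 (k + K)%N) KP
  eK_cvg (fun k => mu (k + K)%N) (fun k => (EB k).1) (fun k => (EB k).2).
have lg0 k : 0 < `|ln (eps (f k + K)%N)| by rewrite normr_gt0 lt_eqF.
have [k|k x Ox|k|g gi [nu [rnu wnu]]] := @density_compactness R N Omega B oO B_gt0 OB
  (fun k x => rho (f k + K)%N x / `|ln (eps (f k + K)%N)|) M.
- by apply: measurable_funM.
- by rewrite divr_ge0 ?rho_ge0// ltW.
- apply: le_trans (MP (f k + K)%N); rewrite /L1_norm le_eqVlt; apply/orP; left.
  apply/eqP; apply: eq_integral => x /set_mem Ox.
  by rewrite /= normrM normfV (ger0_norm (rho_ge0 _ _ Ox)).
have fg i j : (i < j)%N -> (f (g i) < f (g j))%N by move=> ij; exact/fi/gi.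
have fgy := subseq_cvgy fg.
have vBV := indicator_in_BV_pair oO B_gt0 OB hab c0 mE Hc.
exists (fun k => (f (g k) + K)%N); split.
  by move=> i j ij; rewrite ltn_add2r; exact: fg.
split; last by exists nu.
exists (fun x => alpha + (beta - alpha) * \1_E x); split.
  exact: vBV.
apply: (@well_approximation R N Omega B oO B_gt0 OB W alpha beta C E
  (fun k => eps (f (g k) + K)%N) (fun k => u (f (g k) + K)%N)) => //.
- by move=> e e0; exact: well_dist_le.
- by move=> k; have [] := EB (f (g k)).
- exact: cvg_comp fgy eK_cvg.
- exact: cvg_comp (subseq_cvgy gi) Ecvg.
Qed.
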